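(* Let $\rho:\Gamma\rightarrow \mathrm{SL}(2,\mathbf C)$ be a $\tau$-representation, where $\tau\in\mathbf C$, $\tau\neq\pm2$, and let $\nu=\cosh^{-1}(-\tau/2)$. Then $$\sum_{[g]\in\hat\Omega}{\mathfrak h}_{\tau}\big(\mathrm{tr}\,\rho[g]\big)=\nu \mod 2\pi i,$$ and the sum converges absolutely, if and only if both of the following hold: (i$'$) $\mathrm{tr}\,\rho[g]\notin(-2,2)$ for all $[g]\in\hat\Omega$, and (ii) $|\mathrm{tr}\,\rho[g]|\le 2$ for only finitely many classes $[g]\in\hat\Omega$.
   Context: $\Gamma$ is the fundamental group of the once punctured torus $\mathbb T$, a free group on two generators. A representation $\rho:\Gamma\to\mathrm{SL}(2,\mathbf C)$ is a $\tau$-representation if $\mathrm{tr}\,\rho([a,b])=\tau$ for some (hence every) pair $a,b$ of free generators of $\Gamma$, where $[a,b]=aba^{-1}b^{-1}$. Define $g\sim h$ on $\Gamma$ if $g$ is conjugate to $h$ or to $h^{-1}$. The set $\Gamma/\!\sim$ is identified with the set of free homotopy classes of unoriented closed curves on $\mathbb T$. $\hat\Omega\subset\Gamma/\!\sim$ is the subset corresponding to free homotopy classes of non-trivial, non-peripheral, unoriented simple closed curves on $\mathbb T$ (equivalently, the classes of elements of $\Gamma$ that belong to some free basis of $\Gamma$). The value $\mathrm{tr}\,\rho[g]:=\mathrm{tr}\,\rho(g)$ depends only on the class $[g]$. Branch conventions for $u\in\mathbf C$: $\sqrt u$ has positive real part if $u\notin(-\infty,0]$ and positive imaginary part if $u\in(-\infty,0)$;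 $\log u$ ($u\ne0$) has imaginary part in $(-\pi,\pi]$; $\cosh^{-1}(u)$ has real part $\ge0$ and imaginary part in $(-\pi,\pi]$, and has imaginary part in $[0,\pi]$ when its real part is $0$. Define, for $x\in\mathbf C\setminus\{0\}$, $$h(x)=\frac12\bigg(1-\sqrt{1-\frac4{x^2}}\,\bigg),$$ and, for fixed $\tau\ne\pm2$ with $\nu=\cosh^{-1}(-\tau/2)$, $${\mathfrak h}_{\tau}(x)=\log\frac{1+(e^{\nu}-1)h(x)}{1+(e^{-\nu}-1)h(x)},\qquad x\neq 0,\ \pm\sqrt{\tau+2}.$$ The statement that the sum converges absolutely to the given value includes the statement that all its terms are defined. ''$=\nu \mod 2\pi i$'' means that the sum differs from $\nu$ by an integer multiple of $2\pi i$. *)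

(* Defs.v *)
From HB Require Import structures.
From mathcomp Require Import all_boot all_order all_algebra.
From mathcomp Require Import generic_quotient complex finmap.
From mathcomp Require Import all_classical all_reals all_analysis.
From mathcomp Require summability.
From mathcomp Require Import ring lra.

Set Implicit Arguments.
Unset Strict Implicit.
Unset Printing Implicit Defensive.

Import Order.TTheory GRing.Theory Num.Theory.
Import numFieldNormedType.Exports.

Local Open Scope classical_set_scope.
Local Open Scope ring_scope.
Local Open Scope complex_scope.
Local Open Scope quotient_scope.

Local Notation Re := complex.Re.
Local Notation Im := complex.Im.

Section FreeGroup.
Variable Gamma : groupType.

(* [H] ranges over all groups, finite or not. *)
Definition free_basis (a b : Gamma) : Prop :=
  forall (H : groupType) (x y : H),
    exists! f : Gamma -> H, {morph f : g h / (g * h)%g} /\ f a = x /\ f b = y.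

Definition free_of_rank2 : Prop := exists a b, free_basis a b.

Definition conj_or_inv (g h : Gamma) : bool :=
  `[< exists k : Gamma, h = (g ^ k)%g \/ h = (g^-1 ^ k)%g >].

Lemma conj_or_inv_refl : reflexive conj_or_inv.
Proof. by move=> g; apply/asboolP; exists 1%g; left; rewrite conjg1. Qed.

Lemma conj_or_inv_sym : symmetric conj_or_inv.
Proof.
have imp g h : conj_or_inv g h -> conj_or_inv h g.
  move=> /asboolP[k [->|->]]; apply/asboolP; exists (k^-1)%g; [left|right].
    by rewrite conjgK.
  by rewrite -conjVg invgK conjgK.
by move=> g h; apply/idP/idP; apply: imp.
Qed.

Lemma conj_or_inv_trans : transitive conj_or_inv.
Proof.
move=> h g l /asboolP[j hj] /asboolP[k hk]; apply/asboolP; exists (j * k)%g.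
have VJ (x y : Gamma) : ((x ^ y)^-1 = x^-1 ^ y)%g by rewrite conjVg.
case: hj hk => -> [->|->]; rewrite ?VJ ?invgK -conjgM; by [left|right].
Qed.

Canonical conj_or_inv_equiv :=
  EquivRel conj_or_inv conj_or_inv_refl conj_or_inv_sym conj_or_inv_trans.

(* Gamma/~, the free homotopy classes of unoriented closed curves *)
Definition curve : choiceType := {eq_quot conj_or_inv}.

Definition curve_of (g : Gamma) : curve := \pi_{eq_quot conj_or_inv} g.

Definition simple_curves : set curve :=
  [set c | exists a b, free_basis a b /\ c = curve_of a].

End FreeGroup.

Section Representations.
Variables (R : realType) (Gamma : groupType).
Implicit Types rho : Gamma -> 'M[R[i]]_2.

Definition SL2_rep rho : Prop :=
  (forall g, \det (rho g) = 1) /\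
  {morph rho : g h / (g * h)%g >-> g *m h}.

Definition tau_rep (tau : R[i]) rho : Prop :=
  SL2_rep rho /\
  exists a b, free_basis a b /\ \tr (rho (a * b * a^-1 * b^-1)%g) = tau.

(* well defined on classes: see [tr_curve_of] *)
Definition tr_curve rho (c : curve Gamma) : R[i] :=
  \tr (rho (repr (c : {eq_quot @conj_or_inv Gamma}))).

Lemma tr_curve_of rho (g : Gamma) :
  SL2_rep rho -> tr_curve rho (curve_of g) = \tr (rho g).
Proof.
move=> [det1 rhoM].
have rho1 : rho 1%g = 1%:M.
  have u : rho 1%g \in unitmx by rewrite unitmxE det1 unitr1.
  have e : rho 1%g *m rho 1%g = rho 1%g by rewrite -rhoM mulg1.
  by rewrite -[LHS]mul1mx -{1}(mulVmx u) -mulmxA e mulVmx.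
have trJ h k : \tr (rho (h ^ k)%g) = \tr (rho h).
  by rewrite conjgE !rhoM mxtrace_mulC -mulmxA -rhoM mulgV rho1 mulmx1.
have trV h : \tr (rho (h^-1)%g) = \tr (rho h).
  have u : rho h \in unitmx by rewrite unitmxE det1 unitr1.
  have -> : rho (h^-1)%g = \adj (rho h).
    rewrite -[RHS]mul1mx -rho1 -(mulVg h) rhoM -mulmxA mul_mx_adj det1.
    by rewrite mulmx1.
  rewrite /mxtrace !big_ord_recl !big_ord0 !mxE /cofactor !det_mx11 !mxE /=.
  rewrite !addr0 !expr0 !mul1r addrC expr2 mulrNN !mul1r.
  by congr (_ + _); congr (rho h _ _); apply: val_inj.
rewrite /tr_curve /curve_of; set r := repr _.
have : conj_or_inv r g by apply/eqmodP; rewrite /r reprK.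
by move=> /asboolP[k [->|->]]; rewrite trJ // trV.
Qed.

End Representations.

Section ComplexFunctions.
Variable R : realType.
Implicit Types u w x z tau : R[i].

Definition cexp z : R[i] :=
  (expR (Re z))%:C * (cos (Im z) +i* sin (Im z)).

Definition carg z : R :=
  if 0 <= Im z then acos (Re z / Re `|z|) else - acos (Re z / Re `|z|).

(* principal branch: see [cexp_clog] and [Im_clog]; junk at 0 *)
Definition clog z : R[i] := ln (Re `|z|) +i* carg z.

Definition ccosh z : R[i] := (cexp z + cexp (- z)) / 2.

Definition acosh_branch u w : Prop :=
  [/\ ccosh w = u, 0 <= Re w, - pi < Im w <= pi & Re w = 0 -> 0 <= Im w].

(* there is exactly one such value: see [cacoshP] and [acosh_branch_inj] *)
Definition cacosh u : R[i] := xget 0 [set w | acosh_branch u w].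

(* [sqrtc] is the required branch of the square root: see [Re_sqrtc_gt0] and
   [Im_sqrtc_gt0] *)
Definition hfun x : R[i] := (1 - sqrtc (1 - 4 / x ^+ 2)) / 2.

Definition hfrak tau x : R[i] :=
  let nu := cacosh (- tau / 2) in
  clog ((1 + (cexp nu - 1) * hfun x) / (1 + (cexp (- nu) - 1) * hfun x)).

Definition hfrak_defined tau x : Prop :=
  [/\ x <> 0, x <> sqrtc (tau + 2) & x <> - sqrtc (tau + 2)].

(* The sum of [f] over [D], in no particular order, converges absolutely to [s].
   Writing [R[i]^o] selects the usual topology of the complex plane. *)
Definition abs_sum_to (I : choiceType) (D : set I) (f : I -> R[i]) (s : R[i]) :
    Prop :=
  summable D (fun i => (Re `|f i|)%:E) /\
  (summability.partial_sum (fun i => if i \in D then f i else 0)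
     : {fset I} -> R[i]^o) @ summability.totally --> (s : R[i]^o).

End ComplexFunctions.

Section ComplexFunctionsFacts.
Variable R : realType.
Implicit Types u w x z tau : R[i].

Lemma Re_norm (a b : R) : Re `|a +i* b| = Num.sqrt (a ^+ 2 + b ^+ 2).
Proof. by []. Qed.

Lemma Re_sqrtc_gt0 z : ~~ (z <= 0) -> 0 < Re (sqrtc z).
Proof.
case: z => a b; rewrite lecE /= sqrtr_gt0 negb_and => h.
rewrite divr_gt0 // -ltrBlDr sub0r.
have [b0|b0] := eqVneq b 0.
  move: h; rewrite b0 eqxx /= -ltNge => a0.
  by rewrite expr0n addr0 sqrtr_sqr gtr0_norm //; lra.
apply: (le_lt_trans (y := `|a|)); first by rewrite -normrN ler_norm.
have b2 : 0 < b ^+ 2 by rewrite exprn_even_gt0.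
have ab : 0 < a ^+ 2 + b ^+ 2 by rewrite ltr_wpDl ?sqr_ge0.
by rewrite -sqrtr_sqr (ltr_sqrt _ ab) ltrDl.
Qed.

Lemma Im_sqrtc_gt0 z : z < 0 -> 0 < Im (sqrtc z).
Proof.
case: z => a b; rewrite ltcE /= => /andP[/eqP<- a0].
rewrite eqxx mul1r sqrtr_gt0 expr0n addr0 sqrtr_sqr ltr0_norm //; lra.
Qed.

Lemma cexpD z w : cexp (z + w) = cexp z * cexp w.
Proof.
case: z w => [a b] [c d]; rewrite /cexp /= expRD cosD sinD; simpc.
by congr (_ +i* _); ring.
Qed.

Lemma cexp0 : cexp 0 = 1 :> R[i].
Proof. by rewrite /cexp /= expR0 cos0 sin0; simpc. Qed.

Lemma cexpN_mul z : cexp z * cexp (- z) = 1.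
Proof. by rewrite -cexpD subrr cexp0. Qed.

Lemma cexp_neq0 z : cexp z != 0.
Proof.
apply/eqP => z0; have /eqP := cexpN_mul z.
by rewrite z0 mul0r eq_sym oner_eq0.
Qed.

Lemma norm_cexp z : Re `|cexp z| = expR (Re z).
Proof.
case: z => a b; rewrite /cexp /=; simpc; rewrite /=.
by rewrite !exprMn -mulrDr cos2Dsin2 mulr1 sqrtr_sqr ger0_norm ?expR_ge0.
Qed.

Lemma norm_gt0 z : z != 0 -> 0 < Re `|z|.
Proof.
rewrite -normr_gt0; case: (`|z|) => a b.
by rewrite ltcE /= => /andP[].
Qed.

Lemma sqr_norm z : Re `|z| ^+ 2 = Re z ^+ 2 + Im z ^+ 2.
Proof.
by case: z => a b; rewrite Re_norm sqr_sqrtr // addr_ge0 ?sqr_ge0.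
Qed.

Lemma carg_spec z : z != 0 ->
  [/\ - pi < carg z <= pi, Re `|z| * cos (carg z) = Re z &
      Re `|z| * sin (carg z) = Im z].
Proof.
move=> z0; have n0 := norm_gt0 z0; have n2 := sqr_norm z.
set n := Re `|z| in n0 n2 *.
have t1 : -1 <= Re z / n <= 1.
  rewrite -ler_norml -(@ler_pXn2r _ 2) ?nnegrE // expr1n real_normK ?num_real //.
  by rewrite expr_div_n ler_pdivrMr ?exprn_gt0 // mul1r n2 lerDl sqr_ge0.
have [/andP[a0 api] ca] := acos_def t1.
have pi0 := pi_gt0 R.
have sa : n * sin (acos (Re z / n)) = `|Im z|.
  rewrite sin_acos // -[X in X * _](ger0_norm (ltW n0)) -sqrtr_sqr -sqrtrM ?sqr_ge0 //.
  rewrite mulrBr mulr1 expr_div_n mulrCA divff ?expf_neq0 ?gt_eqF // mulr1.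
  by rewrite n2 addrAC subrr add0r sqrtr_sqr.
have cn : n * cos (acos (Re z / n)) = Re z.
  by rewrite ca mulrCA divff ?mulr1 ?gt_eqF.
rewrite /carg -/n; case: (leP 0 (Im z)) => h.
  split=> //; first by apply/andP; split; lra.
  by rewrite sa ger0_norm.
have apiN : acos (Re z / n) != pi.
  apply/eqP => e; move: sa; rewrite e sinpi mulr0 => /esym/eqP.
  by rewrite normr_eq0 lt_eqF.
have alt : acos (Re z / n) < pi by rewrite lt_neqAle apiN.
split; first by apply/andP; split; lra.
  by rewrite cosN.
by rewrite sinN mulrN sa ltr0_norm ?opprK.
Qed.

Lemma cexp_clog z : z != 0 -> cexp (clog z) = z.
Proof.
move=> z0; have [_ c s] := carg_spec z0.
rewrite /cexp /clog /= lnK ?posrE ?norm_gt0 //; simpc.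
by rewrite c s; case: (z).
Qed.

Lemma Im_clog z : z != 0 -> - pi < Im (clog z) <= pi.
Proof. by move=> /carg_spec[]. Qed.

Lemma cexp_inj z w : - pi < Im z <= pi -> - pi < Im w <= pi ->
  cexp z = cexp w -> z = w.
Proof.
move=> hz hw e.
have eRe : Re z = Re w by apply: expR_inj; rewrite -!norm_cexp e.
suff eIm : Im z = Im w by case: z w eRe eIm {hz hw e} => [a b] [c d] /= -> ->.
move: e; rewrite /cexp eRe; simpc => -[].
have E0 : expR (Re w) != 0 by rewrite gt_eqF ?expR_gt0.
move=> /(mulfI E0) ec /(mulfI E0) es.
have pi0 := pi_gt0 R.
have acosE (t : R) : - pi < t <= pi ->
    t = if 0 <= sin t then acos (cos t) else - acos (cos t).
  move=> /andP[t1 t2]; case: (leP 0 t) => t0.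
    by rewrite sin_ge0_pi ?t0 // cosK // in_itv /= t0.
  have : 0 < sin (- t) by apply: sin_gt0_pi; apply/andP; split; lra.
  rewrite sinN oppr_gt0 => st; rewrite leNgt st /= cosKN ?opprK //.
  by apply/andP; split; lra.
by rewrite (acosE _ hz) (acosE _ hw) ec es.
Qed.

Lemma cexp_Npi (a : R) : cexp (a -i* pi) = cexp (a +i* pi).
Proof. by rewrite /cexp /= cosN sinN sinpi oppr0. Qed.

Lemma oppcE (a b : R) : - (a +i* b) = - a +i* - b.
Proof. by []. Qed.

Lemma ccoshN z : ccosh (- z) = ccosh z.
Proof. by rewrite /ccosh opprK addrC. Qed.

Lemma ccosh_Npi (a : R) : ccosh (a -i* pi) = ccosh (a +i* pi).
Proof.
rewrite /ccosh cexp_Npi; congr ((_ + _) / _).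
by rewrite !oppcE opprK -cexp_Npi.
Qed.

Lemma acosh_branch_exists u : exists w, acosh_branch u w.
Proof.
pose s := sqrtc (u ^+ 2 - 1); have s2 : s ^+ 2 = u ^+ 2 - 1 by exact: sqr_sqrtc.
have p1 : (u + s) * (u - s) = 1.
  by rewrite mulrC -subr_sqr s2 opprB addrC subrK.
have us0 : u + s != 0.
  by apply/eqP => e; move/eqP: p1; rewrite e mul0r eq_sym oner_eq0.
have e1 := cexp_clog us0; have := Im_clog us0.
set w := clog _ in e1 * => /andP[i1 i2].
have e2 : cexp (- w) = u - s.
  by apply: (mulfI us0); rewrite p1 -e1 cexpN_mul.
have cw : ccosh w = u.
  by rewrite /ccosh e1 e2; field.
have pi0 := pi_gt0 R.
case: w => a b in i1 i2 cw {e1 e2} *; rewrite /= in i1 i2.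
have cNw : ccosh (- a -i* b) = u.
  by rewrite -cw -[RHS]ccoshN oppcE.
have [a0|a0|a0] := ltgtP a 0.
- have [bpi|bpi] := eqVneq b pi.
    exists (- a +i* pi); split=> /=; [|lra|lra|lra].
    by rewrite -ccosh_Npi -bpi.
  have bl : b < pi by rewrite lt_neqAle bpi.
  by exists (- a -i* b); split=> //=; [lra|apply/andP; split; lra|lra].
- by exists (a +i* b); split=> //=; [lra|apply/andP; split; lra|lra].
have [b0|b0] := leP 0 b.
  by exists (a +i* b); split=> //=; [lra|apply/andP; split; lra].
by exists (- a -i* b); split=> //=; [lra|apply/andP; split; lra|lra].
Qed.

Lemma cacoshP u : acosh_branch u (cacosh u).
Proof. exact: xgetPex (acosh_branch_exists u). Qed.

Lemma acosh_branch_inj u w z : acosh_branch u w -> acosh_branch u z -> w = z.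
Proof.
move=> [cw rw iw hw] [cz rz iz hz].
have two0 : (2 : R[i]) != 0 by rewrite pnatr_eq0.
have e : cexp w + cexp (- w) = cexp z + cexp (- z).
  have := etrans cw (esym cz); rewrite /ccosh => /(congr1 ( *%R^~ 2)).
  by rewrite !mulfVK.
have : (cexp w - cexp z) * (cexp w - cexp (- z)) = 0.
  rewrite mulrBl !mulrBr cexpN_mul.
  have -> : cexp w * cexp w = cexp w * (cexp z + cexp (- z)) - 1.
    by rewrite -e mulrDr cexpN_mul addrK.
  by ring.
move=> /eqP; rewrite mulf_eq0 !subr_eq0 => /orP[/eqP /cexp_inj|/eqP ew].
  exact.
have pi0 := pi_gt0 R.
have rN : Re w = - Re z.
  apply: expR_inj; rewrite -norm_cexp ew norm_cexp.
  by case: (z).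
have w0 : Re w = 0 by lra.
have z0 : Re z = 0 by lra.
move: {hw} (hw w0) {hz} (hz z0) => hw hz.
case: w z w0 z0 hw hz iw iz ew {cw cz rw rz rN e} => [a b] [c d] /= -> ->.
move=> b0 d0 /andP[b1 b2] /andP[d1 d2] ew.
have [dpi|dpi] := eqVneq d pi.
  apply: cexp_inj; rewrite /= ?b1 ?d1 //.
  by rewrite ew dpi -cexp_Npi; rewrite oppcE oppr0.
have dl : d < pi by rewrite lt_neqAle dpi.
have : 0 +i* b = - (0 +i* d).
  by apply: cexp_inj => //=; apply/andP; split; lra.
move=> /eqP; rewrite eq_complex /= => /andP[_ /eqP bd].
have b00 : b = 0 by lra.
have d00 : d = 0 by lra.
by rewrite b00 d00.
Qed.

End ComplexFunctionsFacts.

(* Main.v *)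
(* Following Bowditch.  By Nielsen's theorem every free basis is obtained from a
   fixed one (a, b) by elementary moves and conjugation, so that the simple curves
   are a, b and the products uv, where (u, v) runs through the two binary trees
   generated from (a, b) and (a^-1, b) by (u, v) |-> (u, uv) and (u, v) |-> (uv, v).
   On traces each tree becomes the recursion (x, y, z) |-> (x, w, y), (w, y, x) with
   w = xy - z, which preserves x^2 + y^2 + z^2 - xyz = mu, where mu = tau + 2.

   With eps = exp nu and P = 1 + (eps - 1) h, the function
   G(x, y, z) = (1 + (eps - 1) z/(xy)) / (P(x) P(y)) satisfies
   G(x, y, z) = exp(h_tau(w)) G(x, w, y) G(w, y, x) and
   exp(h_tau(x)) exp(h_tau(y)) G(x, y, z) G(x, y, w) = eps.  Hence the identity says
   that G(x, y, z) is the product of exp h_tau over the tree below (x, y, z).  This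
   holds when |x| and |y| are large and |z| <= |w|, because G - 1 = O(1/|xy|^2) and
   these errors decay geometrically down the tree.  If it failed somewhere, it would
   fail along an infinite path.  A path that ends in a fan around a fixed x is
   excluded by solving the linear recurrence along the fan, where G tends to 1.  On
   any other path all moduli are eventually above 2, and either they grow until the
   large case applies, or they decrease to a limit configuration with mu = 4.

   Conversely, |h_tau| is bounded below on bounded sets, so summability leaves only
   finitely many bounded traces; but a trace in (-2, 2) makes its whole fan bounded. *)

Require Import Defs.
From HB Require Import structures.
From mathcomp Require Import all_boot all_order all_algebra.
From mathcomp Require Import generic_quotient complex finmap.
From mathcomp Require Import all_classical all_reals all_analysis.
From mathcomp Require Import ring lra zify.
From mathcomp Require summability.

Set Implicit Arguments.
Unset Strict Implicit.
Unset Printing Implicit Defensive.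

Import Order.TTheory GRing.Theory Num.Theory.
Import numFieldNormedType.Exports.

Local Open Scope classical_set_scope.

(** * Nielsen's theorem for the free group of rank two *)

(** Logarithms are determined only up to their branch, so the argument is multiplicative: truncated
    sums are exponentiated and compared with [G], and the branch returns once, at the end, as a
    multiple of [2 pi i]. The shape of [G] comes from the fans: [x h(x)] and [x (1 - h(x))] are the
    roots of [X^2 - x X + 1], which governs the traces around [x]; hence [z/(xy)] tends to [h(x)]
    along a fan, and the numerator of [G] to [P(x)]. Convergence and identity form one property of
    an edge, which passes from the two edges behind it to the edge itself; this is why a failure is
    inherited along a path. Conditions (i') and (ii) must also yield that all terms are defined: if
    [x^2 = mu], the fan around [x] starts on an eigenline and contracts in one of its two
    directions, producing infinitely many small traces. That no curve is counted twice is seen in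
    homology, where the two trees give exponents of equal and of opposite signs. *)

Section Words.

(* [(i, e)] is the generator [i], inverted when [e] holds. *)
Definition letter : Type := (bool * bool)%type.
HB.instance Definition _ := Choice.on letter.
Implicit Types (x y : letter) (u v w : seq letter).

Definition linv x : letter := (x.1, ~~ x.2).

Lemma linvK : involutive linv.
Proof. by case=> a []. Qed.

Lemma linv_neq x : linv x != x.
Proof. by case: x => a []; rewrite /linv /= xpair_eqE andbF. Qed.

Definition reduced : pred (seq letter) := sorted (fun x y => y != linv x).

Definition winv w := rev (map linv w).

Definition lmul x w :=
  if w is y :: w' then if y == linv x then w' else x :: w else [:: x].

Definition wmul u v := foldr lmul v u.

(** The cancellation in [wmul u v] will be measured by [lcp (winv u) v]. *)
Fixpoint lcp u v :=
  if (u, v) is (x :: u', y :: v') then if x == y then (lcp u' v').+1 else 0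
  else 0.

Lemma size_winv w : size (winv w) = size w.
Proof. by rewrite size_rev size_map. Qed.

Lemma winvK : involutive winv.
Proof. by move=> w; rewrite /winv map_rev revK mapK //; apply: linvK. Qed.

Lemma winv_cat u v : winv (u ++ v) = winv v ++ winv u.
Proof. by rewrite /winv map_cat rev_cat. Qed.

Lemma reduced_winv w : reduced (winv w) = reduced w.
Proof.
rewrite /winv /reduced rev_sorted sorted_map.
have E : relpre linv (fun y x => y != linv x) =2 (fun x y => y != linv x).
  by move=> x y /=; rewrite linvK eq_sym -(inv_eq linvK).
by rewrite (eq_sorted E).
Qed.

Lemma reduced_lmul x w : reduced w -> reduced (lmul x w).
Proof.
case: w => //= y w; case: ifP => [_ /path_sorted //|/= ->//].
Qed.

Lemma reduced_wmul u v : reduced v -> reduced (wmul u v).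
Proof. by move=> rv; elim: u => //= x u; apply: reduced_lmul. Qed.

(** Letters act on reduced words by permutations (van der Waerden's construction of the free group);
    associativity follows from this without a discussion of cancellation. *)
Lemma lmulK x w : reduced w -> lmul x (lmul (linv x) w) = w.
Proof.
case: w => [|y w] /=; first by rewrite eqxx.
rewrite linvK; case: eqVneq => [->|yx] h; last by rewrite /= eqxx.
by case: w h => //= z w /andP[/negPf ->].
Qed.

Lemma wmul_lmul x v w : reduced w -> wmul (lmul x v) w = lmul x (wmul v w).
Proof.
move=> rw; case: v => //= y v; case: eqP => //= ->.
by rewrite lmulK // reduced_wmul.
Qed.

Lemma wmulA u v w : reduced w -> wmul u (wmul v w) = wmul (wmul u v) w.
Proof. by move=> rw; elim: u => //= x u ->; rewrite -wmul_lmul. Qed.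

Lemma wmul_reduced u v : reduced (u ++ v) -> wmul u v = u ++ v.
Proof.
elim: u => [|x u IH] //= h; rewrite IH; last exact: path_sorted h.
by case: (u ++ v) h {IH} => //= y w /andP[/negPf ->].
Qed.

Lemma wmulw0 w : reduced w -> wmul w [::] = w.
Proof. by move=> rw; rewrite wmul_reduced cats0. Qed.

Lemma wmulVw w : wmul (winv w) w = [::].
Proof.
elim: w => //= x w IH.
by rewrite /winv /= rev_cons /wmul foldr_rcons /= linvK eqxx.
Qed.

Lemma lcpC u v : lcp u v = lcp v u.
Proof. by elim: u v => [|x u IH] [|y v] //=; rewrite IH eq_sym. Qed.

Lemma lcp_size u v : lcp u v <= size u.
Proof. by elim: u v => [|x u IH] [|y v] //=; case: eqP => //= _; rewrite ltnS IH. Qed.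

Lemma lcp_sizer u v : lcp u v <= size v.
Proof. by rewrite lcpC lcp_size. Qed.

Lemma lcp_ge u v k : k <= size u -> k <= size v -> (k <= lcp u v) = (take k u == take k v).
Proof.
elim: u v k => [|x u IH] [|y v] [|k] //=; rewrite ?take0 ?eqxx //.
rewrite !ltnS => ku kv; rewrite eqseq_cons; case: eqP => //= _.
by rewrite ltnS IH.
Qed.

(** The ultrametric inequality for words; with [lcp_eq] it is the tool for comparing cancellations
    later. *)
Lemma lcp_min u v w : minn (lcp u v) (lcp v w) <= lcp u w.
Proof.
elim: u v w => [|x u IH] [|y v] [|z w] //=; rewrite ?minn0 ?min0n //.
case: (eqVneq x y) => [->|xy]; last by rewrite min0n.
case: (eqVneq y z) => [_|]; last by rewrite minn0.
by rewrite minnSS ltnS.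
Qed.

Lemma lcp_eq u v w : lcp u v < lcp v w -> lcp u w = lcp u v.
Proof.
move=> h; have := lcp_min u v w; have := lcp_min u w v; rewrite (lcpC w v).
by lia.
Qed.

Lemma reduced_catl u v : reduced (u ++ v) -> reduced u.
Proof. by case/cat_sorted2. Qed.

Lemma reduced_catr u v : reduced (u ++ v) -> reduced v.
Proof. by case/cat_sorted2. Qed.

Lemma wmulE u v : reduced u -> reduced v ->
  wmul u v = take (size u - lcp (winv u) v) u ++ drop (lcp (winv u) v) v.
Proof.
elim/last_ind: u v => [|u x IH] v ru rv.
  by case: v {rv} => //= *; rewrite drop0.
have ru' : reduced u by move: ru; rewrite -cats1 => /reduced_catl.
have -> : winv (rcons u x) = linv x :: winv u by rewrite /winv map_rcons rev_rcons.
have cat : (if v is y :: _ then y != linv x else true) ->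
    wmul (rcons u x) v = rcons u x ++ v.
  move=> h; apply: wmul_reduced; rewrite cat_rcons /reduced sorted_cat_cons.
  by apply/andP; split=> //; case: v h rv => //= y v -> ->.
case: v rv cat => [|y v] rv cat.
  by rewrite cat //= subn0 take_size.
rewrite /=; case: eqVneq => yx; last first.
  by rewrite cat ?subn0 ?take_size ?drop0 // eq_sym.
rewrite size_rcons subSS /= /wmul foldr_rcons /= yx eqxx -/(wmul u v).
rewrite IH //; last exact: path_sorted rv.
rewrite -cats1 takel_cat //; exact: leq_subr.
Qed.

Lemma size_wmul u v : reduced u -> reduced v ->
  (size (wmul u v) + (lcp (winv u) v).*2 = size u + size v)%N.
Proof.
move=> ru rv; rewrite wmulE // size_cat size_takel ?leq_subr // size_drop.
have := lcp_size (winv u) v; have := lcp_sizer (winv u) v.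
by rewrite size_winv; lia.
Qed.

Lemma nth_winv x0 w i : i < size w ->
  nth x0 (winv w) i = linv (nth x0 w (size w - i.+1)).
Proof.
move=> h; rewrite /winv nth_rev size_map // (nth_map x0) //; lia.
Qed.

(* In a longer overlap the middle of [w] would be inverse to itself or to its
   neighbour. *)
Lemma lcp_winv w : reduced w -> w != [::] -> (lcp (winv w) w).*2 < size w.
Proof.
move=> rw w0; rewrite ltnNge; apply/negP => h.
have s0 : 0 < size w by case: (w) w0.
pose x0 : letter := (true, true).
set k := lcp _ _ in h.
have kw : k <= size w by apply: lcp_sizer.
have key i : i < k -> nth x0 w i = linv (nth x0 w (size w - i.+1)).
  move=> ik; rewrite -nth_winv; last by lia.
  have /eqP e : take k (winv w) == take k w by rewrite -lcp_ge ?size_winv.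
  by rewrite -[in LHS](nth_take _ ik) -e nth_take.
case: (boolP (odd (size w))) => od.
  have /key : (size w)./2 < k by lia.
  have -> : size w - (size w)./2.+1 = (size w)./2 by lia.
  by move/esym/eqP; rewrite (negPf (linv_neq _)).
have /key : (size w)./2.-1 < k by lia.
have -> : size w - (size w)./2.-1.+1 = (size w)./2.-1.+1 by lia.
have /(sortedP x0) /(_ (size w)./2.-1) := rw.
have -> : (size w)./2.-1.+1 < size w by lia.
by move=> /(_ isT) /eqP n e; apply: n; rewrite e linvK.
Qed.

End Words.

Record free2 := Free2 {fword : seq letter; fword_reduced : reduced fword}.
HB.instance Definition _ := [isSub for fword].
HB.instance Definition _ := [Choice of free2 by <:].

Definition fone : free2 := @Free2 [::] isT.
Definition fmul (u v : free2) : free2 :=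
  Free2 (reduced_wmul (fword u) (fword_reduced v)).
Lemma reduced_winv_fword (u : free2) : reduced (winv (fword u)).
Proof. by rewrite reduced_winv fword_reduced. Qed.
Definition finv (u : free2) : free2 := Free2 (reduced_winv_fword u).

Lemma fmulA : associative fmul.
Proof. by move=> u v w; apply/val_inj/wmulA/fword_reduced. Qed.
Lemma fmul1w : left_id fone fmul.
Proof. by move=> u; apply: val_inj. Qed.
Lemma fmulw1 : right_id fone fmul.
Proof. by move=> u; apply/val_inj/wmulw0/fword_reduced. Qed.
Lemma fmulVw : left_inverse fone finv fmul.
Proof. by move=> u; apply/val_inj/wmulVw. Qed.
Lemma fmulwV : right_inverse fone finv fmul.
Proof.
by move=> u; apply: val_inj; rewrite /= -[X in wmul X _]winvK wmulVw.
Qed.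
HB.instance Definition _ := isGroup.Build free2 fmulA fmul1w fmulw1 fmulVw fmulwV.

Definition fletter (x : letter) : free2 := @Free2 [:: x] isT.

Lemma morph_inv (G H : groupType) (f : G -> H) :
  {morph f : x y / (x * y)%g} -> {morph f : x / (x^-1)%g}.
Proof.
move=> fM x; have f1 : f 1%g = 1%g.
  by apply: (mulgI (f 1%g)); rewrite -fM !mulg1.
by apply: (mulgI (f x)); rewrite -fM !mulgV.
Qed.

Section Generation.
Variable G : groupType.
Implicit Types (u v g : G) (P : G -> Prop).
Local Open Scope group_scope.

(** Phrased as an induction principle over predicates closed under the group operations, so that no
    subgroups have to be formed. *)
Definition generate u v : Prop :=
  forall P, P 1 -> (forall g h, P g -> P h -> P (g * h)) ->
    (forall g, P g -> P g^-1) -> P u -> P v -> forall g, P g.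

Definition lval u v (x : letter) : G :=
  let g := if x.1 then v else u in if x.2 then g^-1 else g.

Definition weval u v (w : seq letter) : G :=
  foldr (fun x g => lval u v x * g) 1 w.

Lemma lval_linv u v x : lval u v (linv x) = (lval u v x)^-1.
Proof. by case: x => [[] []]; rewrite /lval /= ?invgK. Qed.

Lemma weval_lmul u v x w : weval u v (lmul x w) = lval u v x * weval u v w.
Proof.
case: w => //= y w; case: eqP => //= ->.
by rewrite lval_linv mulVKg.
Qed.

Lemma weval_wmul u v w1 w2 : weval u v (wmul w1 w2) = weval u v w1 * weval u v w2.
Proof.
elim: w1 => [|x w1 IH] /=; first by rewrite mul1g.
by rewrite weval_lmul IH mulgA.
Qed.

Lemma weval_morph u v :
  {morph (fun w : free2 => weval u v (fword w)) : w1 w2 / w1 * w2}.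
Proof. by move=> w1 w2; rewrite /= weval_wmul. Qed.

Lemma generate_weval u v : generate u v ->
  forall g, exists w : free2, weval u v (fword w) = g.
Proof.
move=> gen; apply: gen.
- by exists 1.
- by move=> _ _ [w1 <-] [w2 <-]; exists (w1 * w2); rewrite -weval_morph.
- move=> _ [w <-]; exists w^-1.
  exact: (morph_inv (@weval_morph u v)).
- by exists (fletter (false, false)); rewrite /= mulg1.
- by exists (fletter (true, false)); rewrite /= mulg1.
Qed.

Lemma generate_inv u v : generate u v -> generate u^-1 v.
Proof.
move=> gen P P1 PM PV Pu Pv; apply: gen => //.
by rewrite -[u]invgK; apply: PV.
Qed.

Lemma generate_swap u v : generate u v -> generate v u.
Proof. by move=> gen P P1 PM PV Pu Pv; apply: gen. Qed.

Lemma generate_mul u v : generate u v -> generate u (u * v).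
Proof.
move=> gen P P1 PM PV Pu Pv; apply: gen => //.
by rewrite -(mulKg u v); apply: PM => //; apply: PV.
Qed.

Lemma generate_conj k u v : generate u v -> generate (u ^ k) (v ^ k).
Proof.
move=> gen P P1 PM PV Pu Pv g; rewrite -(conjgKV k g).
apply: (gen (fun g => P (g ^ k))) => //.
- by rewrite conj1g.
- by move=> a b; rewrite conjMg; apply: PM.
- by move=> a; rewrite conjVg; apply: PV.
Qed.

(** Conjugation is included among the moves: curves do not see it, and the case of half cancellation
    below needs it to shorten a pair. *)
Inductive nielsen (a b : G) : G -> G -> Prop :=
| nielsen_base : nielsen a b a b
| nielsen_swap u v of nielsen a b u v : nielsen a b v u
| nielsen_inv u v of nielsen a b u v : nielsen a b u^-1 v
| nielsen_mul u v of nielsen a b u v : nielsen a b u (u * v)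
| nielsen_conj k u v of nielsen a b u v : nielsen a b (u ^ k) (v ^ k).

Lemma nielsen_invr a b u v : nielsen a b u v -> nielsen a b u v^-1.
Proof. by move=> /nielsen_swap/nielsen_inv/nielsen_swap. Qed.

Lemma nielsen_mulV a b u v : nielsen a b u (u * v) -> nielsen a b u v.
Proof.
by move=> /nielsen_inv/nielsen_mul/nielsen_inv; rewrite invgK mulKg.
Qed.

Lemma nielsen_mulr a b u v : nielsen a b u v -> nielsen a b (u * v) v.
Proof.
move=> /nielsen_inv /nielsen_swap/nielsen_inv/nielsen_mul/nielsen_swap.
by move=> /nielsen_inv /nielsen_swap /nielsen_inv/nielsen_swap; rewrite invgM !invgK.
Qed.

Lemma nielsen_mulrV a b u v : nielsen a b (u * v) v -> nielsen a b u v.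
Proof.
by move=> /nielsen_invr/nielsen_mulr/nielsen_invr; rewrite invgK mulgK.
Qed.

Lemma nielsen_conjV a b k u v : nielsen a b (u ^ k) (v ^ k) -> nielsen a b u v.
Proof. by move=> /(nielsen_conj k^-1); rewrite !conjgK. Qed.

End Generation.

Section Basis.
Variable G : groupType.
Implicit Types (a b u v g : G).
Local Open Scope group_scope.

(** The universal property is used twice: existence gives the map to [free2], and uniqueness
    identifies the composite with [weval] as the identity of [G]. *)
Lemma free_basis_fmorph a b : free_basis a b ->
  exists f : G -> free2, [/\ {morph f : x y / x * y},
    f a = fletter (false, false), f b = fletter (true, false) &
    cancel f (fun w => weval a b (fword w))].
Proof.
move=> bas.
have [f [[fM [fa fb]] _]] := bas free2 (fletter (false, false)) (fletter (true, false)).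
exists f; split=> // g.
have [h [[_ _] hu]] := bas G a b.
have e1 : h = (fun x => weval a b (fword (f x))).
  apply: hu; split; first by move=> x y; rewrite fM weval_morph.
  by rewrite fa fb /= !mulg1.
have e2 : h = id by apply: hu.
by rewrite -[LHS]/((fun x => weval a b (fword (f x))) g) -e1 e2.
Qed.

Lemma free_basis_generate a b : free_basis a b -> generate a b.
Proof.
move=> /free_basis_fmorph[f [_ _ _ fK]] P P1 PM PV Pa Pb g; rewrite -(fK g).
elim: (fword _) => //= x w IH; apply: PM => //.
by case: x => [[] []]; rewrite /lval /=; try apply: PV.
Qed.

Lemma free_basis_swap u v : free_basis u v -> free_basis v u.
Proof.
move=> bas H x y; have [f [[fM [fu fv]] f_uniq]] := bas H y x.
exists f; split=> // g [gM [gv gu]]; exact: f_uniq.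
Qed.

Lemma free_basis_inv u v : free_basis u v -> free_basis u^-1 v.
Proof.
move=> bas H x y; have [f [[fM [fu fv]] f_uniq]] := bas H x^-1 y.
exists f; split=> [|g [gM [gu gv]]]; first by rewrite (morph_inv fM) fu invgK.
apply: f_uniq; split=> //; split=> //.
by rewrite -[u]invgK (morph_inv gM) gu.
Qed.

Lemma free_basis_mul u v : free_basis u v -> free_basis u (u * v).
Proof.
move=> bas H x y; have [f [[fM [fu fv]] f_uniq]] := bas H x (x^-1 * y).
exists f; split=> [|g [gM [gu gv]]]; first by rewrite fM fu fv mulVKg.
apply: f_uniq; split=> //; split=> //.
by apply: (mulgI (g u)); rewrite -gM gv gu mulVKg.
Qed.

Lemma free_basis_mulr u v : free_basis u v -> free_basis (u * v) v.
Proof.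
move=> /free_basis_inv/free_basis_swap/free_basis_inv/free_basis_mul.
move=> /free_basis_swap/free_basis_inv/free_basis_swap/free_basis_inv.
by move=> /free_basis_swap; rewrite invgM !invgK.
Qed.

End Basis.

Lemma same_gen (l m : letter) : m != linv l -> l.1 = m.1 -> l = m.
Proof. by case: l m => [[] []] [[] []]. Qed.

(** * Nielsen reduction of generating pairs *)

Section NielsenReduction.
Local Open Scope group_scope.
Implicit Types (u v g h : free2).

Definition len g := size (fword g).
(* the number of letters cancelled from each factor of [g * h] *)
Definition canc g h := lcp (winv (fword g)) (fword h).

Arguments len _%_g.
Arguments fword _%_g.
Arguments canc _%_g _%_g.

Let A := fletter (false, false).
Let B := fletter (true, false).

Lemma lenV g : len g^-1 = len g.
Proof. exact: size_winv. Qed.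

Lemma lenM g h : (len (g * h) + (canc g h).*2 = len g + len h)%N.
Proof. by apply: size_wmul; apply: fword_reduced. Qed.

Lemma len_gt0 g : g != 1 -> (0 < len g)%N.
Proof.
apply: contraNT; rewrite -eqn0Ngt => /nilP e; apply/eqP/val_inj.
by rewrite /= e.
Qed.

Lemma canc_self g : g != 1 -> ((canc g g).*2 < len g)%N.
Proof.
move=> g1; apply: lcp_winv (fword_reduced g) _.
by apply: contraNneq g1 => e; apply/eqP/val_inj.
Qed.

Lemma canc_sizel g h : (canc g h <= len g)%N.
Proof. by rewrite -lenV; apply: lcp_size. Qed.

Lemma canc_sizer g h : (canc g h <= len h)%N.
Proof. exact: lcp_sizer. Qed.

Lemma lcp_mul g h : (len g - canc g h <= lcp (fword g) (fword (g * h)))%N.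
Proof.
rewrite lcp_ge; first last.
- by rewrite -/(len _); have := lenM g h; have := canc_sizel g h;
    have := canc_sizer g h; rewrite /len; lia.
- exact: leq_subr.
rewrite /= wmulE ?fword_reduced // -/(canc g h) -/(len g).
by rewrite take_size_cat // size_takel // leq_subr.
Qed.

(** Otherwise the group would be generated by one element, hence abelian, whereas the two letters of
    [free2] do not commute. *)
Lemma generate_neq1 u v : generate u v -> u != 1.
Proof.
apply: contraPneq => -> gen.
have cv g : g * v = v * g.
  apply: (gen (fun g => g * v = v * g)) => [|a b ca cb|a ca||//];
    rewrite ?mul1g ?mulg1 //.
    by rewrite -mulgA cb !mulgA ca.
  by apply: (mulgI a); rewrite mulVKg mulgA ca mulgK.
have cgh g h : g * h = h * g.
  apply: (gen (fun h => g * h = h * g)) => [|a b ca cb|a ca||//];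
    rewrite ?mul1g ?mulg1 //.
    by rewrite mulgA ca -mulgA cb mulgA.
  by apply: (mulgI a); rewrite mulVKg mulgA -ca mulgK.
by have := congr1 fword (cgh A B).
Qed.

(** A counterexample to Nielsen's theorem of minimal total length; the section refutes its
    existence. *)
Definition irreducible u v : Prop :=
  [/\ generate u v, ~ nielsen A B u v &
      forall u' v', (len u' + len v' < len u + len v)%N ->
        generate u' v' -> nielsen A B u' v'].

Lemma irreducible_swap u v : irreducible u v -> irreducible v u.
Proof.
move=> [gen nN IH]; split=> [||u' v' h]; first exact: generate_swap gen.
  by move=> /nielsen_swap.
by move=> gen'; apply: IH => //; rewrite (addnC (len u)).
Qed.

Lemma irreducible_inv u v : irreducible u v -> irreducible u^-1 v.
Proof.
move=> [gen nN IH]; split=> [||u' v' h]; first exact: generate_inv gen.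
  by move=> /nielsen_inv; rewrite invgK.
by apply: IH; rewrite lenV in h.
Qed.

Lemma generate_mulr (G : groupType) (u v : G) : generate u v -> generate (u * v) v.
Proof.
move=> /generate_inv/generate_swap/generate_inv/generate_mul.
move=> /generate_swap/generate_inv/generate_swap/generate_inv.
by move=> /generate_swap; rewrite invgM !invgK.
Qed.

(** If more than half of one factor cancelled, replacing the other factor by the product would give
    a shorter generating pair, one elementary move away. *)
Lemma irreducible_canc u v : irreducible u v ->
  ((canc u v).*2 <= len u)%N /\ ((canc u v).*2 <= len v)%N.
Proof.
move=> [gen nN IH].
split; rewrite leqNgt; apply/negP => h; apply: nN.
  apply: nielsen_mulV; apply: IH (generate_mul gen).
  by rewrite -(ltn_add2r (canc u v).*2) -addnA lenM; lia.
apply: nielsen_mulrV; apply: IH (generate_mulr gen).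
by rewrite -(ltn_add2r (canc u v).*2) addnAC lenM; lia.
Qed.

(* If [u] cancels half by half into both neighbours in [v * u * v], then
   [u = p * q^-1] and [v = q * m * p^-1], and conjugation by [q] turns [(u, v * u)]
   into [(q^-1 * p, m)]. *)
Lemma irreducible_half u v : irreducible u v ->
  ~ ((canc v u).*2 = len u /\ (canc u v).*2 = len u).
Proof.
move=> irr [e1 e2]; have [gen nN IH] := irr.
have [c1 c2] := irreducible_canc irr.
have u0 := len_gt0 (generate_neq1 gen).
set k := canc u v in e2 c1 c2.
have k1 : canc v u = k by lia.
have ru := fword_reduced u; have rv := fword_reduced v.
have su : size (fword u) = (k + k)%N by rewrite -/(len u) -e2 addnn.
have sv : (k + k <= size (fword v))%N by rewrite addnn.
have qe : take k (winv (fword u)) = take k (fword v).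
  by apply/eqP; rewrite -lcp_ge; [exact: leqnn|rewrite size_winv; lia|lia].
have rq : reduced (take k (fword v)).
  by apply: (@reduced_catl _ (drop k (fword v))); rewrite cat_take_drop.
pose q := Free2 rq.
have rp : reduced (take k (fword u)).
  by apply: (@reduced_catl _ (drop k (fword u))); rewrite cat_take_drop.
pose p := Free2 rp.
have due : drop k (fword u) = winv (take k (fword v)).
  rewrite -qe -[in LHS](cat_take_drop k (fword u)).
  have -> : winv (fword u) = winv (drop k (fword u)) ++ winv (take k (fword u)).
    by rewrite -winv_cat cat_take_drop.
  rewrite take_size_cat ?winvK ?cat_take_drop //.
  by rewrite size_winv size_drop; lia.
have ue : u = p * q^-1.
  apply: val_inj; rewrite /= wmul_reduced -due ?cat_take_drop //.
pose mw := drop k (take (size (fword v) - k) (fword v)).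
have vue : fword (v * u) = take k (fword v) ++ (mw ++ winv (take k (fword v))).
  rewrite /= wmulE // -/(canc v u) k1 due catA; congr (_ ++ _).
  rewrite -[LHS](cat_take_drop k); congr (_ ++ _).
  by rewrite take_takel //; lia.
have rvu := fword_reduced (v * u); rewrite vue in rvu.
have rmq := reduced_catr rvu.
pose m := Free2 (reduced_catl rmq).
have vuq : (v * u) = q * (m * q^-1).
  by apply: val_inj; rewrite [LHS]vue /= !wmul_reduced.
have vuc : (v * u) ^ q = m by rewrite vuq conjgE !mulgA mulVg mul1g mulgVK.
have uc : u ^ q = q^-1 * p by rewrite ue conjgE mulgVK.
apply: nN; apply: nielsen_swap; apply: nielsen_mulrV; apply: nielsen_swap.
apply: (nielsen_conjV (k := q)); apply: IH.
  have lq : (len (u ^ q) <= k + k)%N.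
    rewrite uc; have := lenM q^-1 p; rewrite lenV.
    have -> : len q = k by rewrite /len /= size_takel; lia.
    have -> : len p = k by rewrite /len /= size_takel; lia.
    by move=> <-; apply: leq_addr.
  have lm : len ((v * u) ^ q) = (len v - (k + k))%N.
    by rewrite vuc /len /= size_drop size_takel ?leq_subr //; lia.
  apply: leq_ltn_trans (leq_add lq (eq_leq lm)) _.
  by rewrite -/(len v) in sv; lia.
exact: generate_conj (generate_swap (generate_mulr (generate_swap gen))).
Qed.

Section Irreducible.
Variables u v : free2.
Hypothesis irr : irreducible u v.
Local Notation s := (lval u v).

Lemma irreducible_lval l m : l.1 != m.1 -> irreducible (s l) (s m).
Proof.
have i2 := irreducible_inv (irreducible_swap irr).
have i3 := irreducible_inv irr.
have i4 := irreducible_inv (irreducible_swap i3).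
by case: l m => [[] []] [[] []] //= _; rewrite /lval /= //;
  apply: irreducible_swap.
Qed.

Lemma lval_neq1 l : s l != 1.
Proof.
have /irreducible_lval[gen _ _] : l.1 != (~~ l.1, true).1 by case: l.1.
exact: generate_neq1 gen.
Qed.

Lemma lval_canc l m : m != linv l ->
  ((canc (s l) (s m)).*2 <= len (s l))%N /\ ((canc (s l) (s m)).*2 <= len (s m))%N.
Proof.
case: (eqVneq l.1 m.1) => [e ml|/irreducible_lval/irreducible_canc //].
by rewrite -(same_gen ml e); have := canc_self (lval_neq1 l); lia.
Qed.

(** Cancellation from both sides can exhaust [s m] only if each side takes exactly half. A neighbour
    with the same generator takes less than half; two equal neighbours are excluded by
    [irreducible_half]; two mutually inverse ones would make [s m] agree with its own inverse on
    half of its length. *)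
Lemma lval_canc2 l m n : m != linv l -> n != linv m ->
  (canc (s l) (s m) + canc (s m) (s n) < len (s m))%N.
Proof.
move=> ml nm; have [_ c1] := lval_canc ml; have [c2 _] := lval_canc nm.
rewrite ltnNge; apply/negP => h.
have e1 : (canc (s l) (s m)).*2 = len (s m) by lia.
have e2 : (canc (s m) (s n)).*2 = len (s m) by lia.
have self := canc_self (lval_neq1 m).
have lm : l.1 != m.1.
  by apply/eqP => e; move: self; rewrite -{1}(same_gen ml e) e1 ltnn.
have nm1 : n.1 != m.1.
  by apply/eqP => /esym e; move: self; rewrite {2}(same_gen nm e) e2 ltnn.
have [nl|nl] := eqVneq n l.
  have ml' : m.1 != l.1 by rewrite eq_sym.
  by apply: (irreducible_half (irreducible_lval ml')); move: e2; rewrite nl.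
have nE : n = linv l.
  by case: l n m nl lm nm1 {nm ml h c1 c2 e1 e2 self} => [[] []] [[] []] [[] []].
have : (len (s m) <= (lcp (winv (fword (s m))) (fword (s m))).*2)%N.
  have := lcp_min (winv (fword (s m))) (fword (s n)) (fword (s m)).
  rewrite -/(canc _ _) -/(canc _ _).
  have -> : lcp (fword (s n)) (fword (s m)) = canc (s l) (s m).
    by rewrite nE lval_linv.
  by lia.
by rewrite -/(canc _ _); lia.
Qed.

(** By [lval_canc2] the cancellation on the left of [s t] stops before it meets the cancellation on
    the right, so the letters after [t] have no influence on it. *)
Lemma canc_weval l w : reduced (l :: w) ->
  canc (s l) (weval u v w) = if w is t :: _ then canc (s l) (s t) else 0.
Proof.
elim: w l => [|t w IH] l; first by rewrite /canc; case: (winv _).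
move=> /= /andP[tl rw]; have := IH t rw; rewrite /canc => e.
apply: lcp_eq; apply: leq_trans (lcp_mul _ _).
rewrite /canc e -/(canc (s l) (s t)).
have c := lval_canc tl; have t0 := len_gt0 (lval_neq1 t).
case: w rw {IH e} => [|n w] /=; first by lia.
move=> /andP[nt _]; have := lval_canc2 tl nt; rewrite /canc; lia.
Qed.

(** Prepending a letter never shortens a value, since at most half of the prepended factor
    cancels. *)
Lemma len_weval l w : reduced (l :: w) -> (len (weval u v (l :: w)) <= 1)%N -> w = [::].
Proof.
elim: w l => // t w IH l rlw l1; have c := canc_weval rlw.
have /andP[tl rw] : (t != linv l) && reduced (t :: w) := rlw.
have [c1 c2] := lval_canc tl.
have e : (len (weval u v [:: l, t & w]) + (canc (s l) (s t)).*2 =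
    len (s l) + len (weval u v (t :: w)))%N by rewrite -c; apply: lenM.
have l2 : (len (weval u v (t :: w)) <= 1)%N by lia.
have w0 := IH t rw l2; move: e l1 l2; rewrite w0.
have -> : weval u v [:: t] = s t by rewrite /= mulg1.
by have := len_gt0 (lval_neq1 t); have := len_gt0 (lval_neq1 l); lia.
Qed.

Lemma irreducible_false : False.
Proof.
have [gen nN _] := irr.
(* As [u] and [v] generate, the letters of [free2] are values of words; having length one, they are
   values of single letters, that is [u] or [v] up to inversion. *)
have letter_lval x : exists l, fletter x = s l.
  have [[w rw] /= e] := generate_weval gen (fletter x).
  case: w rw e => [|l w] rw e; first by have := congr1 fword e.
  exists l; have w0 : w = [::] by apply: (len_weval rw); rewrite e.
  by rewrite -e w0 /= mulg1.
have [l lA] := letter_lval (false, false); have [m mB] := letter_lval (true, false).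
have : nielsen (s l) (s m) (s l) (s m) by apply: nielsen_base.
have lm : l.1 != m.1.
  apply/eqP => e; have [ml|ml] : m = l \/ m = linv l.
    by case: l m e {lA mB} => [[] []] [[] []]; auto.
    by have := congr1 fword lA; rewrite -ml -mB.
  by have := congr1 fword lA; rewrite -[l]linvK -ml lval_linv -mB.
have : nielsen A B (s l) (s m) by rewrite -lA -mB; apply: nielsen_base.
move=> N _; apply: nN; move: N; clear -lm.
case: l m lm => [[] []] [[] []] //= _; rewrite /lval /= => N;
  do ?[done | by have := nielsen_swap N
  | by have := nielsen_inv N; rewrite invgK
  | by have := nielsen_invr N; rewrite invgK
  | by have := nielsen_inv (nielsen_invr N); rewrite !invgK
  | by have := nielsen_swap (nielsen_inv N); rewrite invgK
  | by have := nielsen_swap (nielsen_invr N); rewrite invgK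
  | by have := nielsen_swap (nielsen_inv (nielsen_invr N)); rewrite !invgK].
Qed.

End Irreducible.

Lemma nielsen_free2 u v : generate u v -> nielsen A B u v.
Proof.
have [n] := ubnP (len u + len v); elim: n u v => // n IH u v /ltnSE le gen.
apply: contrapT => nN; apply: (@irreducible_false u v); split=> // u' v' h.
by apply: IH; apply: leq_trans h le.
Qed.

End NielsenReduction.

Section NielsenTheorem.
Variable G : groupType.
Implicit Types (a b u v g : G).
Local Open Scope group_scope.

Lemma nielsen_morph (H : groupType) (f : G -> H) a b u v :
  {morph f : x y / x * y} -> nielsen a b u v -> nielsen (f a) (f b) (f u) (f v).
Proof.
move=> fM; elim=> [|{}u {}v _ N|{}u {}v _ N|{}u {}v _ N|k {}u {}v _ N].
- exact: nielsen_base.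
- exact: nielsen_swap.
- by rewrite (morph_inv fM); apply: nielsen_inv.
- by rewrite fM; apply: nielsen_mul.
- have fJ x : f (x ^ k) = f x ^ f k by rewrite !conjgE !fM (morph_inv fM).
  by rewrite !fJ; apply: nielsen_conj.
Qed.

End NielsenTheorem.

(** The pair is carried to [free2] by [f], treated there, and carried back by [weval a b], which
    undoes [f]. *)
Lemma nielsen_free_basis (G : groupType) (a b u v : G) :
  free_basis a b -> free_basis u v -> nielsen a b u v.
Proof.
move=> bas /free_basis_generate gen; have [f [fM fa fb fK]] := free_basis_fmorph bas.
have fgen : generate (f u) (f v).
  have preim (P : free2 -> Prop) : P 1%g -> (forall g h, P g -> P h -> P (g * h)%g) ->
      (forall g, P g -> P (g^-1)%g) -> P (f u) -> P (f v) -> forall g, P (f g).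
    move=> P1 PM PV Pu Pv.
    apply: (gen (fun g => P (f g))) => // [|g h|g].
    - by rewrite -(mulgV 1%g) fM (morph_inv fM) mulgV.
    - by rewrite fM; apply: PM.
    - by rewrite (morph_inv fM); apply: PV.
  move=> P P1 PM PV Pu Pv; have Pf := preim P P1 PM PV Pu Pv.
  case=> w rw; elim: w rw => [|x w IH] rw.
    by rewrite (_ : Free2 _ = 1%g) //; apply: val_inj.
  have rw' : reduced w by apply: (@reduced_catr [:: x]).
  have -> : Free2 rw = (fletter x * Free2 rw')%g.
    by apply: val_inj; rewrite /= -[RHS]/(wmul [:: x] w) wmul_reduced.
  apply: PM => //.
  have /= [fAV fBV] := (morph_inv fM a, morph_inv fM b).
  case: x {rw} => [[] []].
  - have -> : fletter (true, true) = f (b^-1)%g by rewrite fBV fb; apply: val_inj.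
    exact: Pf.
  - by rewrite -fb; apply: Pf.
  - have -> : fletter (false, true) = f (a^-1)%g by rewrite fAV fa; apply: val_inj.
    exact: Pf.
  - by rewrite -fa; apply: Pf.
have := nielsen_morph (@weval_morph G a b) (nielsen_free2 fgen).
by rewrite !fK /= !mulg1.
Qed.

(** * Simple curves as the vertices of two binary trees *)

Section StepPairs.
Variable G : groupType.
Implicit Types (a b u v g k : G) (p : G * G).
Local Open Scope group_scope.

Definition step p (d : bool) := if d then (p.1 * p.2, p.2) else (p.1, p.1 * p.2).
Definition descend p (l : seq bool) := foldl step p l.
Definition node p (l : seq bool) := let q := descend p l in q.1 * q.2.

Lemma curve_of_conj k u : curve_of (u ^ k) = curve_of u.
Proof.
apply/esym/eqmodP; rewrite /equiv /=.
by apply/asboolP; exists k; left.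
Qed.

Lemma curve_of_inv u : curve_of u^-1 = curve_of u.
Proof.
apply/esym/eqmodP; rewrite /equiv /=.
by apply/asboolP; exists 1; right; rewrite conjg1.
Qed.

Section Classification.
Variables a b : G.

(** Pairs occurring in one of the two trees, up to the moves that leave the two curves unchanged. *)
Inductive equiv_node : G -> G -> Prop :=
| equiv_node_base u v l of
    (u, v) = descend (a, b) l \/ (u, v) = descend (a^-1, b) l : equiv_node u v
| equiv_node_swap u v of equiv_node u v : equiv_node v u
| equiv_node_inv u v of equiv_node u v : equiv_node u^-1 v
| equiv_node_conj k u v of equiv_node u v : equiv_node (u ^ k) (v ^ k).

Lemma equiv_node_invr u v : equiv_node u v -> equiv_node u v^-1.
Proof. by move=> /equiv_node_swap/equiv_node_inv/equiv_node_swap. Qed.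

Lemma equiv_node_step u v l d :
  (u, v) = descend (a, b) l \/ (u, v) = descend (a^-1, b) l ->
  equiv_node (step (u, v) d).1 (step (u, v) d).2.
Proof.
move=> h; apply: (@equiv_node_base _ _ (rcons l d)).
by rewrite /descend !foldl_rcons -/(descend _ _) -/(descend _ _) -surjective_pairing;
  case: h => <-; [left|right].
Qed.

Lemma equiv_nodeL u v l :
  (u, v) = descend (a, b) l \/ (u, v) = descend (a^-1, b) l -> equiv_node u (u * v).
Proof. by move=> /(equiv_node_step false). Qed.

Lemma equiv_nodeR u v l :
  (u, v) = descend (a, b) l \/ (u, v) = descend (a^-1, b) l -> equiv_node (u * v) v.
Proof. by move=> /(equiv_node_step true). Qed.

(** The element [u^-1 * v] lies on the parent side of the edge [(u, v)]: below a root it is, up to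
    conjugation and inversion, a member of the parent pair, and at a root it is the first node of
    the other tree. *)
Lemma equiv_node_up u v l :
  (u, v) = descend (a, b) l \/ (u, v) = descend (a^-1, b) l ->
  equiv_node u (u^-1 * v) /\ equiv_node v (u^-1 * v).
Proof.
elim/last_ind: l u v => [|l d _] u v.
  have h1 : (a, b) = descend (a, b) [::] \/ (a, b) = descend (a^-1, b) [::] by left.
  have h2 : (a^-1, b) = descend (a, b) [::] \/ (a^-1, b) = descend (a^-1, b) [::].
    by right.
  move=> [] [-> ->]; rewrite ?invgK; split.
  - by have := equiv_node_inv (equiv_nodeL h2); rewrite invgK.
  - exact: equiv_node_swap (equiv_nodeR h2).
  - exact: equiv_node_inv (equiv_nodeL h1).
  - exact: equiv_node_swap (equiv_nodeR h1).
rewrite /descend !foldl_rcons -/(descend _ _) -/(descend _ _) => h.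
have [x [y [e h']]] : exists x y, (u, v) = step (x, y) d /\
    ((x, y) = descend (a, b) l \/ (x, y) = descend (a^-1, b) l).
  by case: h => ->; [case e : (descend (a, b) l) => [x y]|
    case e : (descend (a^-1, b) l) => [x y]]; exists x, y; auto.
have B := equiv_node_base h'; have L := equiv_nodeL h'; have R := equiv_nodeR h'.
case: d {h} e => [] [-> ->]; last first.
  by rewrite mulKg; split=> //.
have -> : (x * y)^-1 * y = (x ^ (x * y))^-1.
  by rewrite -conjVg conjgE invgM !mulgA mulgVK.
have fix_self g : g ^ g = g by rewrite conjgE mulKg.
split; apply: equiv_node_invr.
  by rewrite -{1}(fix_self (x * y)); apply/equiv_node_conj/equiv_node_swap.
have -> : x ^ (x * y) = x ^ y by rewrite conjgM fix_self.
by rewrite -{1}(fix_self y); apply/equiv_node_conj/equiv_node_swap.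
Qed.

(** The four products are treated together because swapping and inverting permute them up to
    conjugation and inversion, which lets the induction pass through these moves. *)
Lemma equiv_node_mul u v : equiv_node u v ->
  [/\ equiv_node u (u * v), equiv_node u (u^-1 * v),
      equiv_node v (v * u) & equiv_node v (v^-1 * u)].
Proof.
have fix_self g : g ^ g = g by rewrite conjgE mulKg.
have mulJ g h : (g * h) ^ g = h * g by rewrite conjgE mulgA mulKg.
elim=> [{}u {}v l h|{}u {}v _ [] //|{}u {}v _ [h1 h2 h3 h4]|k {}u {}v _ [h1 h2 h3 h4]].
- have [U1 U2] := equiv_node_up h; split=> //; first exact: equiv_nodeL h.
    have := equiv_node_conj v^-1 (equiv_node_swap (equiv_nodeR h)).
    have -> : v ^ v^-1 = v by rewrite conjgE invgK mulgV mulg1.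
    by rewrite conjgE invgK mulgK.
  by have := equiv_node_invr U2; rewrite invgM invgK.
- rewrite invgK; split.
  + exact: equiv_node_inv h2.
  + exact: equiv_node_inv h1.
  + have := equiv_node_conj v^-1 h4.
    have -> : v ^ v^-1 = v by rewrite conjgE invgK mulgV mulg1.
    have -> : (v^-1 * u) ^ v^-1 = u * v^-1 by rewrite conjgE invgK mulgA mulVKg.
    by move/equiv_node_invr; rewrite invgM invgK.
  + have := equiv_node_conj v h3; rewrite fix_self mulJ.
    by move/equiv_node_invr; rewrite invgM.
- by split; rewrite -?conjVg -conjMg; apply: equiv_node_conj.
Qed.

Lemma nielsen_equiv_node u v : nielsen a b u v -> equiv_node u v.
Proof.
elim=> [|{}u {}v _|{}u {}v _|{}u {}v _|k {}u {}v _].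
- by apply: (@equiv_node_base _ _ [::]); left.
- exact: equiv_node_swap.
- exact: equiv_node_inv.
- by case/equiv_node_mul.
- exact: equiv_node_conj.
Qed.

Definition tree_curve (c : curve G) : Prop :=
  [\/ c = curve_of a, c = curve_of b, exists l, c = curve_of (node (a, b) l) |
      exists l, c = curve_of (node (a^-1, b) l)].

Lemma descend_tree_curve u v l :
  (u, v) = descend (a, b) l \/ (u, v) = descend (a^-1, b) l ->
  tree_curve (curve_of u) /\ tree_curve (curve_of v).
Proof.
elim/last_ind: l u v => [|l d IH] u v.
  by move=> [] [-> ->]; rewrite ?curve_of_inv; split; [apply: Or41|apply: Or42|
    apply: Or41|apply: Or42].
rewrite /descend !foldl_rcons -/(descend _ _) -/(descend _ _) => h.
have [x [y [e h']]] : exists x y, (u, v) = step (x, y) d /\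
    ((x, y) = descend (a, b) l \/ (x, y) = descend (a^-1, b) l).
  by case: h => ->; [case e : (descend (a, b) l) => [x y]|
    case e : (descend (a^-1, b) l) => [x y]]; exists x, y; auto.
have [Tx Ty] := IH _ _ h'.
have Txy : tree_curve (curve_of (x * y)).
  by case: h' => h'; [apply: Or43|apply: Or44]; exists l; rewrite /node -h'.
by case: d {h} e => [] [-> ->].
Qed.

Lemma nielsen_tree_curve u v : nielsen a b u v -> tree_curve (curve_of u).
Proof.
move=> /nielsen_equiv_node N.
suff [] : tree_curve (curve_of u) /\ tree_curve (curve_of v) by [].
elim: N => [{}u {}v l /descend_tree_curve //|{}u {}v _ []//|{}u {}v _|k {}u {}v _].
  by rewrite curve_of_inv.
by rewrite !curve_of_conj.
Qed.

End Classification.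

Lemma free_basis_descend a b l : free_basis a b ->
  free_basis (descend (a, b) l).1 (descend (a, b) l).2.
Proof.
elim: l a b => //= d l IH a b bas.
by case: d => /=; apply: IH; [apply: free_basis_mulr|apply: free_basis_mul].
Qed.

Lemma simple_node a b l : free_basis a b -> simple_curves (curve_of (node (a, b) l)).
Proof.
move=> /(free_basis_descend l) bas; exists (node (a, b) l), (descend (a, b) l).2.
by split=> //; apply: free_basis_mulr.
Qed.

Lemma simple_tree_curve a b c : free_basis a b ->
  simple_curves c <-> tree_curve a b c.
Proof.
move=> bas; split=> [[u [v [buv ->]]]|].
  exact: nielsen_tree_curve (nielsen_free_basis bas buv).
case=> [->|->|[l ->]|[l ->]].
- by exists a, b.
- by exists b, a; split=> //; apply: free_basis_swap.
- exact: simple_node.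
- by apply: simple_node; apply: free_basis_inv.
Qed.

End StepPairs.

(** * Homology classes of the simple curves *)

Definition zpair : Type := (int * int)%type.
HB.instance Definition _ := Choice.on zpair.
HB.instance Definition _ := isGroup.Build zpair
  (@addrA (int * int)%type) (@add0r (int * int)%type) (@addr0 (int * int)%type)
  (@addNr (int * int)%type) (@addrN (int * int)%type).

Section Homology.
Variable G : groupType.
Implicit Types g h u v : G.
Local Open Scope ring_scope.

(** The abelianisation. The universal property asks for a target with a multiplicative group
    structure, hence the copy [zpair] of the additive group of integer pairs. *)
Lemma homology_exists (a b : G) : free_basis a b -> exists f : G -> zpair,
  {morph f : x y / (x * y)%g} /\ f a = (1, 0) /\ f b = (0, 1).
Proof.
by move=> bas; have [f []] := bas _ ((1, 0) : zpair) ((0, 1) : zpair); exists f.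
Qed.

Lemma curve_homology (f : G -> zpair) g h : {morph f : x y / (x * y)%g} ->
  curve_of g = curve_of h ->
  (f g : int * int) = f h \/ (f g : int * int) = - (f h : int * int).
Proof.
move=> fM /eqmodP /asboolP[k]; have fV := morph_inv fM.
have fJ x : (f (x ^ k)%g : int * int) = f x.
  rewrite conjgE !fM fV -[LHS]/((- (f k : int * int) + ((f x : int * int) + f k))).
  by rewrite addrCA addNr addr0.
case=> ->; rewrite fJ; first by left.
by right; rewrite fV -[RHS]/(- - (f g : int * int)) opprK.
Qed.

(** Exponent sums of the two generators in a node. The first move substitutes into everything that
    follows, which gives the recursion of the Calkin-Wilf tree. *)
Fixpoint coef (l : seq bool) : nat * nat :=
  match l with
  | [::] => (1, 1)
  | false :: l' => ((coef l').1 + (coef l').2, (coef l').2)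
  | true :: l' => ((coef l').1, (coef l').1 + (coef l').2)
  end%N.

Lemma coef_gt0 l : (0 < (coef l).1)%N /\ (0 < (coef l).2)%N.
Proof. by elim: l => [|[] l] //=; lia. Qed.

(** The order of the two coefficients recovers the first move; they are equal only for the empty
    word. *)
Lemma coef_inj : injective coef.
Proof.
elim=> [|x l IH] [|y m] //.
- by have := coef_gt0 m; case: y => /= -[? ?] []; lia.
- by have := coef_gt0 l; case: x => /= -[? ?] []; lia.
have := coef_gt0 m; have := coef_gt0 l.
case: x y => [] [] /= -[? ?] [? ?] [e1 e2]; try (exfalso; lia);
  congr (_ :: _); apply: IH; move: e1 e2;
  case: (coef l) (coef m) => [? ?] [? ?] /= e1 e2; congr pair; lia.
Qed.

Lemma homology_node (f : G -> zpair) u v l : {morph f : x y / (x * y)%g} ->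
  (f (node (u, v) l) : int * int) =
  (f u : int * int) *+ (coef l).1 + (f v : int * int) *+ (coef l).2.
Proof.
move=> fM; elim: l u v => [|[] l IH] u v; first by rewrite /node /= fM.
  rewrite /node /= -/(node (_, _) l) IH fM -[(f u * f v)%g]/((f u : int * int) + f v).
  by rewrite mulrnDl -addrA -mulrnDr.
rewrite /node /= -/(node (_, _) l) IH fM -[(f u * f v)%g]/((f u : int * int) + f v).
by rewrite mulrnDl addrA -mulrnDr.
Qed.

End Homology.

Local Open Scope ring_scope.
Local Open Scope complex_scope.

Local Notation Re := complex.Re.
Local Notation Im := complex.Im.

(** * The complex logarithm and the gap function *)

Section Modulus.
Variable R : realType.
Implicit Types z w : R[i].

Definition cmod z : R := Re `|z|.

Lemma cmodE z : `|z| = (cmod z)%:C.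
Proof. by []. Qed.

Lemma cmod_ge0 z : 0 <= cmod z.
Proof. by case: z => a b; rewrite /cmod Re_norm sqrtr_ge0. Qed.

Lemma cmod0 : cmod 0 = 0.
Proof. by rewrite /cmod normr0. Qed.

Lemma cmod1 : cmod 1 = 1.
Proof. by rewrite /cmod normr1. Qed.

Lemma cmodM z w : cmod (z * w) = cmod z * cmod w.
Proof. by rewrite {1}/cmod normrM !cmodE -rmorphM. Qed.

Lemma cmodX z n : cmod (z ^+ n) = cmod z ^+ n.
Proof. by elim: n => [|n IH]; rewrite ?cmod1 // !exprS cmodM IH. Qed.

Lemma cmodN z : cmod (- z) = cmod z.
Proof. by rewrite /cmod normrN. Qed.

Lemma cmodV z : cmod z^-1 = (cmod z)^-1.
Proof. by rewrite {1}/cmod normfV cmodE -fmorphV. Qed.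

Lemma cmod_gt0 z : (0 < cmod z) = (z != 0).
Proof.
apply/idP/idP => [|/norm_gt0 //].
by apply: contraTneq => ->; rewrite cmod0 ltxx.
Qed.

Lemma cmod_eq0 z : (cmod z == 0) = (z == 0).
Proof. by have := cmod_gt0 z; rewrite lt0r cmod_ge0 andbT => /negb_inj. Qed.

Lemma cmodD z w : cmod (z + w) <= cmod z + cmod w.
Proof. by rewrite -lecR rmorphD -!cmodE ler_normD. Qed.

Lemma cmodB z w : cmod (z - w) <= cmod z + cmod w.
Proof. by rewrite -(cmodN w) cmodD. Qed.

Lemma cmodBC z w : cmod (z - w) = cmod (w - z).
Proof. by rewrite -cmodN opprB. Qed.

Lemma cmod_lbB z w : cmod z - cmod w <= cmod (z - w).
Proof. by rewrite lerBlDr -{1}(subrK w z) cmodD. Qed.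

Lemma cmod_lbD z w : cmod z - cmod w <= cmod (z + w).
Proof. by have := cmod_lbB z (- w); rewrite cmodN opprK. Qed.

Lemma cmod_real (x : R) : cmod x%:C = `|x|.
Proof. by rewrite /cmod /= expr0n addr0 sqrtr_sqr. Qed.

Lemma cmod_nat n : cmod n%:R = n%:R.
Proof. by rewrite -(rmorph_nat (real_complex R)) cmod_real normr_nat. Qed.

Lemma cmod_div z w : cmod (z / w) = cmod z / cmod w.
Proof. by rewrite cmodM cmodV. Qed.

Lemma normRe_le z : `|Re z| <= cmod z.
Proof.
case: z => a b; rewrite /cmod /= -sqrtr_sqr ler_wsqrtr //.
by rewrite lerDl sqr_ge0.
Qed.

Lemma normIm_le z : `|Im z| <= cmod z.
Proof.
case: z => a b; rewrite /cmod /= -sqrtr_sqr ler_wsqrtr //.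
by rewrite lerDr sqr_ge0.
Qed.

Lemma cmod_le_ReIm z : cmod z <= `|Re z| + `|Im z|.
Proof.
case: z => a b /=; rewrite (_ : a +i* b = a%:C + 'i * b%:C); last by simpc.
apply: (le_trans (cmodD _ _)); rewrite cmodM !cmod_real.
by rewrite [cmod 'i]/cmod /= expr0n expr1n add0r sqrtr1 mul1r.
Qed.

Lemma Re_le z : Re z <= cmod z.
Proof. exact: le_trans (ler_norm _) (normRe_le z). Qed.

(** Limits of sequences are kept in epsilon form; the filter in [abs_sum_to] is met only in
    [abs_sum_exhaust]. *)
Definition ctends (u : nat -> R[i]) (l : R[i]) :=
  forall e : R, 0 < e -> exists N, forall n, (N <= n)%N -> cmod (u n - l) < e.

Lemma ctends_cst l : ctends (fun=> l) l.
Proof. by move=> e e0; exists 0%N => n _; rewrite subrr cmod0. Qed.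

Lemma ctends_unique u l m : ctends u l -> ctends u m -> l = m.
Proof.
move=> ul um; apply/eqP; rewrite -subr_eq0 -cmod_eq0 eq_le cmod_ge0 andbT.
rewrite leNgt; apply/negP => d0.
have h : 0 < cmod (l - m) / 2 by rewrite divr_gt0.
have [N1 h1] := ul _ h; have [N2 h2] := um _ h.
have := h1 (maxn N1 N2) (leq_maxl _ _); have := h2 (maxn N1 N2) (leq_maxr _ _).
have := cmodB (u (maxn N1 N2) - m) (u (maxn N1 N2) - l).
rewrite (_ : _ - _ - _ = l - m); last by ring.
lra.
Qed.

Lemma ctends_ext u v l N : (forall n, (N <= n)%N -> u n = v n) ->
  ctends u l -> ctends v l.
Proof.
move=> uv ul e /ul[M h]; exists (maxn N M) => n; rewrite geq_max => /andP[n1 n2].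
by rewrite -uv // h.
Qed.

Lemma ctends_shift u l : ctends (fun n => u n.+1) l <-> ctends u l.
Proof.
split=> h e /h[N hN].
  by exists N.+1 => -[//|n] /hN.
by exists N => n nN; apply: hN; apply: leqW.
Qed.

Lemma ctendsM u v l m : ctends u l -> ctends v m ->
  ctends (fun n => u n * v n) (l * m).
Proof.
move=> ul vm e e0; pose B := cmod l + cmod m + 1.
have B0 : 0 < B by rewrite /B; have := cmod_ge0 l; have := cmod_ge0 m; lra.
have d0 : 0 < Num.min 1 (e / (2 * B)).
  by rewrite lt_min ltr01 /= divr_gt0 // mulr_gt0.
have [N1 h1] := ul _ d0; have [N2 h2] := vm _ d0.
exists (maxn N1 N2) => n; rewrite geq_max => /andP[/h1 {}h1 /h2 {}h2].
move: h1 h2; rewrite !lt_min => /andP[a1 a2] /andP[b1 b2].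
have -> : u n * v n - l * m = (u n - l) * (v n - m) + ((u n - l) * m + l * (v n - m)).
  by ring.
have := cmodD ((u n - l) * (v n - m)) ((u n - l) * m + l * (v n - m)).
have := cmodD ((u n - l) * m) (l * (v n - m)).
rewrite !cmodM; set x := cmod (u n - l) in a1 a2 *; set y := cmod (v n - m) in b1 b2 *.
set dd := e / (2 * B) in a2 b2.
have edd : e = dd * (2 * B) by rewrite /dd divfK // mulf_neq0 ?gt_eqF.
have x0 : 0 <= x by apply: cmod_ge0.
have y0 : 0 <= y by apply: cmod_ge0.
have l0 := cmod_ge0 l; have m0 := cmod_ge0 m.
have t1 : x * y <= dd * 1 by apply: ler_pM => //; lra.
have t2 : x * cmod m <= dd * cmod m by apply: ler_wpM2r => //; lra.
have t3 : cmod l * y <= dd * cmod l by rewrite mulrC; apply: ler_wpM2r => //; lra.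
have dd0 : 0 < dd by lra.
rewrite edd /B; have := mulr_ge0 (ltW dd0) l0; have := mulr_ge0 (ltW dd0) m0; nra.
Qed.

Lemma ctendsD u v l m : ctends u l -> ctends v m ->
  ctends (fun n => u n + v n) (l + m).
Proof.
move=> ul vm e e0; have e2 : 0 < e / 2 by rewrite divr_gt0.
have [N1 h1] := ul _ e2; have [N2 h2] := vm _ e2.
exists (maxn N1 N2) => n; rewrite geq_max => /andP[/h1 {}h1 /h2 {}h2].
have := cmodD (u n - l) (v n - m).
rewrite (_ : _ - _ + (_ - _) = u n + v n - (l + m)); last by ring.
lra.
Qed.

Lemma ctendsV u l : l != 0 -> ctends u l -> ctends (fun n => (u n)^-1) l^-1.
Proof.
rewrite -cmod_gt0 => l0 ul e e0; set L := cmod l in l0.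
have d0 : 0 < Num.min (L / 2) (e * L ^+ 2 / 2).
  by rewrite lt_min !divr_gt0 // mulr_gt0 // exprn_gt0.
have [N h] := ul _ d0; exists N => n /h; rewrite lt_min => /andP[h1 h2].
have un : L / 2 < cmod (u n).
  by have := cmod_lbB l (l - u n); rewrite subKr (cmodBC l) -/L; lra.
have u0 : u n != 0 by rewrite -cmod_gt0; lra.
have ll0 : l != 0 by rewrite -cmod_gt0.
have -> : (u n)^-1 - l^-1 = (l - u n) / (u n * l).
  by field; rewrite u0 ll0.
rewrite cmod_div cmodM -/L cmodBC ltr_pdivrMr; last by apply: mulr_gt0 => //; lra.
apply: (lt_le_trans h2); rewrite -mulrA ler_wpM2l ?ltW //.
by rewrite expr2; nra.
Qed.

Lemma nondecreasing_bounded_lim (u : nat -> R) (C : R) :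
  (forall n, u n <= u n.+1) -> (forall n, u n <= C) ->
  exists l, (forall n, u n <= l) /\
    forall e, 0 < e -> exists N, forall n, (N <= n)%N -> l - e < u n.
Proof.
move=> mono ub.
have hm : {homo u : n m / (n <= m)%N >-> n <= m} by apply/nondecreasing_seqP.
have hs : has_sup (range u).
  by split; [exists (u 0%N), 0%N|exists C => _ [n _ <-]].
exists (sup (range u)); split=> [n|e e0].
  by apply: ub_le_sup; [case: hs|exists n].
have [_ [N _ <-] h] := sup_adherent e0 hs.
by exists N => n /hm; apply: lt_le_trans.
Qed.

(* [u + T] is nondecreasing when [T] dominates the variation of [u]. *)
Lemma dominated_real_lim (u T : nat -> R) (C : R) :
  (forall n, `|u n.+1 - u n| <= T n.+1 - T n) -> (forall n, T n <= C) ->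
  exists l, forall e, 0 < e -> exists N, forall n, (N <= n)%N -> `|u n - l| < e.
Proof.
move=> dom TC; have mT n : T n <= T n.+1.
  by have := dom n; have := normr_ge0 (u n.+1 - u n); lra.
have [t [tub tl]] := nondecreasing_bounded_lim mT TC.
have muT n : u n + T n <= u n.+1 + T n.+1.
  by have := dom n; rewrite ler_norml => /andP[]; lra.
have uC n : u n <= u 0%N - T 0%N + T n.
  elim: n => [|n IH]; first by lra.
  by have := dom n; rewrite ler_norml => /andP[]; lra.
have uC2 n : u n + T n <= u 0%N - T 0%N + C + C by have := uC n; have := TC n; lra.
have [s [sub sl]] := nondecreasing_bounded_lim muT uC2.
exists (s - t) => e e0; have e2 : 0 < e / 2 by rewrite divr_gt0.
have [N1 h1] := tl _ e2; have [N2 h2] := sl _ e2.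
exists (maxn N1 N2) => n; rewrite geq_max => /andP[/h1 {}h1 /h2 {}h2].
by have := tub n; have := sub n; rewrite ltr_norml; move=> ? ?; apply/andP; split; lra.
Qed.

(** Absolute convergence implies convergence, with [T] in the role of the partial sums of the
    moduli. *)
Lemma dominated_lim (u : nat -> R[i]) (T : nat -> R) (C : R) :
  (forall n, cmod (u n.+1 - u n) <= T n.+1 - T n) -> (forall n, T n <= C) ->
  exists l, ctends u l.
Proof.
move=> dom TC.
have ReB z w : Re (z - w) = Re z - Re w by case: z w => [? ?] [? ?].
have ImB z w : Im (z - w) = Im z - Im w by case: z w => [? ?] [? ?].
have [x hx] : exists x, forall e, 0 < e -> exists N, forall n, (N <= n)%N ->
    `|Re (u n) - x| < e.
  apply: dominated_real_lim TC => n; rewrite -ReB.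
  exact: le_trans (normRe_le _) (dom n).
have [y hy] : exists y, forall e, 0 < e -> exists N, forall n, (N <= n)%N ->
    `|Im (u n) - y| < e.
  apply: dominated_real_lim TC => n; rewrite -ImB.
  exact: le_trans (normIm_le _) (dom n).
exists (x +i* y) => e e0; have e2 : 0 < e / 2 by rewrite divr_gt0.
have [N1 h1] := hx _ e2; have [N2 h2] := hy _ e2.
exists (maxn N1 N2) => n; rewrite geq_max => /andP[/h1 {}h1 /h2 {}h2].
by apply: le_lt_trans (cmod_le_ReIm _) _; rewrite ReB ImB /=; lra.
Qed.

Lemma cexp_near0 (e : R) : 0 < e ->
  exists2 d, 0 < d & forall w, cmod w < d -> cmod (cexp w - 1) < e.
Proof.
move=> e0.
have cont (f : R -> R) : {for 0, continuous f} -> forall k, 0 < k ->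
    exists2 d, 0 < d & forall x, `|x| < d -> `|f x - f 0| < k.
  move=> fc k k0; have /cvgrPdist_lt /(_ k k0) := fc.
  rewrite near_nbhs => /nbhs_ballP[d d0 h]; exists d => // x xd.
  rewrite distrC; apply: h; rewrite /ball /= sub0r normrN //.
(* Since [E <= 2], the total error is at most [2k + k + 2k]. *)
pose k := Num.min 1 (e / 8).
have k0 : 0 < k by rewrite lt_min ltr01 divr_gt0.
have [k1 k4] : k <= 1 /\ k <= e / 8 by rewrite !ge_min !lexx orbT.
have [d1 d10 h1] := cont _ (@continuous_expR R 0) _ k0.
have [d2 d20 h2] := cont _ (@continuous_cos R 0) _ k0.
have [d3 d30 h3] := cont _ (@continuous_sin R 0) _ k0.
exists (Num.min d1 (Num.min d2 d3)) => [|w]; first by rewrite !lt_min d10 d20.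
rewrite !lt_min => /and3P[w1 w2 w3].
have {w1}/h1 := le_lt_trans (normRe_le w) w1; rewrite expR0.
have {w2}/h2 := le_lt_trans (normIm_le w) w2; rewrite cos0.
have {w3}/h3 := le_lt_trans (normIm_le w) w3; rewrite sin0 subr0.
rewrite /cexp; set E := expR _; set c := cos _; set s := sin _ => s3 c3 E3.
have -> : E%:C * (c +i* s) - 1 = (E * c - 1) +i* (E * s).
  by simpc; congr (_ +i* _); ring.
apply: le_lt_trans (cmod_le_ReIm _) _ => /=.
have E2 : E <= 2 by move: E3; rewrite ltr_norml => /andP[]; lra.
have E0 : 0 <= E by apply: expR_ge0.
have t1 : `|E * c - 1| <= E * `|c - 1| + `|E - 1|.
  rewrite (_ : E * c - 1 = E * (c - 1) + (E - 1)); last by ring.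
  by apply: (le_trans (ler_normD _ _)); rewrite normrM (ger0_norm E0).
have t2 : E * `|c - 1| <= 2 * `|c - 1| by apply: ler_wpM2r.
have t3 : E * `|s| <= 2 * `|s| by apply: ler_wpM2r.
rewrite normrM (ger0_norm E0).

lra.
Qed.

Lemma ctends_cexp u l : ctends u l -> ctends (fun n => cexp (u n)) (cexp l).
Proof.
move=> ul e e0; have c0 : 0 < cmod (cexp l) by rewrite cmod_gt0 cexp_neq0.
have k0 : 0 < e / cmod (cexp l) by rewrite divr_gt0.
have [d d0 h] := cexp_near0 k0; have [N hN] := ul _ d0.
exists N => n /hN /h; rewrite ltr_pdivlMr // -cmodM mulrBl mul1r.
by rewrite -cexpD subrK.
Qed.

Lemma atan_le (t : R) : `|atan t| <= `|t|.
Proof.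
suff pos (s : R) : 0 <= s -> 0 <= atan s <= s.
  have [t0|t0] := leP 0 t.
    by have /andP[a b] := pos t t0; rewrite !ger0_norm.
  have /pos /andP[a b] : 0 <= - t by lra.
  by rewrite -[X in `|atan X|]opprK atanN normrN -[X in _ <= X]normrN !ger0_norm; lra.
move=> s0.
have D x : x \in `]0, s[ -> is_derive x 1 (@atan R) ((fun x => (1 + x ^+ 2)^-1) x).
  by move=> _; apply: is_derive1_atan.
have C : {within `[0, s], continuous (@atan R)}.
  by apply: continuous_subspaceT => x; apply: continuous_atan.
have [c _] := MVT_segment s0 D C; rewrite atan0 !subr0 => ->.
have c1 : 1 <= 1 + c ^+ 2 by rewrite lerDl sqr_ge0.
rewrite mulr_ge0 ?invr_ge0 //=; last by lra.
by rewrite ler_piMl // invf_le1 //; lra.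
Qed.

Lemma cos_gt0_acos (c : R) : 0 < c <= 1 -> 0 <= acos c < pi / 2.
Proof.
move=> /andP[c0 c1]; have pi0 := pi_gt0 R.
have cI : -1 <= c <= 1 by apply/andP; split; lra.
have [/andP[a0 api] ca] := acos_def cI.
rewrite a0 /= -ltr_cos ?in_itv /= ?a0 ?api //; last by apply/andP; split; lra.
by rewrite ca cos_pihalf.
Qed.

(** Modulus and argument contribute at most [2d] each: [ln r] lies between [1 - 1/r] and [r - 1],
    and as [Re z >= 1/2] the argument is the arctangent of [Im z / Re z]. *)
Lemma cmod_clog z : cmod (z - 1) <= 1 / 2 -> cmod (clog z) <= 4 * cmod (z - 1).
Proof.
set d := cmod (z - 1) => d2.
have ReB : Re (z - 1) = Re z - 1 by case: (z).
have ImB : Im (z - 1) = Im z by case: (z) => a b /=; rewrite oppr0 addr0.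
have re : `|Re z - 1| <= d by rewrite -ReB normRe_le.
have im : `|Im z| <= d by rewrite -ImB normIm_le.
have re2 : 1 / 2 <= Re z by move: re; rewrite ler_norml => /andP[]; lra.
have z0 : z != 0.
  by apply/eqP => e; move: re2; rewrite e /=; lra.
have [/andP[cpi1 cpi2] cc cs] := carg_spec z0.
set r := Re `|z| in cc cs; have r0 : 0 < r by apply: norm_gt0.
have r1 : `|r - 1| <= d.
  have := cmod_lbB z 1; have := cmod_lbB 1 z; rewrite cmod1 (cmodBC 1) -/d.
  by rewrite -[cmod z]/r ler_norml => ? ?; apply/andP; split; lra.
have rz : Re z <= r by apply: Re_le.
have lnr : `|ln r| <= 2 * d.
  have [a1 a2] : r - 1 <= d /\ - d <= r - 1 by move: r1; rewrite ler_norml => /andP[].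
  have u1 : ln r <= r - 1.
    have := @le_ln1Dx R (r - 1); rewrite addrCA subrr addr0; apply; lra.
  have u2 : - ln r <= r^-1 - 1.
    have := @le_ln1Dx R (r^-1 - 1); rewrite addrCA subrr addr0 lnV ?posrE //; apply.
    by have := @invr_gt0 R r; rewrite r0; lra.
  have u3 : r^-1 - 1 <= 2 * d.
    have -> : r^-1 - 1 = (1 - r) / r by rewrite mulrBl divff ?gt_eqF // mul1r.
    by rewrite ler_pdivrMr //; nra.
  by rewrite ler_norml; apply/andP; split; lra.
have th : - (pi / 2) < carg z < pi / 2.
  have /cos_gt0_acos/andP[a0 a1] : 0 < Re z / r <= 1.
    by rewrite divr_gt0 //= ?ler_pdivrMr ?mul1r //; lra.
  by rewrite /carg -/r; case: ifP => _; apply/andP; split; lra.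
have cg0 : 0 < cos (carg z) by apply: cos_gt0_pihalf.
have arg : `|carg z| <= 2 * d.
  rewrite -(@tanK R (carg z)); last by rewrite in_itv /= th.
  apply: (le_trans (atan_le _)).
  have -> : tan (carg z) = Im z / Re z.
    rewrite /tan -cc -cs; field; rewrite gt_eqF //= gt_eqF //.
  rewrite normrM normfV (@ger0_norm _ (Re z)); last by lra.
  have d0 : 0 <= d by apply: cmod_ge0.
  by rewrite ler_pdivrMr; [nra|lra].
apply: (le_trans (cmod_le_ReIm _)); rewrite /= -/r; lra.
Qed.

End Modulus.

Section Gap.
Variable R : realType.
Implicit Types x y z w : R[i].

Lemma Re_sqrtc_ge0 z : 0 <= Re (sqrtc z).
Proof. by case: z => a b; rewrite /= sqrtr_ge0. Qed.

Lemma hfun_eq x : x != 0 -> hfun x * (1 - hfun x) = (x ^+ 2)^-1.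
Proof.
move=> x0; rewrite /hfun; set s := sqrtc _.
have s2 : s ^+ 2 = 1 - 4 / x ^+ 2 by exact: sqr_sqrtc.
have -> : (1 - s) / 2 * (1 - (1 - s) / 2) = (1 - s ^+ 2) / 4 by field.
by rewrite s2; field.
Qed.

Lemma hfun_neq0 x : x != 0 -> hfun x != 0.
Proof.
move=> x0; apply/eqP => h0; have := hfun_eq x0; rewrite h0 mul0r => /esym/eqP.
by rewrite invr_eq0 expf_eq0 (negPf x0).
Qed.

Lemma cmod_sqr z : cmod z ^+ 2 = Re z ^+ 2 + Im z ^+ 2.
Proof. exact: sqr_norm. Qed.

(** The branch of the square root makes [h] the root of smaller modulus of [h (1 - h) = 1/x^2]. *)
Lemma hfun_le_sub1 x : cmod (hfun x) <= cmod (1 - hfun x).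
Proof.
rewrite /hfun; set s := sqrtc _; have s0 : 0 <= Re s by apply: Re_sqrtc_ge0.
have -> : 1 - (1 - s) / 2 = (1 + s) / 2 by field.
rewrite !cmod_div ler_wpM2r ?invr_ge0 ?cmod_ge0 //.
rewrite -(@ler_pXn2r _ 2) ?nnegrE ?cmod_ge0 // !cmod_sqr.
case: s s0 => a b /= a0; nra.
Qed.

(** From [(1 - s) (1 + s) = 4/x^2], where [Re s >= 0] keeps the modulus of the second factor at
    least 1. *)
Lemma cmod_hfun x : x != 0 -> cmod (hfun x) <= 2 / cmod x ^+ 2.
Proof.
move=> x0; rewrite /hfun; set s := sqrtc _; have s0 : 0 <= Re s by apply: Re_sqrtc_ge0.
have s2 : s ^+ 2 = 1 - 4 / x ^+ 2 by exact: sqr_sqrtc.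
have s1 : 1 <= cmod (1 + s).
  by apply: le_trans (Re_le _); case: s s0 {s2} => a b /=; lra.
have e : (1 - s) * (1 + s) = 4 / x ^+ 2 by rewrite -subr_sqr expr1n s2 opprB addrC subrK.
have cx : 0 < cmod x ^+ 2 by rewrite exprn_gt0 // cmod_gt0.
have := congr1 (@cmod R) e; rewrite cmodM !cmod_div cmodX !cmod_nat => e'.
have := cmod_ge0 (1 - s).
have c0 : 0 < cmod x by rewrite cmod_gt0.
have -> : 2 / cmod x ^+ 2 = (4 / cmod x ^+ 2) / 2 by field; rewrite gt_eqF.
by move=> ?; rewrite ler_wpM2r ?invr_ge0 // -e' ler_peMr.
Qed.

Section Tau.
Variable tau : R[i].
Hypothesis tau2 : tau <> 2.
Hypothesis tauN2 : tau <> - 2.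

Let nu := cacosh (- tau / 2).
Let eps := cexp nu.
Let mu := tau + 2.

Let eps0 : eps != 0.
Proof. exact: cexp_neq0. Qed.

Lemma cexpN_nu : cexp (- nu) = eps^-1.
Proof. by apply: (mulfI eps0); rewrite cexpN_mul mulfV. Qed.

(** The equation [eps + 1/eps = - tau] for [nu], in the form in which it enters the identities for
    [G]. *)
Lemma eps_mu : eps * mu = - (eps - 1) ^+ 2.
Proof.
have [e _ _ _] := cacoshP (- tau / 2).
have e2 : eps + eps^-1 = - tau.
  move: e; rewrite -/nu /ccosh cexpN_nu -/eps => /(congr1 (fun t => t * 2)).
  by rewrite !divfK.
have -> : mu = 2 - (eps + eps^-1) by rewrite e2 opprK addrC.
by field.
Qed.

Lemma mu_neq0 : mu != 0.
Proof. by apply/eqP => /eqP; rewrite addr_eq0 => /eqP. Qed.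

Lemma mu_neq4 : mu != 4.
Proof.
apply/eqP => e; apply: tau2; have -> : tau = mu - 2 by rewrite addrK.
by rewrite e; ring.
Qed.

Lemma eps_neq1 : eps != 1.
Proof.
apply/eqP => e; have := eps_mu; rewrite e subrr expr0n oppr0 mul1r => /eqP.
by rewrite (negPf mu_neq0).
Qed.

Lemma eps_neqN1 : eps != -1.
Proof.
apply/eqP => e; have := eps_mu; rewrite e mulN1r => /oppr_inj m4.
by have := mu_neq4; rewrite m4; apply/negP/negPn/eqP; ring.
Qed.

Definition gapP x := 1 + (eps - 1) * hfun x.
Definition gapQ x := 1 + (eps^-1 - 1) * hfun x.
(* the product of [exp h_tau] over all regions behind the edge [(x, y, z)] *)
Definition gapG x y z := (1 + (eps - 1) * (z / (x * y))) / (gapP x * gapP y).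

Lemma gapPQ x : x != 0 -> gapP x * gapQ x = 1 - mu / x ^+ 2.
Proof.
move=> x0; rewrite -(hfun_eq x0) /gapP /gapQ.
apply: (mulfI eps0); move: (hfun x) => h.
transitivity (eps - eps * mu * (h * (1 - h))); last by ring.
by rewrite eps_mu; field; apply: eps0.
Qed.

(** Equivalent to [hfrak_defined] by [hfrak_definedP]; by [gapPQ] it makes both numerator and
    denominator of [exp h_tau] nonzero. *)
Definition regular x := (x != 0) && (x ^+ 2 != mu).

Lemma regular_neq0 x : regular x -> x != 0.
Proof. by case/andP. Qed.

Lemma regular_ratio x : regular x -> 1 - mu / x ^+ 2 != 0.
Proof.
move=> /andP[x0 xm]; rewrite subr_eq0 eq_sym; apply: contraNneq xm => e.
by rewrite -[x ^+ 2]mul1r -e divfK // expf_neq0.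
Qed.

Lemma gapP_neq0 x : regular x -> gapP x != 0.
Proof.
move=> rx; have := regular_ratio rx; rewrite -gapPQ; last exact: regular_neq0.
by rewrite mulf_eq0 negb_or => /andP[].
Qed.

Lemma gapQ_neq0 x : regular x -> gapQ x != 0.
Proof.
move=> rx; have := regular_ratio rx; rewrite -gapPQ; last exact: regular_neq0.
by rewrite mulf_eq0 negb_or => /andP[].
Qed.

Lemma hfrakE x : hfrak tau x = clog (gapP x / gapQ x).
Proof. by rewrite /hfrak -/nu -/eps cexpN_nu. Qed.

Lemma cexp_hfrak x : regular x -> cexp (hfrak tau x) = gapP x / gapQ x.
Proof.
move=> rx; rewrite hfrakE cexp_clog // mulf_neq0 ?invr_eq0 ?gapP_neq0 ?gapQ_neq0 //.
Qed.

Definition markoff x y z := x ^+ 2 + y ^+ 2 + z ^+ 2 - x * y * z = mu.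

Lemma markoffL x y z : markoff x y z -> markoff x (x * y - z) y.
Proof. by rewrite /markoff => <-; ring. Qed.

Lemma markoffR x y z : markoff x y z -> markoff (x * y - z) y x.
Proof. by rewrite /markoff => <-; ring. Qed.

Lemma markoff_swap x y z : markoff x y z -> markoff y x z.
Proof. by rewrite /markoff => <-; ring. Qed.

Lemma markoff_opp x y z : markoff x y z -> markoff x y (x * y - z).
Proof. by rewrite /markoff => <-; ring. Qed.

Lemma gapG_split x y z : markoff x y z ->
  regular x -> regular y -> regular (x * y - z) ->
  gapG x y z = cexp (hfrak tau (x * y - z)) *
    (gapG x (x * y - z) y * gapG (x * y - z) y x).
Proof.
set w := x * y - z => m rx ry rw.
have [x0 y0 w0] := And3 (regular_neq0 rx) (regular_neq0 ry) (regular_neq0 rw).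
have [Px Py Pw] := And3 (gapP_neq0 rx) (gapP_neq0 ry) (gapP_neq0 rw).
have Qw := gapQ_neq0 rw; have PQ := gapPQ w0.
rewrite cexp_hfrak // /gapG.
(* Once [P(x) P(y)] is cancelled, only the product [P(w) Q(w) = 1 - mu/w^2] remains, so the square
   root hidden in [h] disappears. *)
have key : (1 + (eps - 1) * (z / (x * y))) * (gapP w * gapQ w) =
    (1 + (eps - 1) * (y / (x * w))) * (1 + (eps - 1) * (x / (w * y))).
  rewrite PQ; apply/eqP; rewrite -subr_eq0; apply/eqP.
  have -> : z = x * y - w by rewrite /w; ring.
  have m' : x ^+ 2 + y ^+ 2 + w ^+ 2 - x * y * w - mu = 0.
    by rewrite -m /w; ring.
  (* The defect is a combination of the Markoff equation and of [eps_mu]. *)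
  transitivity ((eps - 1) / (x * y * w) *
      - (x ^+ 2 + y ^+ 2 + w ^+ 2 - x * y * w - mu) -
      (eps * mu + (eps - 1) ^+ 2) / w ^+ 2).
    by field; rewrite x0 y0 w0.
  by rewrite m' eps_mu addNr oppr0 mulr0 mul0r subr0.
transitivity ((1 + (eps - 1) * (z / (x * y))) * (gapP w * gapQ w) /
    (gapP x * gapP y * (gapP w * gapQ w))).
  by rewrite -mulf_div divff ?mulr1 // mulf_neq0.
rewrite key; move: (gapP x) (gapP y) (gapP w) (gapQ w) Px Py Pw Qw => a b c d *.
by field; apply/and5P; split; rewrite ?x0 ?y0 ?w0 //; apply/andP.
Qed.

Lemma gapG_edge x y z : markoff x y z -> regular x -> regular y ->
  cexp (hfrak tau x) * cexp (hfrak tau y) * (gapG x y z * gapG x y (x * y - z)) = eps.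
Proof.
move=> m rx ry.
have [x0 y0] := conj (regular_neq0 rx) (regular_neq0 ry).
have [Px Py] := conj (gapP_neq0 rx) (gapP_neq0 ry).
have [Qx Qy] := conj (gapQ_neq0 rx) (gapQ_neq0 ry).
have PQx := gapPQ x0; have PQy := gapPQ y0.
rewrite !cexp_hfrak // /gapG.
(* With [t = z/(xy)] both sides equal [eps + (eps - 1)^2 t (1 - t)]. *)
have key : (1 + (eps - 1) * (z / (x * y))) *
    (1 + (eps - 1) * ((x * y - z) / (x * y))) =
    eps * (gapP x * gapQ x) * (gapP y * gapQ y).
  rewrite PQx PQy; apply/eqP; rewrite -subr_eq0; apply/eqP.
  have m' : x ^+ 2 + y ^+ 2 + z ^+ 2 - x * y * z - mu = 0 by rewrite m subrr.
  have e' : eps * mu + (eps - 1) ^+ 2 = 0 by rewrite eps_mu addNr.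
  transitivity ((eps * mu + (eps - 1) ^+ 2) *
     ((x * y - z) * z / (x * y) ^+ 2) +
     eps * mu * (x ^+ 2 + y ^+ 2 + z ^+ 2 - x * y * z - mu) / (x * y) ^+ 2).
    by field; rewrite x0 y0.
  by rewrite m' e' mulr0 !mul0r addr0.
transitivity ((1 + (eps - 1) * (z / (x * y))) *
    (1 + (eps - 1) * ((x * y - z) / (x * y))) / (gapP x * gapQ x * (gapP y * gapQ y))).
  move: (gapP x) (gapP y) (gapQ x) (gapQ y) Px Py Qx Qy => a b c d *.
  by field; rewrite x0 y0; apply/and5P.
by rewrite key -(mulrA eps) mulfK // !mulf_neq0.
Qed.

Lemma gapG_neq0 x y z : markoff x y z -> regular x -> regular y -> gapG x y z != 0.
Proof.
move=> m rx ry; apply/eqP => g0; have := gapG_edge m rx ry.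
by rewrite g0 mul0r mulr0 => /esym/eqP; rewrite (negPf eps0).
Qed.

End Tau.
End Gap.

(** * Estimates for large traces *)

Section Estimates.
Variables (R : realType) (tau : R[i]).
Implicit Types x y z w : R[i].

Let eps := cexp (cacosh (- tau / 2)).
Let mu : R[i] := tau + 2.
Let E1 : R := cmod (eps - 1).
Let E2 : R := cmod (eps^-1 - 1).
Let D : R := cmod (eps - eps^-1).
Let M : R := cmod mu.

(** Chosen so that [cmod_gapG] still closes after division by [|P(x) P(y)| >= 9/16]. *)
Definition gapG_const : R := 4 * (E1 * (8 + M)) + 8 * E1 ^+ 2.
(** The sum of all quantities to be dominated: beyond it [|x| >= 10], [|x|^2 > |mu|], and the
    products of [|h(x)|] with [E1], [E2] and [D] are at most [1/80]. *)
Definition large_bound : R := 10 + M + 16 * E1 + 16 * E2 + 16 * D + gapG_const.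
(** The factors are 4 from [cmod_clog], 4/3 from [1/|Q|] and 2 from [cmod_hfun]; their product 32/3
    is rounded up. *)
Definition hfrak_const : R := 12 * D.

Lemma norms_ge0 : [/\ 0 <= E1, 0 <= E2, 0 <= D & 0 <= M].
Proof. by split; apply: cmod_ge0. Qed.

Lemma gapG_const_ge0 : 0 <= gapG_const.
Proof.
have [E10 E20 D0 M0] := norms_ge0.
by rewrite /gapG_const; have := mulr_ge0 E10 M0; have := sqr_ge0 E1; lra.
Qed.

Lemma large_ge10 : 10 <= large_bound.
Proof.
have [E10 E20 D0 M0] := norms_ge0.
by rewrite /large_bound; have := gapG_const_ge0; lra.
Qed.

Lemma hfrak_const_ge0 : 0 <= hfrak_const.
Proof. have [E10 E20 D0 M0] := norms_ge0; by rewrite /hfrak_const; lra. Qed.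

Lemma large_sqr x : large_bound <= cmod x -> 10 * large_bound <= cmod x ^+ 2.
Proof. by move=> b; have := large_ge10; nra. Qed.

Lemma large_neq0 x : large_bound <= cmod x -> x != 0.
Proof. by rewrite -cmod_gt0; have := large_ge10; lra. Qed.

Lemma large_regular x : large_bound <= cmod x -> regular tau x.
Proof.
have [E10 E20 D0 M0] := norms_ge0.
move=> b; rewrite /regular large_neq0 //=; apply/eqP => e.
have := large_sqr b; rewrite -cmodX e -/mu -/M /large_bound.
by have := gapG_const_ge0; lra.
Qed.

Lemma large_hfun x : large_bound <= cmod x -> cmod (hfun x) * (5 * large_bound) <= 1.
Proof.
move=> b; have := cmod_hfun (large_neq0 b); have x2 := large_sqr b; have b10 := large_ge10.
rewrite ler_pdivlMr; last by lra.
by have := cmod_ge0 (hfun x); nra.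
Qed.

Lemma large_coef (c a : R) : 0 <= a -> 0 <= c -> 16 * c <= large_bound ->
  a * (5 * large_bound) <= 1 ->
  c * a <= 1 / 80.
Proof. by move=> a0 c0 cb ab; nra. Qed.

Lemma large_gapQ x : large_bound <= cmod x -> 3 / 4 <= cmod (gapQ tau x).
Proof.
have [E10 E20 D0 M0] := norms_ge0.
move=> b; have h := large_hfun b; rewrite /gapQ -/eps.
have := cmod_lbD 1 ((eps^-1 - 1) * hfun x); rewrite cmod1 cmodM -/E2.
have : E2 * cmod (hfun x) <= 1 / 80.
  apply: large_coef h => //; first exact: cmod_ge0.
  by rewrite /large_bound; have := gapG_const_ge0; lra.
lra.
Qed.

Lemma large_gapP x : large_bound <= cmod x -> 3 / 4 <= cmod (gapP tau x).
Proof.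
have [E10 E20 D0 M0] := norms_ge0.
move=> b; have h := large_hfun b; rewrite /gapP -/eps.
have := cmod_lbD 1 ((eps - 1) * hfun x); rewrite cmod1 cmodM -/E1.
have : E1 * cmod (hfun x) <= 1 / 80.
  apply: large_coef h => //; first exact: cmod_ge0.
  by rewrite /large_bound; have := gapG_const_ge0; lra.
lra.
Qed.

Lemma cmod_hfrak x : large_bound <= cmod x ->
  cmod (hfrak tau x) <= hfrak_const / cmod x ^+ 2.
Proof.
have [E10 E20 D0 M0] := norms_ge0.
move=> b; have h := large_hfun b; have Q := large_gapQ b.
have rx := large_regular b; have Q0 := gapQ_neq0 rx.
have a0 := cmod_ge0 (hfun x).
have Dh : D * cmod (hfun x) <= 1 / 80.
  by apply: large_coef h => //; rewrite /large_bound; have := gapG_const_ge0; lra.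
have e : gapP tau x / gapQ tau x - 1 = (eps - eps^-1) * hfun x / gapQ tau x.
  apply: (mulIf Q0); rewrite mulrBl !divfK // mul1r /gapP /gapQ -/eps; ring.
have le : cmod (gapP tau x / gapQ tau x - 1) <= 4 / 3 * (D * cmod (hfun x)).
  rewrite e cmod_div cmodM -/D ler_pdivrMr; last by lra.
  by have := mulr_ge0 D0 a0; nra.
rewrite hfrakE; apply: (le_trans (cmod_clog _)); first by lra.
have hx := cmod_hfun (large_neq0 b).
have : D * cmod (hfun x) <= D * (2 / cmod x ^+ 2) by rewrite ler_wpM2l.
have i0 : 0 <= (cmod x ^+ 2)^-1 by rewrite invr_ge0 sqr_ge0.
rewrite /hfrak_const; have := mulr_ge0 D0 i0; lra.
Qed.

Definition edge_weight x y : R := (cmod x * cmod y) ^- 2.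

Lemma edge_weight_ge0 x y : 0 <= edge_weight x y.
Proof. by rewrite invr_ge0 sqr_ge0. Qed.

(* With [t = z/(xy)] and [s = h(x) + h(y)], both [t(1-t)] and [s(1-s)] equal
   [1/x^2 + 1/y^2] up to [O(1/(xy)^2)]. *)
Lemma cmod_gapG x y z : markoff tau x y z ->
  large_bound <= cmod x -> large_bound <= cmod y ->
  cmod z <= cmod (x * y - z) ->
  cmod (gapG tau x y z - 1) <= gapG_const * edge_weight x y.
Proof.
have [E10 E20 D0 M0] := norms_ge0.
move=> m bx byy zw; have x0 := large_neq0 bx; have y0 := large_neq0 byy.
have X := large_sqr bx; have Y := large_sqr byy; have b10 := large_ge10.
have Mb : M <= large_bound by rewrite /large_bound; have := gapG_const_ge0; lra.
have [hx hy] := (cmod_hfun x0, cmod_hfun y0).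
have [hbx hby] := (large_hfun bx, large_hfun byy).
have [hx0 hy0] := (cmod_ge0 (hfun x), cmod_ge0 (hfun y)).
have [Px Py] := (large_gapP bx, large_gapP byy).
have [ex ey] := (hfun_eq x0, hfun_eq y0).
set B := edge_weight x y; have B0 : 0 <= B by apply: edge_weight_ge0.
have cx : 0 < cmod x by rewrite cmod_gt0.
have cy : 0 < cmod y by rewrite cmod_gt0.
set a := hfun x in hx hbx hx0 Px ex *; set b := hfun y in hy hby hy0 Py ey *.
have ea : gapP tau x = 1 + (eps - 1) * a by [].
have eb : gapP tau y = 1 + (eps - 1) * b by [].
clearbody a b.
have hab : cmod a * cmod b <= 4 * B.
  apply: (le_trans (ler_pM hx0 hy0 hx hy)).
  rewrite le_eqVlt; apply/orP; left; apply/eqP; rewrite /B /edge_weight; field.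
  by rewrite !gt_eqF.
set t := z / (x * y).
have tt : t * (1 - t) = (x ^+ 2)^-1 + (y ^+ 2)^-1 - mu / (x * y) ^+ 2.
  rewrite /t /mu -m; field; rewrite x0 y0 //.
(* Here [|z| <= |w|] enters: with [z w = x^2 + y^2 - mu] it bounds [|z|^2]. It makes [t], and not
   [1 - t], the root close to [h(x) + h(y)]. *)
have ct : cmod t <= 1 / 4.
  have z2 : cmod z ^+ 2 <= cmod x ^+ 2 + cmod y ^+ 2 + M.
    have e : z * (x * y - z) = x ^+ 2 + y ^+ 2 - mu by rewrite /mu -m; ring.
    have : cmod z ^+ 2 <= cmod z * cmod (x * y - z) by rewrite expr2 ler_wpM2l ?cmod_ge0.
    rewrite -cmodM e; have := cmodB (x ^+ 2 + y ^+ 2) mu; have := cmodD (x ^+ 2) (y ^+ 2).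
    rewrite !cmodX -/M; lra.
  rewrite /t cmod_div ler_pdivrMr cmodM ?mulr_gt0 //.
  rewrite -(@ler_pXn2r _ 2) ?nnegrE ?cmod_ge0 //; last by rewrite !mulr_ge0 // ltW.
  apply: (le_trans z2); rewrite !exprMn.
  set x2 := cmod x ^+ 2 in X *; set y2 := cmod y ^+ 2 in Y *.
  have y0x : 0 <= x2 * (y2 - 100) by apply: mulr_ge0; lra.
  have x0y : 0 <= y2 * (x2 - 100) by apply: mulr_ge0; lra.
  by rewrite expr2; lra.
have small c : 0 <= c -> c * (5 * large_bound) <= 1 -> c <= 1 / 8 :> R by move=> *; nra.
have ca := small _ hx0 hbx; have cb := small _ hy0 hby.
(* The second factor in [key] stays away from 0, so that [key] controls the first. *)
have low : 1 / 2 <= cmod (1 - t - (a + b)).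
  have := cmod_lbB (1 - t) (a + b); have := cmod_lbB 1 t; have := cmodD a b.
  rewrite cmod1; lra.
have xy2 : cmod ((x * y) ^+ 2)^-1 = B by rewrite cmodV cmodX cmodM.
have key : (t - (a + b)) * (1 - t - (a + b)) = 2 * (a * b) - mu / (x * y) ^+ 2.
  have -> : (t - (a + b)) * (1 - t - (a + b)) =
      t * (1 - t) - (a * (1 - a) + b * (1 - b)) + 2 * (a * b) by ring.
  by rewrite tt ex ey; ring.
have ts : cmod (t - (a + b)) <= 2 * (8 + M) * B.
  have := congr1 (@cmod R) key; rewrite cmodM => e.
  have le : cmod (t - (a + b)) * (1 / 2) <= (8 + M) * B.
    apply: (@le_trans _ _ (cmod (t - (a + b)) * cmod (1 - t - (a + b)))).
      by rewrite ler_wpM2l ?cmod_ge0.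
    rewrite e; apply: (le_trans (cmodB _ _)).
    rewrite !cmodM cmod_nat xy2 -/M; lra.
  lra.
have PP : 9 / 16 <= cmod (gapP tau x * gapP tau y).
  by rewrite cmodM; have := cmod_ge0 (gapP tau x); nra.
have e : gapG tau x y z - 1 =
    ((eps - 1) * (t - (a + b)) - (eps - 1) ^+ 2 * (a * b)) / (gapP tau x * gapP tau y).
  have PP0 : gapP tau x * gapP tau y != 0 by rewrite -cmod_gt0; lra.
  apply: (mulIf PP0); rewrite mulrBl /gapG !divfK // mul1r ea eb -/eps -/t.
  by ring.
rewrite e cmod_div ler_pdivrMr; last by lra.
apply: (le_trans (cmodB _ _)).
rewrite (cmodM (eps - 1)) (cmodM (_ ^+ 2)) (cmodM a) cmodX -/E1.
have t1 : E1 * cmod (t - (a + b)) <= E1 * (2 * (8 + M) * B) by rewrite ler_wpM2l.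
have t2 : E1 ^+ 2 * (cmod a * cmod b) <= E1 ^+ 2 * (4 * B).
  by rewrite ler_wpM2l ?sqr_ge0.
have g0 := mulr_ge0 gapG_const_ge0 B0.
have t3 : gapG_const * B * (9 / 16) <=
    gapG_const * B * cmod (gapP tau x * gapP tau y) by rewrite ler_wpM2l.
apply: le_trans t3; 
have t4 := mulr_ge0 (mulr_ge0 E10 M0) B0; have t5 := mulr_ge0 E10 B0.
have t6 := mulr_ge0 (sqr_ge0 E1) B0.
apply: le_trans (lerD t1 t2) _; rewrite /gapG_const.
have -> : E1 * (2 * (8 + M) * B) + E1 ^+ 2 * (4 * B) =
  16 * (E1 * B) + 2 * (E1 * M * B) + 4 * (E1 ^+ 2 * B) by ring.
have -> : (4 * (E1 * (8 + M)) + 8 * E1 ^+ 2) * B * (9 / 16) =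
  18 * (E1 * B) + 9 / 4 * (E1 * M * B) + 9 / 2 * (E1 ^+ 2 * B) by field.
by move: (E1 * B) (E1 * M * B) (E1 ^+ 2 * B) t4 t5 t6 => *; lra.
Qed.

End Estimates.

(** * Sums over binary trees *)

Section Trees.
Variables (R : realType) (tau : R[i]).
Implicit Types x y z w : R[i].

(* [(x, y, z)] is the edge between the regions [x] and [y] pointing to [z]; the
   region at its tail is [x * y - z], and the tree extends behind it. *)
Fixpoint region x y z (l : seq bool) : R[i] :=
  match l with
  | [::] => x * y - z
  | false :: l' => region x (x * y - z) y l'
  | true :: l' => region (x * y - z) y x l'
  end.

Fixpoint tree_norm (n : nat) x y z : R :=
  if n is m.+1 then cmod (hfrak tau (x * y - z)) +
    (tree_norm m x (x * y - z) y + tree_norm m (x * y - z) y x)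
  else 0.

Fixpoint tree_sum (n : nat) x y z : R[i] :=
  if n is m.+1 then hfrak tau (x * y - z) +
    (tree_sum m x (x * y - z) y + tree_sum m (x * y - z) y x)
  else 0.

Lemma tree_normS n x y z : tree_norm n.+1 x y z = cmod (hfrak tau (x * y - z)) +
  (tree_norm n x (x * y - z) y + tree_norm n (x * y - z) y x).
Proof. by []. Qed.

Lemma tree_sumS n x y z : tree_sum n.+1 x y z = hfrak tau (x * y - z) +
  (tree_sum n x (x * y - z) y + tree_sum n (x * y - z) y x).
Proof. by []. Qed.

(** The remainder when [G] is split down to depth [n]: a product over the [2^n] edges at that
    depth. *)
Fixpoint leaf_prod (n : nat) x y z : R[i] :=
  if n is m.+1 then leaf_prod m x (x * y - z) y * leaf_prod m (x * y - z) y x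
  else gapG tau x y z.

Definition admissible x y z : Prop :=
  [/\ markoff tau x y z, regular tau x, regular tau y &
      forall l, regular tau (region x y z l)].

Lemma admissibleL x y z : admissible x y z -> admissible x (x * y - z) y.
Proof.
move=> [m rx ry rl]; split=> [||| l] //.
- exact: markoffL.
- exact: (rl [::]).
- exact: (rl (false :: l)).
Qed.

Lemma admissibleR x y z : admissible x y z -> admissible (x * y - z) y x.
Proof.
move=> [m rx ry rl]; split=> [||| l] //.
- exact: markoffR.
- exact: (rl [::]).
- exact: (rl (true :: l)).
Qed.

Lemma gapG_tree n x y z : admissible x y z ->
  gapG tau x y z = cexp (tree_sum n x y z) * leaf_prod n x y z.
Proof.
elim: n x y z => [|n IH] x y z adm /=; first by rewrite cexp0 mul1r.
have [m rx ry rl] := adm.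
rewrite (gapG_split m rx ry (rl [::])) (IH _ _ _ (admissibleL adm)).
by rewrite (IH _ _ _ (admissibleR adm)) !cexpD; ring.
Qed.

Lemma cmod_tree_sum n x y z : cmod (tree_sum n x y z) <= tree_norm n x y z.
Proof.
elim: n x y z => [|n IH] x y z /=; first by rewrite cmod0.
apply: (le_trans (cmodD _ _)); rewrite lerD2l.
by apply: (le_trans (cmodD _ _)); rewrite lerD.
Qed.

(** Both differences run over the same level of the tree. *)
Lemma cmod_tree_sumB n x y z :
  cmod (tree_sum n.+1 x y z - tree_sum n x y z) <=
  tree_norm n.+1 x y z - tree_norm n x y z.
Proof.
elim: n x y z => [|n IH] x y z.
  by rewrite [tree_sum 0 _ _ _]/= [tree_norm 0 _ _ _]/= !subr0 cmod_tree_sum.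
rewrite (tree_sumS n.+1) (tree_sumS n x y) (tree_normS n.+1) (tree_normS n x y).
set w := x * y - z.
rewrite [X in cmod X <= _](_ : _ = (tree_sum n.+1 x w y - tree_sum n x w y) +
  (tree_sum n.+1 w y x - tree_sum n w y x)); last by ring.
rewrite [X in _ <= X](_ : _ = (tree_norm n.+1 x w y - tree_norm n x w y) +
  (tree_norm n.+1 w y x - tree_norm n w y x)); last by ring.
exact: le_trans (cmodD _ _) (lerD (IH _ _ _) (IH _ _ _)).
Qed.

Definition tree_bounded x y z : Prop := exists C, forall n, tree_norm n x y z <= C.

Definition tree_good x y z : Prop := tree_bounded x y z /\
  ctends (fun n => cexp (tree_sum n x y z)) (gapG tau x y z).

Lemma tree_bounded_lim x y z : tree_bounded x y z ->
  exists s, ctends (fun n => tree_sum n x y z) s.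
Proof.
move=> [C hC]; apply: (@dominated_lim _ _ (fun n => tree_norm n x y z) C) => // n.
exact: cmod_tree_sumB.
Qed.

Lemma tree_bounded_split x y z :
  tree_bounded x (x * y - z) y -> tree_bounded (x * y - z) y x -> tree_bounded x y z.
Proof.
move=> [C1 h1] [C2 h2]; exists (cmod (hfrak tau (x * y - z)) + (C1 + C2)) => -[|n] /=.
  have := h1 0%N; have := h2 0%N; have := cmod_ge0 (hfrak tau (x * y - z)) => /=; lra.
by rewrite lerD2l lerD.
Qed.

Lemma tree_lim_split x y z p q :
  ctends (fun n => cexp (tree_sum n x (x * y - z) y)) p ->
  ctends (fun n => cexp (tree_sum n (x * y - z) y x)) q ->
  ctends (fun n => cexp (tree_sum n x y z)) (cexp (hfrak tau (x * y - z)) * (p * q)).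
Proof.
move=> hp hq; apply/ctends_shift => /=.
apply: (ctends_ext (N := 0)); last exact: ctendsM (ctends_cst _) (ctendsM hp hq).
by move=> n _; rewrite !cexpD.
Qed.

Lemma tree_good_split x y z : admissible x y z ->
  tree_good x (x * y - z) y -> tree_good (x * y - z) y x -> tree_good x y z.
Proof.
move=> [m rx ry rl] [b1 g1] [b2 g2]; split; first exact: tree_bounded_split.
by rewrite (gapG_split m rx ry (rl [::])); apply: tree_lim_split.
Qed.

Definition deep x y z : Prop :=
  [/\ markoff tau x y z, large_bound tau <= cmod x, large_bound tau <= cmod y &
      cmod z <= cmod (x * y - z)].

Lemma outward_region x y z : cmod z <= cmod (x * y - z) ->
  cmod x * cmod y <= 2 * cmod (x * y - z).
Proof.
by move=> zw; have := cmodD (x * y - z) z; rewrite subrK cmodM; lra.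
Qed.

Lemma deep_region x y z : deep x y z ->
  5 * cmod x <= cmod (x * y - z) /\ 5 * cmod y <= cmod (x * y - z).
Proof.
move=> [_ bx byy /outward_region h]; have := large_ge10 tau.
by have := cmod_ge0 x; have := cmod_ge0 y; split; nra.
Qed.

Lemma deepL x y z : deep x y z -> deep x (x * y - z) y.
Proof.
move=> d; have [c1 c2] := deep_region d; have [m bx byy zw] := d.
have b10 := large_ge10 tau; split=> //; first exact: markoffL.
  by have := cmod_ge0 x; lra.
have := cmod_lbB (x * (x * y - z)) y; rewrite cmodM.
have : 10 * cmod (x * y - z) <= cmod x * cmod (x * y - z).
  by rewrite ler_wpM2r ?cmod_ge0 //; lra.
by have := cmod_ge0 y; lra.
Qed.

Lemma deep_swap x y z : deep x y z -> deep y x z.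
Proof. by move=> [m bx byy zw]; split; rewrite 1?mulrC //; apply: markoff_swap. Qed.

Lemma deepR x y z : deep x y z -> deep (x * y - z) y x.
Proof.
move=> /deep_swap/deepL/deep_swap; by rewrite (mulrC y x).
Qed.

Lemma deep_admissible x y z : deep x y z -> admissible x y z.
Proof.
move=> d; have [m bx byy _] := d; split=> //; try exact: large_regular.
move=> l; apply: large_regular; elim: l x y z d {m bx byy} => [|[] l IH] x y z d.
- have [c1 _] := deep_region d; have [_ bx _ _] := d => /=.
  by have := cmod_ge0 x; lra.
- exact: IH (deepR d).
- exact: IH (deepL d).
Qed.

(** A factor 1/4 for each of two children makes the total weight at least halve from one level to
    the next. *)
Lemma deep_weightL x y z : deep x y z ->
  edge_weight x (x * y - z) <= edge_weight x y / 4.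
Proof.
move=> d; have [_ c2] := deep_region d; have [_ bx byy _] := d.
have b10 := large_ge10 tau.
have cx : 0 < cmod x by lra.
have cy : 0 < cmod y by lra.
have -> : edge_weight x y / 4 = (2 * (cmod x * cmod y)) ^- 2.
  by rewrite /edge_weight; field; rewrite !gt_eqF.
rewrite /edge_weight lef_pV2 ?posrE ?exprn_gt0 ?mulr_gt0 //; last by lra.
rewrite ler_pXn2r ?nnegrE ?mulr_ge0 ?cmod_ge0 // mulrCA ler_wpM2l ?cmod_ge0 //.
by lra.
Qed.

Lemma edge_weightC x y : edge_weight x y = edge_weight y x.
Proof. by rewrite /edge_weight mulrC. Qed.

Lemma deep_weightR x y z : deep x y z ->
  edge_weight (x * y - z) y <= edge_weight x y / 4.
Proof.
by move=> /deep_swap/deep_weightL; rewrite edge_weightC (edge_weightC y) (mulrC y).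
Qed.

(** The constant 8 solves [4 + 2 (8/4) = 8]: the first region costs at most 4 weights, and each of
    the two subtrees has at most a quarter of the weight. *)
Lemma deep_tree_norm n x y z : deep x y z ->
  tree_norm n x y z <= 8 * hfrak_const tau * edge_weight x y.
Proof.
have D0 := hfrak_const_ge0 tau.
elim: n x y z => [|n IH] x y z d.
  by rewrite /= mulr_ge0 ?edge_weight_ge0 //; lra.
have L := IH _ _ _ (deepL d); have Rr := IH _ _ _ (deepR d).
have wL := deep_weightL d; have wR := deep_weightR d.
have [_ bx byy /outward_region h] := d; have [c1 _] := deep_region d.
have b10 := large_ge10 tau.
have cx : 0 < cmod x by lra.
have cy : 0 < cmod y by lra.
have bw : large_bound tau <= cmod (x * y - z) by lra.
have hw := cmod_hfrak bw.
rewrite tree_normS.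
have wE : (cmod (x * y - z)) ^- 2 <= 4 * edge_weight x y.
  have -> : 4 * edge_weight x y = (cmod x * cmod y / 2) ^- 2.
    by rewrite /edge_weight; field; rewrite !gt_eqF.
  rewrite lef_pV2 ?posrE ?exprn_gt0 ?divr_gt0 ?mulr_gt0 //; last by lra.
  rewrite ler_pXn2r ?nnegrE ?divr_ge0 ?mulr_ge0 ?cmod_ge0 //; by lra.
have e1 : hfrak_const tau * (cmod (x * y - z)) ^- 2 <=
  hfrak_const tau * (4 * edge_weight x y) by rewrite ler_wpM2l.
have e2 : hfrak_const tau * edge_weight x (x * y - z) <=
  hfrak_const tau * (edge_weight x y / 4) by rewrite ler_wpM2l.
have e3 : hfrak_const tau * edge_weight (x * y - z) y <=
  hfrak_const tau * (edge_weight x y / 4) by rewrite ler_wpM2l.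
lra.
Qed.

(** Both factors differ from 1 by at most [u/4], where [u <= 1] is the bound carried so far; the
    product then differs from 1 by at most [u/2 + u^2/16], which is below [3u/4]. *)
Lemma deep_leaf_prod n x y z : deep x y z ->
  cmod (leaf_prod n x y z - 1) <= (3 / 4) ^+ n * gapG_const tau * edge_weight x y.
Proof.
have C0 := gapG_const_ge0 tau.
elim: n x y z => [|n IH] x y z d.
  by have [m bx byy zw] := d; rewrite expr0 mul1r /=; apply: cmod_gapG.
have L := IH _ _ _ (deepL d); have Rr := IH _ _ _ (deepR d).
have wL := deep_weightL d; have wR := deep_weightR d.
have [_ bx byy _] := d; have b10 := large_ge10 tau.
have cx : 0 < cmod x by lra.
have cy : 0 < cmod y by lra.
have B0 := edge_weight_ge0 x y.
have CB : gapG_const tau * edge_weight x y <= 1.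
  have Cb : gapG_const tau <= large_bound tau.
    have [E10 E20 D0 M0] := norms_ge0 tau; rewrite /large_bound; lra.
  rewrite /edge_weight ler_pdivrMr ?exprn_gt0 ?mulr_gt0 // mul1r.
  have : 10 * large_bound tau <= cmod x * cmod y by nra.
  by rewrite expr2; nra.
rewrite [leaf_prod n.+1 _ _ _]/=.
set a := leaf_prod n x _ y in L *; set b := leaf_prod n _ y x in Rr *.
set k := (3 / 4) ^+ n * gapG_const tau in L Rr.
have k0 : 0 <= k by rewrite mulr_ge0 // exprn_ge0 //; lra.
have kC : k <= gapG_const tau by rewrite /k ler_piMl // exprn_ile1 //; lra.
have e1 : k * edge_weight x (x * y - z) <= k * (edge_weight x y / 4) by rewrite ler_wpM2l.
have e2 : k * edge_weight (x * y - z) y <= k * (edge_weight x y / 4) by rewrite ler_wpM2l.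
have -> : a * b - 1 = (a - 1) * (b - 1) + ((a - 1) + (b - 1)) by ring.
apply: (le_trans (cmodD _ _)); rewrite cmodM.
have := cmodD (a - 1) (b - 1); have := cmod_ge0 (a - 1); have := cmod_ge0 (b - 1).
set p := cmod (a - 1) in L *; set q := cmod (b - 1) in Rr * => q0 p0 pq.
have -> : (3 / 4) ^+ n.+1 * gapG_const tau * edge_weight x y =
    3 / 4 * (k * edge_weight x y) by rewrite exprS /k; ring.
have kB : k * edge_weight x y <= 1.
  by apply: le_trans CB; rewrite ler_wpM2r.
have p1 : p <= k * edge_weight x y / 4 by lra.
have q1 : q <= k * edge_weight x y / 4 by lra.
have kB0 : 0 <= k * edge_weight x y by rewrite mulr_ge0.
by move: (k * edge_weight x y) kB p1 q1 kB0 => u *; nra.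
Qed.

Lemma deep_good x y z : deep x y z -> tree_good x y z.
Proof.
move=> d; have adm := deep_admissible d; have [m rx ry _] := adm; split.
  by exists (8 * hfrak_const tau * edge_weight x y) => n; apply: deep_tree_norm.
have g0 := gapG_neq0 m rx ry.
have leaf1 : ctends (fun n => leaf_prod n x y z) 1.
  move=> e e0; set B := gapG_const tau * edge_weight x y.
  have B0 : 0 <= B by rewrite mulr_ge0 ?edge_weight_ge0 ?gapG_const_ge0.
  have : (fun n => (3 / 4 : R) ^+ n) @ \oo --> (0 : R).
    by apply: cvg_expr; rewrite ger0_norm; lra.
  move=> /cvgrPdist_lt /(_ (e / (B + 1))) [|N _ hN].
    by rewrite divr_gt0 //; lra.
  exists N => n /hN /=; rewrite sub0r normrN ger0_norm; last by rewrite exprn_ge0 //; lra.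
  rewrite ltr_pdivlMr; last by lra.
  have := deep_leaf_prod n d; rewrite -mulrA -/B.
  have : 0 <= (3 / 4 : R) ^+ n by rewrite exprn_ge0 //; lra.
  nra.
(* By [gapG_tree] the exponential of the truncated sum is [G] divided by the leaf product. *)
have := ctendsM (ctends_cst (gapG tau x y z)) (ctendsV (oner_neq0 _) leaf1).
rewrite invr1 mulr1; apply: (ctends_ext (N := 0)) => n _.
have := gapG_tree n adm; set S := cexp _; set L := leaf_prod _ _ _ _ => e.
rewrite {1}e mulfK //; apply: contraNneq g0 => L0.
by rewrite e L0 mulr0.
Qed.

End Trees.

(** * Fans around a fixed region *)

Section Fan.
Variable R : realType.
Implicit Types x a b : R[i].

Definition fan x a b (n : nat) : R[i] :=
  (iter n (fun p => (p.2, x * p.2 - p.1)) (a, b)).1.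

Lemma fanSS x a b n : fan x a b n.+2 = x * fan x a b n.+1 - fan x a b n.
Proof. by []. Qed.

Section Eigenvalues.
Variables x a b : R[i].
Hypothesis x0 : x != 0.
Let y := fan x a b.
(** [eig1] and [eig2] are the eigenvalues of the recurrence; the branch chosen in [h] makes [eig2]
    the one that does not expand. *)
Definition eig1 := x * (1 - hfun x).
Definition eig2 := x * hfun x.

Lemma eigM : eig1 * eig2 = 1.
Proof.
rewrite /eig1 /eig2 mulrACA (mulrC (1 - _)) hfun_eq // -expr2 mulfV //.
by rewrite expf_neq0.
Qed.

Lemma eigD : eig1 + eig2 = x.
Proof. by rewrite /eig1 /eig2; ring. Qed.

Lemma cmod_eig : cmod eig2 <= 1 <= cmod eig1.
Proof.
have le : cmod eig2 <= cmod eig1.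
  rewrite /eig1 /eig2 (cmodM x (hfun x)) (cmodM x (1 - _)).
  by rewrite ler_wpM2l ?cmod_ge0 // hfun_le_sub1.
have := congr1 (@cmod R) eigM; rewrite cmodM cmod1.
by have := cmod_ge0 eig1; have := cmod_ge0 eig2 => *; apply/andP; split; nra.
Qed.

Lemma fan_eig1 n : y n.+1 - eig2 * y n = eig1 ^+ n * (b - eig2 * a).
Proof.
elim: n => [|n IH]; first by rewrite expr0 mul1r.
rewrite exprS -mulrA -IH /y fanSS mulrBr mulrA eigM mul1r -{1}eigD; ring.
Qed.

Lemma fan_eig2 n : y n.+1 - eig1 * y n = eig2 ^+ n * (b - eig1 * a).
Proof.
elim: n => [|n IH]; first by rewrite expr0 mul1r.
rewrite exprS -mulrA -IH /y fanSS mulrBr mulrA (mulrC eig2 eig1) eigM mul1r -{1}eigD.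
ring.
Qed.

(** This is the quadratic form preserved by the recurrence; on Markoff triples its value is
    [mu - x^2]. *)
Lemma eig_dispersion : (b - eig2 * a) * (b - eig1 * a) = b ^+ 2 + a ^+ 2 - x * b * a.
Proof.
transitivity (b ^+ 2 + (eig1 * eig2) * a ^+ 2 - (eig1 + eig2) * b * a); first by ring.
by rewrite eigM eigD mul1r.
Qed.

Lemma cmod_fan_eig2 n : cmod (y n.+1 - eig1 * y n) <= cmod (b - eig1 * a).
Proof.
rewrite fan_eig2 cmodM cmodX ler_piMl ?cmod_ge0 // exprn_ile1 ?cmod_ge0 //.
by case/andP: cmod_eig.
Qed.

Lemma bernoulli_ineq (t : R) n : 0 <= t -> 1 + n%:R * t <= (1 + t) ^+ n.
Proof.
move=> t0; elim: n => [|n IH]; first by rewrite mul0r addr0 expr0.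
rewrite exprS -natr1; have n0 : 0 <= n%:R :> R by [].
have : (1 + t) * (1 + n%:R * t) <= (1 + t) * (1 + t) ^+ n by rewrite ler_wpM2l //; lra.
by have := mulr_ge0 n0 (mulr_ge0 t0 t0); lra.
Qed.

(** Two eigenvalues of modulus one are conjugate, so their sum [x] is real and lies in (-2, 2)
    unless they coincide. *)
Lemma eig_unit : cmod eig1 = 1 -> ~ (- 2 < x < 2) -> eig2 = eig1 /\ eig1 ^+ 2 = 1.
Proof.
move=> e1 xI; have := eigM; have := eigD; have := cmod_sqr eig1; rewrite e1 expr1n.
case: eig1 eig2 => u v [p q] /= n1 D; simpc => -[m1 m2].
have pu : p = u.
  have : u * (u * p - v * q) + v * (u * q + v * p) = u by rewrite m1 m2; ring.
  by rewrite (_ : _ + _ = (u ^+ 2 + v ^+ 2) * p); [rewrite -n1 mul1r|ring].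
have qv : q = - v.
  have : u * (u * q + v * p) - v * (u * p - v * q) = - v by rewrite m1 m2; ring.
  by rewrite (_ : _ - _ = (u ^+ 2 + v ^+ 2) * q); [rewrite -n1 mul1r|ring].
have [v0|v0] := eqVneq v 0.
  rewrite pu qv v0 oppr0; split=> //; rewrite expr2; simpc.
  by congr (_ +i* _); move: n1; rewrite v0; lra.
exfalso; apply: xI; rewrite -D pu qv; simpc.
have v2 : 0 < v ^+ 2 by rewrite exprn_even_gt0.
by apply/and3P; split=> //=; nra.
Qed.

Hypothesis x_notin : ~ (- 2 < x < 2).
Hypothesis disp0 : b ^+ 2 + a ^+ 2 - x * b * a != 0.

(** The growth is exponential if [|eig1| > 1], and linear if the eigenvalues coincide. The linear
    bound covers both cases and suffices, because [1/n^2] is summable. *)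
Lemma fan_linear : exists c : R, 0 < c /\
  exists N, forall n, (N <= n)%N -> c * n%:R <= cmod (y n).
Proof.
have [D0 E0] : b - eig2 * a != 0 /\ b - eig1 * a != 0.
  by move: disp0; rewrite -eig_dispersion mulf_eq0 negb_or => /andP.
suff [p [q [p0 h]]] : exists p q : R, 0 < p /\ forall n, p * n%:R - q <= cmod (y n).
  exists (p / 2); split; first by rewrite divr_gt0.
  exists (Num.bound `|2 * q / p|) => n Nn.
  have q2 : 2 * q / p <= n%:R.
    apply: (le_trans (ler_norm _)); apply/ltW/(lt_le_trans (archi_boundP (normr_ge0 _))).
    by rewrite ler_nat.
  have := h n; move: q2; rewrite ler_pdivrMr // => q2; lra.
have [_ e1] := andP cmod_eig.
have [e1'|e1'] := eqVneq (cmod eig1) 1.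
  have [e2 sq1] := eig_unit e1' x_notin.
  exists (cmod (b - eig2 * a)), (cmod a); split; first by rewrite cmod_gt0.
  move=> n; have lin : eig1 ^+ n * y n = a + n%:R * (eig1 * (b - eig2 * a)).
    elim: n => [|n IH]; first by rewrite expr0 mul1r mul0r addr0.
    have -> : y n.+1 = eig2 * y n + eig1 ^+ n * (b - eig2 * a).
      by rewrite -fan_eig1; ring.
    have sqn : eig1 ^+ n * eig1 ^+ n = 1 by rewrite -exprD addnn -mul2n exprM sq1 expr1n.
    rewrite exprS -natr1.
    transitivity (eig1 * eig2 * (eig1 ^+ n * y n) +
      (eig1 ^+ n * eig1 ^+ n) * (eig1 * (b - eig2 * a))); first by ring.
    by rewrite eigM sqn IH; ring.
  have := congr1 (@cmod R) lin; rewrite cmodM cmodX e1' expr1n mul1r => ->.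
  have := cmod_lbD (n%:R * (eig1 * (b - eig2 * a))) a.
  rewrite (cmodM n%:R) (cmodM eig1) e1' cmod_nat mul1r => le.
  by rewrite [a + _]addrC mulrC.
have e1l : 1 < cmod eig1 by rewrite lt_neqAle eq_sym e1'.
have d0 : 0 < cmod (eig1 - eig2).
  have := cmod_lbB eig1 eig2; have [e2 _] := andP cmod_eig; lra.
exists ((cmod eig1 - 1) * cmod (b - eig2 * a) / cmod (eig1 - eig2)).
exists (cmod (b - eig1 * a) / cmod (eig1 - eig2)); split.
  by rewrite divr_gt0 // mulr_gt0 ?cmod_gt0 // subr_gt0.
move=> n.
have e : (eig1 - eig2) * y n = eig1 ^+ n * (b - eig2 * a) - (y n.+1 - eig1 * y n).
  by rewrite -fan_eig1; ring.
have := congr1 (@cmod R) e; rewrite cmodM => e'.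
rewrite mulrAC -mulrBl ler_pdivrMr // [X in _ <= X]mulrC e'.
have := cmod_lbB (eig1 ^+ n * (b - eig2 * a)) (y n.+1 - eig1 * y n).
have := cmod_fan_eig2 n; rewrite cmodM cmodX.
have : n%:R * (cmod eig1 - 1) <= cmod eig1 ^+ n.
  have := @bernoulli_ineq (cmod eig1 - 1) n; rewrite addrCA subrr addr0 => B.
  have := B _; rewrite subr_ge0 => /(_ e1); lra.
have Dge := cmod_ge0 (b - eig2 * a).
move=> /(ler_wpM2r Dge); lra.
Qed.

End Eigenvalues.
End Fan.

Section FanGood.
Variables (R : realType) (tau : R[i]).
Implicit Types x y z w : R[i].

Lemma ctends0_le (u : nat -> R[i]) (C : R) N :
  (forall n, (N <= n)%N -> cmod (u n) * n%:R <= C) -> ctends u 0.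
Proof.
move=> h e e0; exists (maxn N (Num.bound (`|C| / e))) => n.
rewrite geq_max => /andP[n1 n2].
rewrite subr0 ltNge; apply/negP => le.
have Ce : `|C| / e < n%:R.
  apply: (lt_le_trans (archi_boundP _)); first by rewrite divr_ge0 // ltW.
  by rewrite ler_nat.
have := h n n1; move: Ce; rewrite ltr_pdivrMr // => Ce.
have n0 : 0 <= n%:R :> R by [].
have := ler_norm C; have : e * n%:R <= cmod (u n) * n%:R by rewrite ler_wpM2r.
by rewrite (mulrC e); lra.
Qed.

Lemma ctends_comp_shift (u : nat -> R[i]) l k :
  ctends (fun n => u (n + k)%N) l <-> ctends u l.
Proof.
elim: k => [|k IH]; first by split; apply: (ctends_ext (N := 0)) => n _; rewrite addn0.
rewrite -IH -(ctends_shift (fun n => u (n + k)%N)).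
by split; apply: (ctends_ext (N := 0)) => n _; rewrite addSnnS.
Qed.

Lemma fan_admissible x a b n : admissible tau x b a ->
  admissible tau x (fan x a b n.+1) (fan x a b n).
Proof. by elim: n => //= n IH /IH /admissibleL. Qed.

Section Fan.
Variables x a b : R[i].
Hypothesis adm : admissible tau x b a.
Hypothesis x_notin : ~ (- 2 < x < 2).
Let y := fan x a b.

Let admn n : admissible tau x (y n.+1) (y n).
Proof. exact: fan_admissible. Qed.

Let x0 : x != 0.
Proof. by have [_ /regular_neq0] := adm. Qed.

Let disp0 : b ^+ 2 + a ^+ 2 - x * b * a != 0.
Proof.
have [m /andP[_ xm] _ _] := adm.
have -> : b ^+ 2 + a ^+ 2 - x * b * a = (tau + 2) - x ^+ 2 by rewrite -m; ring.
by rewrite subr_eq0 eq_sym.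
Qed.

Lemma fan_deep : exists c N, [/\ 0 < c, (0 < N)%N &
  forall n, (N <= n)%N -> [/\ large_bound tau <= cmod (y n), c * n%:R <= cmod (y n) &
    deep tau (y n.+2) (y n.+1) x]].
Proof.
have [c [c0 [N hN]]] := fan_linear x0 x_notin disp0.
have b10 := large_ge10 tau; have cx := cmod_ge0 x.
(* The summand [2 |x|] gives [K^2 >= 2 |x|], from which the edges leaving the fan satisfy the last
   clause of [deep]. *)
pose K := large_bound tau + 2 * cmod x.
exists c, (maxn N (Num.bound (K / c))).+1; split=> // n nN.
have large k : (n <= k)%N -> K <= cmod (y k).
  move=> nk; have : (maxn N (Num.bound (K / c)) <= k)%N by apply: leq_trans (ltnW nN) nk.
  rewrite geq_max => /andP[/hN h kb]; apply: le_trans h.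
  rewrite mulrC -ler_pdivrMr //; apply: ltW; apply: (lt_le_trans (archi_boundP _)).
    by rewrite divr_ge0 ?ltW //; rewrite /K; lra.
  by rewrite ler_nat.
have [yn y1 y2] := And3 (large n (leqnn _)) (large n.+1 (leqnSn _))
  (large n.+2 (leq_trans (leqnSn _) (leqnSn _))).
have KB : large_bound tau <= K by rewrite /K; lra.
split; [exact: le_trans yn|apply: hN|split].
- by apply: leq_trans (leq_maxl _ _) (ltnW nN).
- by have [m _ _ _] := admn n; have := markoffR m.
- exact: le_trans y2.
- exact: le_trans y1.
have := cmod_lbB (y n.+2 * y n.+1) x; rewrite cmodM.
have : K * K <= cmod (y n.+2) * cmod (y n.+1) by apply: ler_pM => //; lra.
have : 2 * cmod x <= K * K by rewrite /K; nra.
lra.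
Qed.

(** Each step along the fan adds one region and one deep tree, of size [1/(n+1)^2] up to constants;
    this telescopes against [1/n - 1/(n+1)]. The 9 is 1 for the region and 8 from
    [deep_tree_norm]. *)
Lemma fan_tree_norm : exists k N, [/\ 0 <= k, (0 < N)%N & forall n m, (N <= n)%N ->
  tree_norm tau m x (y n.+1) (y n) <= k / n%:R].
Proof.
have [c [N [c0 N0 h]]] := fan_deep.
have D0 := hfrak_const_ge0 tau; have b10 := large_ge10 tau.
exists (9 * hfrak_const tau / c ^+ 2), N; split=> // [|n m].
  by rewrite divr_ge0 ?sqr_ge0 //; lra.
have k0 : 0 <= hfrak_const tau / c ^+ 2 by rewrite divr_ge0 ?sqr_ge0.
elim: m n => [|m IH] n nN.
  by rewrite /= mulr_ge0 ?invr_ge0 // -mulrA; lra.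
have IHn := IH n.+1 (leqW nN).
have [yb yc dp] := h n nN; have [y1b y1c _] := h n.+1 (leqW nN).
have [y2b y2c _] := h n.+2 (leqW (leqW nN)).
rewrite tree_normS -fanSS -/(y _).
have n0 : 0 < n%:R :> R by rewrite ltr0n; apply: leq_trans nN.
have n1E : n.+1%:R = n%:R + 1 :> R by rewrite natr1.
have n2E : n.+2%:R = n%:R + 2 :> R by rewrite -addn2 natrD.
set t := n%:R in n0 n1E n2E *.
have inv2 (v : R) : c * (t + 1) <= v -> v ^- 2 <= (t + 1) ^- 2 / c ^+ 2.
  move=> cv; have ct : 0 < c * (t + 1) by rewrite mulr_gt0 //; lra.
  rewrite -invfM mulrC -exprMn lef_pV2 ?posrE ?exprn_gt0 //; last by lra.
  by rewrite ler_pXn2r ?nnegrE //; lra.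
have t1 : cmod (hfrak tau (y n.+2)) <= hfrak_const tau / c ^+ 2 * (t + 1) ^- 2.
  apply: (le_trans (cmod_hfrak y2b)); rewrite -mulrA ler_wpM2l // mulrC.
  by apply: inv2; apply: le_trans y2c; rewrite ler_wpM2l ?ltW // n2E; lra.
have t2 : tree_norm tau m (y n.+2) (y n.+1) x <=
    8 * (hfrak_const tau / c ^+ 2 * (t + 1) ^- 2).
  apply: (le_trans (deep_tree_norm m dp)).
  have /inv2 iv : c * (t + 1) <= cmod (y n.+2) * cmod (y n.+1).
    rewrite -n1E; apply: (le_trans y1c).
    by rewrite ler_peMl ?cmod_ge0 //; lra.
  have := ler_wpM2l D0 iv; rewrite -/(edge_weight _ _).
  have -> : hfrak_const tau * ((t + 1) ^- 2 / c ^+ 2) =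
    hfrak_const tau / c ^+ 2 * (t + 1) ^- 2 by rewrite mulrCA mulrC.
  by rewrite -mulrA; lra.
rewrite n1E in IHn.
have frac : (t + 1) ^- 2 <= t^-1 - (t + 1)^-1.
  have -> : t^-1 - (t + 1)^-1 = (t * (t + 1))^-1 by field; rewrite !gt_eqF //; lra.
  by rewrite lef_pV2 ?posrE ?exprn_gt0 ?mulr_gt0 ?expr2 //; nra.
set k := hfrak_const tau / c ^+ 2 in k0 t1 t2 IHn *.
have k9 : 9 * hfrak_const tau / c ^+ 2 = 9 * k by rewrite /k mulrA.
rewrite k9 in IHn *.
have := ler_wpM2l k0 frac; lra.
Qed.

(** As [y_(n+1) - eig1 y_n] stays bounded while [y_n] grows, [y_n / y_(n+1)] tends to
    [1/eig1 = eig2 = x h(x)]. So the numerator of [G] tends to [P(x)], and [P(y_(n+1))] tends to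
    1. *)
Lemma fan_gapG : ctends (fun n => gapG tau x (y n.+1) (y n)) 1.
Proof.
have [c [N [c0 N0 h]]] := fan_deep; have b10 := large_ge10 tau.
have [_ rx _ _] := adm; have Px := gapP_neq0 rx.
set eps := cexp (cacosh (- tau / 2)).
have cn n : (N <= n)%N -> n%:R * c <= cmod (y n.+1).
  move=> nN; have [_ yc _] := h n.+1 (leqW nN).
  by apply: le_trans yc; rewrite mulrC ler_wpM2l ?ltW // ltr_nat.
have h0 : ctends (fun n => hfun (y n.+1)) 0.
  apply: (@ctends0_le _ (2 / c) N) => n nN; have [yb yc _] := h n.+1 (leqW nN).
  have y0 : 0 < cmod (y n.+1) by lra.
  have hy := cmod_hfun (large_neq0 yb).
  rewrite ler_pdivlMr // -mulrA.
  apply: (@le_trans _ _ (2 / cmod (y n.+1) ^+ 2 * cmod (y n.+1))).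
    by apply: ler_pM (cmod_ge0 _) (mulr_ge0 (ler0n _ _) (ltW c0)) hy (cn n nN).
  have -> : 2 / cmod (y n.+1) ^+ 2 * cmod (y n.+1) = 2 / cmod (y n.+1).
    by field; rewrite gt_eqF.
  by rewrite ler_pdivrMr //; lra.
have P1 : ctends (fun n => gapP tau (y n.+1)) 1.
  have := ctendsD (ctends_cst 1) (ctendsM (ctends_cst (eps - 1)) h0).
  by rewrite mulr0 addr0.
have r0 : ctends (fun n => (y n.+1 - eig1 x * y n) / y n.+1) 0.
  apply: (@ctends0_le _ (cmod (b - eig1 x * a) / c) N) => n nN.
  have [yb yc _] := h n.+1 (leqW nN); have y0 : 0 < cmod (y n.+1) by lra.
  rewrite (cmod_div _ (y n.+1)) ler_pdivlMr // -(mulrA _ n%:R c) mulrAC ler_pdivrMr //.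
  apply: ler_pM (cmod_ge0 _) (mulr_ge0 (ler0n _ _) (ltW c0)) _ (cn n nN).
  exact: cmod_fan_eig2.
have t1 : ctends (fun n => y n / (x * y n.+1)) (hfun x).
  have -> : hfun x = eig2 x / x * (1 + -1 * 0).
    by rewrite mulr0 addr0 mulr1 /eig2 mulrAC mulfV // mul1r.
  have := ctendsM (ctends_cst (eig2 x / x))
    (ctendsD (ctends_cst 1) (ctendsM (ctends_cst (-1)) r0)).
  apply: (ctends_ext (N := N)) => n nN; have [yb _ _] := h n.+1 (leqW nN).
  have y0 := large_neq0 yb.
  transitivity (eig1 x * eig2 x * (y n / (x * y n.+1))); last by rewrite eigM // mul1r.
  by field; rewrite x0 y0.
have := ctendsM (ctendsD (ctends_cst 1) (ctendsM (ctends_cst (eps - 1)) t1))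
  (ctendsV _ (ctendsM (ctends_cst (gapP tau x)) P1)).
by rewrite mulr1 /gapP -/eps => /(_ Px); rewrite divff.
Qed.

(** The product over the tree and [G] have the same ratio at all late edges of the fan, because the
    deep side trees contribute equal factors to both. Both tend to 1, so the ratio is 1. *)
Lemma fan_good : exists n, tree_good tau x (y n.+1) (y n).
Proof.
have [c [N1 [c0 N10 hd]]] := fan_deep; have [k [N2 [k0 N20 hT]]] := fan_tree_norm.
pose N := maxn N1 N2.
have bounded n : (N <= n)%N -> tree_bounded tau x (y n.+1) (y n).
  rewrite geq_max => /andP[_ n2]; exists (k / n%:R) => m; exact: hT.
(* Before [N] the value 0 is arbitrary; it only makes [s] a total sequence. *)
have ex n : exists s, (N <= n)%N -> ctends (fun m => tree_sum tau m x (y n.+1) (y n)) s.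
  have [nN|] := leqP N n; last by exists 0.
  by have [s hs] := tree_bounded_lim (bounded n nN); exists s.
have [s hs] := choice ex; pose p n := cexp (s n).
have hp n : (N <= n)%N -> ctends (fun m => cexp (tree_sum tau m x (y n.+1) (y n))) (p n).
  by move=> /hs; apply: ctends_cexp.
have g0 n : gapG tau x (y n.+1) (y n) != 0.
  by have [m rx ry _] := admn n; apply: gapG_neq0.
have ratio n : (N <= n)%N ->
    p n.+1 / gapG tau x (y n.+2) (y n.+1) = p n / gapG tau x (y n.+1) (y n).
  move=> nN; have : (N1 <= n)%N by apply: leq_trans nN; apply: leq_maxl.
  move=> /hd[_ _ d]; have [_ dg] := deep_good d.
  have pn := ctends_unique (hp n nN) (tree_lim_split (hp n.+1 (leqW nN)) dg).
  have [m rx ry rl] := admn n.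
  have gn := gapG_split m rx ry (rl [::]).
  have [md rd1 rd2 _] := deep_admissible d.
  rewrite pn gn -fanSS -/(y _).
  move: (cexp_neq0 (hfrak tau (y n.+2))) (g0 n.+1) (gapG_neq0 md rd1 rd2).
  set E := cexp _; set g1 := gapG tau x _ _; set g2 := gapG tau (y n.+2) _ _.
  by move: E g1 g2 => E g1 g2 *; field; apply/and3P.
have ratioN n : p (n + N)%N / gapG tau x (y (n + N)%N.+1) (y (n + N)%N) =
    p N / gapG tau x (y N.+1) (y N).
  by elim: n => // n IH; rewrite addSn ratio ?leq_addl.
have s0 : ctends s 0.
  apply: (@ctends0_le _ k N) => n nN.
  have n0 : 0 < n%:R :> R.
    by rewrite ltr0n; apply: leq_trans nN; rewrite /N; apply: leq_trans N10 (leq_maxl _ _).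
  rewrite -ler_pdivlMr //; apply/ler_addgt0Pr => e e0.
  have [M hM] := hs n nN e e0; have := hM M (leqnn _).
  have : cmod (tree_sum tau M x (y n.+1) (y n)) <= k / n%:R.
    apply: (le_trans (cmod_tree_sum _ _ _ _ _)); apply: hT.
    by apply: leq_trans nN; apply: leq_maxr.
  have := cmod_lbB (s n) (tree_sum tau M x (y n.+1) (y n)); rewrite cmodBC; lra.
have p1 : ctends p 1 by have := ctends_cexp s0; rewrite cexp0.
have one : p N / gapG tau x (y N.+1) (y N) = 1.
  apply: (@ctends_unique _
    (fun n => p (n + N)%N / gapG tau x (y (n + N)%N.+1) (y (n + N)%N))).
    by apply: (ctends_ext (N := 0)); last exact: ctends_cst.
  rewrite -[1](divff (oner_neq0 _)).
  apply: (ctendsM (u := fun n => p (n + N)%N)).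
    exact/ctends_comp_shift.
  by apply: ctendsV (oner_neq0 _) _;
    apply/(ctends_comp_shift (fun n => gapG tau x (y n.+1) (y n)))/fan_gapG.
exists N; split; first exact: bounded.
have <- : p N = gapG tau x (y N.+1) (y N) by rewrite -[LHS](divfK (g0 N)) one mul1r.
exact: hp.
Qed.

End Fan.
End FanGood.

(** * Paths that turn infinitely often *)

Section Path.
Variables (R : realType) (tau : R[i]).
Hypothesis tau2 : tau <> 2.
Implicit Types a b c : R[i].

Lemma parallelogram a b :
  cmod (a - b) ^+ 2 + cmod (a + b) ^+ 2 = 2 * cmod a ^+ 2 + 2 * cmod b ^+ 2.
Proof. by rewrite !cmod_sqr; case: a b => [? ?] [? ?] /=; ring. Qed.

Variables (d : nat -> bool) (x y z : nat -> R[i]).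
Let w n := x n * y n - z n.
Hypothesis turnL : forall n, ~~ d n -> [/\ x n.+1 = x n, y n.+1 = w n & z n.+1 = y n].
Hypothesis turnR : forall n, d n -> [/\ x n.+1 = w n, y n.+1 = y n & z n.+1 = x n].
Hypothesis infL : forall m, exists2 n, (m <= n)%N & ~~ d n.
Hypothesis infR : forall m, exists2 n, (m <= n)%N & d n.
Hypothesis markoff_path : forall n, markoff tau (x n) (y n) (z n).

(* Both sides of the path get replaced by new regions infinitely often. *)
Lemma path_refresh (P : R[i] -> Prop) m : (forall n, (m <= n)%N -> P (w n)) ->
  exists2 k, (m <= k)%N & forall n, (k <= n)%N -> P (x n) /\ P (y n).
Proof.
move=> Pw; have [n1 m1 d1] := infL m; have [n2 m2 d2] := infR m.
exists (maxn n1 n2).+1.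
  by apply: leq_trans m1 _; apply: leq_trans (leq_maxl _ _) (leqnSn _).
have Px k : P (x (n2.+1 + k)%N).
  elim: k => [|k IH]; first by rewrite addn0; have [-> _ _] := turnR d2; apply: Pw.
  rewrite addnS; case: (boolP (d (n2.+1 + k)%N)) => [/turnR[-> _ _]|/turnL[-> _ _]] //.
  by apply: Pw; apply: leq_trans m2 _; rewrite addSnnS leq_addr.
have Py k : P (y (n1.+1 + k)%N).
  elim: k => [|k IH]; first by rewrite addn0; have [_ -> _] := turnL d1; apply: Pw.
  rewrite addnS; case: (boolP (d (n1.+1 + k)%N)) => [/turnR[_ -> _]|/turnL[_ -> _]] //.
  by apply: Pw; apply: leq_trans m1 _; rewrite addSnnS leq_addr.
move=> n; rewrite gtn_max => /andP[h1 h2].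
by rewrite -(subnKC h2); split=> //; rewrite subnKC // -(subnKC h1).
Qed.

Section Eventually.
Variable n0 : nat.
Hypothesis gt2 : forall n, (n0 <= n)%N -> 2 < cmod (x n) /\ 2 < cmod (y n).

Lemma path_gt2_w n : (n0 <= n)%N -> 2 < cmod (w n).
Proof.
move=> nn; have [g1 g2] := gt2 (leqW nn).
by case: (boolP (d n)) => [/turnR[<- _ _]|/turnL[_ <- _]].
Qed.

Definition outward n := cmod (z n) <= cmod (w n).

Lemma outward_w n : outward n -> cmod (x n) * cmod (y n) <= 2 * cmod (w n).
Proof. exact: outward_region. Qed.

Lemma outwardS n : (n0 <= n)%N -> outward n -> outward n.+1.
Proof.
move=> nn /outward_w h; have [g1 g2] := gt2 nn; rewrite /outward [w n.+1]/w.
have cw := cmod_ge0 (w n).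
case: (boolP (d n)) => [/turnR[-> -> ->]|/turnL[-> -> ->]].
  have := cmod_lbB (w n * y n) (x n); rewrite cmodM.
  have : 2 * cmod (w n) <= cmod (w n) * cmod (y n) by nra.
  have : cmod (x n) <= cmod (w n) by nra.
  lra.
have := cmod_lbB (x n * w n) (y n); rewrite cmodM.
have : 2 * cmod (w n) <= cmod (x n) * cmod (w n) by nra.
have : cmod (y n) <= cmod (w n) by nra.
lra.
Qed.

(** If all sides have modulus at least [2r] with [r > 1], a new region exceeds the current lower
    bound by a factor [r]; [path_refresh] turns this into growth of both sides. *)
Lemma outward_big n : (n0 <= n)%N -> outward n -> forall K : R,
  exists2 k, (n <= k)%N & outward k /\ K <= cmod (x k) /\ K <= cmod (y k).
Proof.
move=> nn out K.
have out' k : (n <= k)%N -> outward k.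
  by move=> /subnKC <-; elim: (k - n)%N => [|i IH]; rewrite ?addn0 // addnS outwardS //;
    apply: leq_trans nn (leq_addr _ _).
have [g1 g2] := gt2 nn.
pose r := Num.min (cmod (x n)) (cmod (y n)) / 2.
have r1 : 1 < r by rewrite /r ltr_pdivlMr // mul1r lt_min g1 g2.
have [rx ry] : 2 * r <= cmod (x n) /\ 2 * r <= cmod (y n).
  by rewrite /r mulrC divfK // !ge_min !lexx orbT.
have base k : (n <= k)%N -> 2 * r <= cmod (x k) /\ 2 * r <= cmod (y k).
  move=> /subnKC <-; elim: (k - n)%N => [|i [h1 h2]]; rewrite ?addn0 // addnS.
  have ni : (n <= n + i)%N by apply: leq_addr.
  have [p1 p2] := gt2 (leq_trans nn ni).
  have h := outward_w (out' _ ni).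
  have hw : 2 * r <= cmod (w (n + i)%N) by nra.
  by case: (boolP (d (n + i)%N)) => [/turnR[-> -> _]|/turnL[-> -> _]].
have grow j : exists2 m, (n <= m)%N & forall k, (m <= k)%N ->
    2 * r ^+ j.+1 <= cmod (x k) /\ 2 * r ^+ j.+1 <= cmod (y k).
  elim: j => [|j [m nm IH]]; first by exists n.
  have big_w i : (m <= i)%N -> 2 * r ^+ j.+2 <= cmod (w i).
    move=> mi; have [q1 q2] := IH i mi; have ni := leq_trans nm mi.
    have [p1 p2] := base i ni; have := outward_w (out' i ni).
    rewrite exprS; have : 0 < r ^+ j.+1 by rewrite exprn_gt0 //; lra.
    by move: (r ^+ j.+1) q1 q2 => q *; nra.
  have [k mk hk] := @path_refresh (fun c => 2 * r ^+ j.+2 <= cmod c) m big_w.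
  by exists k => //; apply: leq_trans mk.
pose J := Num.bound (`|K| / (r - 1)).
have [m nm hm] := grow J; have [h1 h2] := hm m (leqnn _).
exists m => //; split; first exact: out'.
suff : K <= 2 * r ^+ J.+1 by split; [apply: le_trans h1|apply: le_trans h2].
have KJ : `|K| <= J%:R * (r - 1).
  rewrite -ler_pdivrMr; last by lra.
  by apply/ltW/archi_boundP; rewrite divr_ge0 //; lra.
have := @bernoulli_ineq R (r - 1) J; rewrite addrCA subrr addr0 => B.
have {}B := B _; have r10 : 0 <= r - 1 by lra.
have {B} := B r10; rewrite exprS; have := ler_norm K.
have : 0 < r ^+ J by rewrite exprn_gt0 //; lra.
nra.
Qed.

Hypothesis never_outward : forall n, (n0 <= n)%N -> ~ outward n.

Lemma inward_lt n : (n0 <= n)%N -> cmod (w n) < cmod (z n).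
Proof. by move=> /never_outward/negP; rewrite -ltNge. Qed.

(** Each step replaces [z] by the smaller [w] in the triple, so the sum of the three moduli
    decreases and its decrements tend to 0. *)
Lemma inward_gap (e : R) : 0 < e -> exists2 m, (n0 <= m)%N &
  forall n, (m <= n)%N -> cmod (z n) < cmod (w n) + e.
Proof.
move=> e0; pose S n := - (cmod (x (n0 + n)%N) + cmod (y (n0 + n)%N) + cmod (z (n0 + n)%N)).
have Sstep n : S n.+1 = S n + cmod (z (n0 + n)%N) - cmod (w (n0 + n)%N).
  rewrite /S addnS; case: (boolP (d (n0 + n)%N)) => [/turnR[-> -> ->]|/turnL[-> -> ->]]; ring.
have mono n : S n <= S n.+1.
  by rewrite Sstep; have := inward_lt (leq_addr n n0); lra.
have S0 n : S n <= 0.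
  by rewrite /S oppr_le0 !addr_ge0 ?cmod_ge0.
have [l [ub hl]] := nondecreasing_bounded_lim mono S0.
have [N hN] := hl e e0; exists (n0 + N)%N; first exact: leq_addr.
move=> n nn; have nn0 : (n0 <= n)%N by apply: leq_trans nn; apply: leq_addr.
have := hN (n - n0)%N; rewrite leq_subRL // => /(_ nn).
have := ub (n - n0)%N.+1; rewrite Sstep subnKC //; lra.
Qed.

(* The persisting side [a], with next regions [b] and [c]: here [b] replaces [f]
   and [c] replaces [g]. *)
Lemma persistent_le (a b c f g : R[i]) (e : R) :
  0 <= e -> a * g = f + b -> a * b = g + c ->
  2 < cmod a -> 2 < cmod b -> 2 < cmod g -> cmod f < cmod b + e -> cmod c < cmod g ->
  cmod a ^+ 2 <= 4 + 2 * e.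
Proof.
move=> e0 e1 e2 a2 b2 g2 fb cg.
have h1 : cmod a * cmod g <= 2 * cmod b + e.
  by rewrite -cmodM e1; have := cmodD f b; lra.
have h2 : cmod a * cmod b <= 2 * cmod g.
  by rewrite -cmodM e2; have := cmodD g c; lra.
have h3 : cmod a * (cmod a * cmod b) <= 4 * cmod b + 2 * e by nra.
have b0 : 0 < cmod b by lra.
rewrite -(ler_pM2r b0) expr2 -mulrA; apply: (le_trans h3).
by have : 2 * e <= e * cmod b; nra.
Qed.

Lemma path_turn m : exists2 n, (m <= n)%N & ~~ d n && d n.+1.
Proof.
have [n1 m1 d1] := infL m.
apply: contrapT => no; have allL k : ~~ d (n1 + k)%N.
  elim: k => [|k IH]; rewrite ?addn0 // addnS; apply/negP => dk.
  apply: no; exists (n1 + k)%N; last by rewrite IH.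
  by apply: leq_trans m1 (leq_addr _ _).
have [n2 m2 d2] := infR n1.
by have := allL (n2 - n1)%N; rewrite subnKC // d2.
Qed.

(** At a late turn [a], [b], [c] have moduli close to 2. As [y + c = a b] has modulus at least 4,
    the parallelogram law forces [y] close to [c], and in the same way [f] close to [a]. Hence
    [a b - 2c] and [c b - 2a] nearly vanish, so [b^2] is close to 4, and then so is [mu]. *)
Lemma inward_false : False.
Proof.
pose g := cmod (tau + 2 - 4).
have g0 : 0 < g by rewrite cmod_gt0 subr_eq0 mu_neq4.
(* The estimates end in [g^2 <= 18 (22 e + 22 e) = 792 e], against [900 e <= g^2]. *)
pose e := Num.min 1 ((g / 30) ^+ 2).
have e0 : 0 < e by rewrite lt_min ltr01 exprn_gt0 // divr_gt0.
have [e1 eg] : e <= 1 /\ e <= (g / 30) ^+ 2 by rewrite !ge_min !lexx orbT.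
have [M nM gap] := inward_gap e0.
have [n Mn /andP[dn dn1]] := path_turn M.
have n0n := leq_trans nM Mn.
have [xE yE zE] := turnL dn; have [xE' yE' zE'] := turnR dn1.
set a := x n in xE; set b := w n in yE.
have w1E : w n.+1 = a * b - y n by rewrite /w xE yE zE.
set c := w n.+1 in xE' w1E.
have w2E : w n.+2 = c * b - a by rewrite /w xE' yE' zE' yE xE.
set f := w n.+2 in w2E.
have [a2 y2] := gt2 n0n; rewrite -/a in a2.
have b2 := path_gt2_w n0n; rewrite -/b in b2.
have c2 := path_gt2_w (leqW n0n); rewrite -/c in c2.
have f2 := path_gt2_w (leqW (leqW n0n)); rewrite -/f in f2.
have i0 := inward_lt n0n; rewrite -/b in i0.
have g0' := gap n Mn; rewrite -/b in g0'.
have i1 := inward_lt (leqW n0n); rewrite zE -/c in i1.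
have g1 := gap n.+1 (leqW Mn); rewrite zE -/c in g1.
have i2 := inward_lt (leqW (leqW n0n)); rewrite zE' xE -/f in i2.
have bE : a * y n = z n + b by rewrite /b /w /a; ring.
have aa : cmod a ^+ 2 <= 4 + 2 * e.
  apply: (@persistent_le a b c (z n) (y n)) => //; first exact: ltW.
  by rewrite w1E; ring.
have bb : cmod b ^+ 2 <= 4 + 2 * e.
  apply: (@persistent_le b c f (y n) a) => //; first exact: ltW.
    by rewrite w1E; ring.
  by rewrite w2E; ring.
have ca : cmod c <= cmod a.
  have : cmod c * cmod b <= 2 * cmod a.
    have e3 : f + a = c * b by rewrite w2E subrK.
    by have := cmodD f a; rewrite e3 cmodM; lra.
  nra.
have cc : cmod c ^+ 2 <= 4 + 2 * e.
  by apply: le_trans aa; rewrite ler_pXn2r ?nnegrE ?cmod_ge0.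
have sq4 (u v : R[i]) : 2 < cmod u -> 2 < cmod v -> 16 <= cmod (u * v) ^+ 2.
  move=> hu hv; rewrite cmodM; have h : 4 <= cmod u * cmod v by nra.
  by rewrite expr2; nra.
pose u1 := a * b - 2 * c; pose u2 := c * b - 2 * a.
have n1 : cmod u1 ^+ 2 <= 22 * e.
  have -> : u1 = y n - c by rewrite /u1 w1E; ring.
  have := parallelogram (y n) c.
  have -> : y n + c = a * b by rewrite w1E; ring.
  have := sq4 a b a2 b2; have c3 : cmod c <= 3 by nra.
  have yy : cmod (y n) ^+ 2 <= cmod c ^+ 2 + 7 * e by nra.
  lra.
have n2 : cmod u2 ^+ 2 <= 22 * e.
  have -> : u2 = f - a by rewrite /u2 w2E; ring.
  have := parallelogram f a.
  have -> : f + a = c * b by rewrite w2E; ring.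
  have := sq4 c b c2 b2.
  have ff : cmod f ^+ 2 <= cmod a ^+ 2 by nra.
  lra.
have m := markoff_path n.+2; rewrite xE' yE' zE' yE xE -/c /markoff in m.
have x0 : a != 0 by rewrite -cmod_gt0; lra.
have b4 : a * (b ^+ 2 - 4) = 2 * u2 + b * u1 by rewrite /u1 /u2; ring.
have b4n : 2 * cmod (b ^+ 2 - 4) <= 2 * cmod u2 + cmod b * cmod u1.
  have : cmod a * cmod (b ^+ 2 - 4) <= 2 * cmod u2 + cmod b * cmod u1.
    rewrite -cmodM b4; apply: (le_trans (cmodD _ _)).
    by rewrite (cmodM 2) (cmodM b) cmod_nat.
  by have := cmod_ge0 (b ^+ 2 - 4); nra.
have gE : 2 * (tau + 2 - 4) = 2 * (b ^+ 2 - 4) - (a * u2 + c * u1).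
  by rewrite -m /u1 /u2; ring.
have a3 : cmod a <= 3 by nra.
have b3 : cmod b <= 3 by nra.
have c3 : cmod c <= 3 by nra.
have gle : g <= 3 * cmod u1 + 3 * cmod u2.
  have := congr1 (@cmod R) gE; rewrite (cmodM 2) cmod_nat -/g => g2.
  have := cmodB (2 * (b ^+ 2 - 4)) (a * u2 + c * u1); rewrite -g2 (cmodM 2) cmod_nat.
  have := cmodD (a * u2) (c * u1); rewrite (cmodM a) (cmodM c).
  have := cmod_ge0 u1; have := cmod_ge0 u2 => p2 p1.
  have : cmod a * cmod u2 <= 3 * cmod u2 by rewrite ler_wpM2r.
  have : cmod c * cmod u1 <= 3 * cmod u1 by rewrite ler_wpM2r.
  have : cmod b * cmod u1 <= 3 * cmod u1 by rewrite ler_wpM2r.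
  lra.
have := cmod_ge0 u1; have := cmod_ge0 u2.
have gg : 900 * e <= g ^+ 2 by move: eg; rewrite !expr2; lra.
move: (cmod u1) (cmod u2) n1 n2 gle => p q *.
have : g ^+ 2 <= (3 * p + 3 * q) ^+ 2 by rewrite ler_pXn2r ?nnegrE //; lra.
have -> : (3 * p + 3 * q) ^+ 2 = 18 * p ^+ 2 + 18 * q ^+ 2 - 9 * (p - q) ^+ 2 by ring.
by have := sqr_ge0 (p - q); lra.
Qed.

End Eventually.
End Path.

Section AllGood.
Variables (R : realType) (tau : R[i]).
Hypothesis tau2 : tau <> 2.
Implicit Types x y z : R[i].

Lemma tree_norm_swap n x y z : tree_norm tau n y x z = tree_norm tau n x y z.
Proof.
elim: n x y z => // n IH x y z; rewrite !tree_normS (mulrC y x).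
by rewrite (IH (x * y - z) y x) (IH x (x * y - z) y); congr (_ + _); rewrite addrC.
Qed.

Lemma tree_sum_swap n x y z : tree_sum tau n y x z = tree_sum tau n x y z.
Proof.
elim: n x y z => // n IH x y z; rewrite !tree_sumS (mulrC y x).
by rewrite (IH (x * y - z) y x) (IH x (x * y - z) y); congr (_ + _); rewrite addrC.
Qed.

Lemma gapG_swap x y z : gapG tau y x z = gapG tau x y z.
Proof. by rewrite /gapG (mulrC y x) (mulrC (gapP tau y)). Qed.

Lemma tree_good_swap x y z : tree_good tau y x z -> tree_good tau x y z.
Proof.
move=> [[C hC] g]; split; first by exists C => n; rewrite -tree_norm_swap.
rewrite -gapG_swap; apply: (ctends_ext (N := 0)) g => n _.
by rewrite tree_sum_swap.
Qed.

Lemma admissible_swap x y z : admissible tau x y z -> admissible tau y x z.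
Proof.
have reg_swap l : forall x y z, region y x z l = region x y z (map negb l).
  elim: l => [|[] l IH] {}x {}y {}z /=; rewrite (mulrC y) //; exact: IH.
move=> [m rx ry rl]; split=> //; first exact: markoff_swap.
by move=> l; rewrite reg_swap.
Qed.

Definition turn (dir : bool) (p : R[i] * R[i] * R[i]) :=
  let w := p.1.1 * p.1.2 - p.2 in
  if dir then (w, p.1.2, p.1.1) else (p.1.1, w, p.1.2).

Lemma tree_good_all x y z (N : nat) : admissible tau x y z ->
  ~ (- 2 < x < 2) -> ~ (- 2 < y < 2) ->
  (forall l, ~ (- 2 < region x y z l < 2)) ->
  (forall l, (N <= size l)%N -> 2 < cmod (region x y z l)) ->
  tree_good tau x y z.
Proof.
move=> adm xI yI lI lN; apply: contrapT => bad.
pose good p := tree_good tau p.1.1 p.1.2 p.2.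
(* Move to the right child if it is bad; if it is good, the left child must be bad, since goodness
   of both would pass to the parent. *)
pose dir p := `[< ~ good (turn true p) >].
pose st n := iter n (fun p => turn (dir p) p) (x, y, z).
pose d n := dir (st n).
pose X n := (st n).1.1; pose Y n := (st n).1.2; pose Z n := (st n).2.
have admn n : admissible tau (X n) (Y n) (Z n).
  elim: n => // n IH; rewrite /X /Y /Z /st /= -/(st n) /turn.
  by case: (dir _); [apply: admissibleR|apply: admissibleL].
have badn n : ~ tree_good tau (X n) (Y n) (Z n).
  elim: n => // n IH; rewrite /X /Y /Z /st /= -/(st n).
  rewrite -[tree_good _ _ _ _]/(good (turn (dir (st n)) (st n))).
  rewrite {1}/dir; case: asboolP => // /contrapT gR gL; apply: IH.
  exact: tree_good_split (admn n) gL gR.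
have stL n : ~~ d n -> [/\ X n.+1 = X n, Y n.+1 = X n * Y n - Z n & Z n.+1 = Y n].
  by rewrite /X /Y /Z /st /= -/(st n) -/(d n) /turn => /negPf ->.
have stR n : d n -> [/\ X n.+1 = X n * Y n - Z n, Y n.+1 = Y n & Z n.+1 = X n].
  by rewrite /X /Y /Z /st /= -/(st n) -/(d n) /turn => ->.
have regn n l : region x y z (mkseq d n ++ l) = region (X n) (Y n) (Z n) l.
  elim: n l => // n IH l; rewrite mkseqS cat_rcons IH.
  by case: (boolP (d n)) => [/stR[-> -> ->]|/stL[-> -> ->]].
have wn n : X n * Y n - Z n = region x y z (mkseq d n) by rewrite -[mkseq d n]cats0 regn.
have notI n : ~ (- 2 < X n < 2) /\ ~ (- 2 < Y n < 2).
  elim: n => // n [IHx IHy].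
  by case: (boolP (d n)) => [/stR[-> -> _]|/stL[-> -> _]]; rewrite wn; split.
case: (pselect (exists m, forall n, (m <= n)%N -> ~~ d n)) => [[m allL]|noL].
  (* From [m] on the path follows the fan around the constant side [X m], where [fan_good] provides
     a good edge. *)
  have [k gk] := fan_good (admn m) (proj1 (notI m)).
  suff [e1 e2 e3] : [/\ X (m + k)%N = X m, Y (m + k)%N = fan (X m) (Z m) (Y m) k.+1 &
      Z (m + k)%N = fan (X m) (Z m) (Y m) k].
    by apply: (badn (m + k)%N); rewrite e1 e2 e3.
  elim: {gk} k => [|k [e1 e2 e3]]; first by rewrite addn0.
  rewrite addnS; have [-> -> ->] := stL _ (allL _ (leq_addr k m)).
  by rewrite e1 e2 e3.
case: (pselect (exists m, forall n, (m <= n)%N -> d n)) => [[m allR]|noR].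
  have [k /tree_good_swap gk] := fan_good (admissible_swap (admn m)) (proj2 (notI m)).
  suff [e1 e2 e3] : [/\ Y (m + k)%N = Y m, X (m + k)%N = fan (Y m) (Z m) (X m) k.+1 &
      Z (m + k)%N = fan (Y m) (Z m) (X m) k].
    by apply: (badn (m + k)%N); rewrite e1 e2 e3.
  elim: {gk} k => [|k [e1 e2 e3]]; first by rewrite addn0.
  rewrite addnS; have [-> -> ->] := stR _ (allR _ (leq_addr k m)).
  by rewrite e1 e2 e3 mulrC.
have infL m : exists2 n, (m <= n)%N & ~~ d n.
  by apply: contrapT => no; apply: noR; exists m => n mn; apply: contrapT => /negP dn;
    apply: no; exists n.
have infR m : exists2 n, (m <= n)%N & d n.
  by apply: contrapT => no; apply: noL; exists m => n mn; apply/negP => dn;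
    apply: no; exists n.
have w2 n : (N <= n)%N -> 2 < cmod (X n * Y n - Z n).
  by move=> Nn; rewrite wn; apply: lN; rewrite size_mkseq.
have [n0 _ gt2] := @path_refresh _ d X Y Z stL stR infL infR (fun c => 2 < cmod c) N w2.
have mn n : markoff tau (X n) (Y n) (Z n) by case: (admn n).
case: (pselect (exists2 n, (n0 <= n)%N & outward X Y Z n)) => [[n nn out]|no].
  have [k _ [ok [xk yk]]] :=
    outward_big stL stR infL infR gt2 nn out (large_bound tau).
  by apply: (badn k); apply: deep_good; split.
apply: (inward_false tau2 stL stR infL infR mn gt2) => n nn out.
by apply: no; exists n.
Qed.

End AllGood.

(** * The sum over simple curves *)

Section AbsSum.
Variables (R : realType) (I : choiceType).
Implicit Types (f : I -> R[i]) (s : seq I).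

Lemma sum_subseq (V : zmodType) (g : I -> V) s1 s2 :
  uniq s1 -> uniq s2 -> {subset s1 <= s2} ->
  \sum_(i <- s2) g i = \sum_(i <- s1) g i + \sum_(i <- s2 | i \notin s1) g i.
Proof.
move=> u1 u2 s12; rewrite (bigID (mem s1)) /=; congr (_ + _).
rewrite -big_filter; apply: perm_big; apply: uniq_perm => //.
  exact: filter_uniq.
move=> i; rewrite mem_filter; apply/andP/idP => [[]//|i1]; split=> //.
exact: s12.
Qed.

Lemma cmod_sum (P : pred I) f s :
  cmod (\sum_(i <- s | P i) f i) <= \sum_(i <- s | P i) cmod (f i).
Proof.
elim/big_ind2: _ => [|a b c d h1 h2|//]; first by rewrite cmod0.
by apply: (le_trans (cmodD _ _)); rewrite lerD.
Qed.

Variables (D : set I) (f : I -> R[i]) (E : nat -> seq I).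
Hypothesis E_uniq : forall n, uniq (E n).
Hypothesis E_mono : forall n, {subset E n <= E n.+1}.
Hypothesis E_exhaust : forall i, D i <-> exists n, i \in E n.

Lemma exhaust_homo n m : (n <= m)%N -> {subset E n <= E m}.
Proof.
by move=> /subnK <-; elim: (m - n)%N => //= k IH i /IH; rewrite addSn; apply: E_mono.
Qed.

Lemma exhaust_seq s : (forall i, i \in s -> D i) -> exists n, {subset s <= E n}.
Proof.
elim: s => [|i s IH] h; first by exists 0%N.
have [n hn] : exists n, {subset s <= E n}.
  by apply: IH => j js; apply: h; rewrite inE js orbT.
have [m hm] := (E_exhaust i).1 (h i (mem_head _ _)).
exists (maxn n m) => j; rewrite inE => /predU1P[->|/hn jn].
  exact: exhaust_homo (leq_maxr _ _) _ hm.
exact: exhaust_homo (leq_maxl _ _) _ jn.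
Qed.

Let T n := \sum_(i <- E n) cmod (f i).

Lemma exhaust_norm_le s n m : uniq s -> (forall i, i \in s -> i \in E m) ->
  (n <= m)%N -> \sum_(i <- s | i \notin E n) cmod (f i) <= T m - T n.
Proof.
move=> us sm nm; rewrite /T (sum_subseq _ (E_uniq n) (E_uniq m) (exhaust_homo nm)).
rewrite addrC addKr -big_filter -[X in _ <= X]big_filter.
set s1 := [seq i <- s | _]; set s2 := [seq i <- E m | _].
have s12 : {subset s1 <= s2}.
  by move=> i; rewrite !mem_filter => /andP[-> /sm].
rewrite (sum_subseq _ (filter_uniq _ us) (filter_uniq _ (E_uniq m)) s12) lerDl.
by rewrite sumr_ge0 // => i _; apply: cmod_ge0.
Qed.

(** A finite set containing [E N] adds only terms of [D], which all lie in some later [E m], so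
    their moduli sum to at most the tail of [T]; indices outside [D] contribute 0. *)
Lemma abs_sum_exhaust (C : R) (l : R[i]) : (forall n, T n <= C) ->
  ctends (fun n => \sum_(i <- E n) f i) l -> abs_sum_to D f l.
Proof.
move=> TC Sl; split.
  apply: (@le_lt_trans _ _ C%:E); last by rewrite ltry.
  apply: ge_ereal_sup => _ [F [Ffin FD] <-].
  rewrite fsbig_finite //=.
  have sD i : i \in (fset_set F : seq I) -> D i.
    by rewrite in_fset_set // inE; apply: FD.
  have [n sn] := exhaust_seq sD.
  have -> : (\sum_(i <- fset_set F) `|(Re `|f i|)%:E|)%E =
      (\sum_(i <- fset_set F) cmod (f i))%:E.
    rewrite -sumEFin; apply: eq_bigr => i _.
    by rewrite -[LHS]/((`|cmod (f i)|)%:E) ger0_norm ?cmod_ge0.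
  rewrite lee_fin; apply: le_trans (TC n).
  rewrite /T (sum_subseq _ (fset_uniq _) (E_uniq n) sn) lerDl.
  by rewrite sumr_ge0 // => i _; apply: cmod_ge0.
have Tmono n : T n <= T n.+1.
  rewrite /T (sum_subseq _ (E_uniq n) (E_uniq n.+1) (@E_mono n)) lerDl.
  by rewrite sumr_ge0 // => i _; apply: cmod_ge0.
have [t [tub tl]] := nondecreasing_bounded_lim Tmono TC.
have totF := @summability.totally_filter I.
apply/cvgrPdist_lt => e e0.
have eE : e = (Re e)%:C.
  by move: e0; case: e => u v; rewrite ltcE /= => /andP[/eqP-> _].
have r0 : 0 < Re e by move: e0; rewrite eE ltcR.
have r2 : 0 < Re e / 2 by rewrite divr_gt0.
have [N1 h1] := tl _ r2; have [N2 h2] := Sl _ r2; pose N := maxn N1 N2.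
exists [fset i in E N]%fset => //= B EB.
rewrite /summability.partial_sum.
rewrite -(big_seq_fsetE _ B xpredT (fun i => if i \in D then f i else 0)) /=.
set g := fun i => if i \in D then f i else 0.
have gE n i : i \in E n -> g i = f i.
  by move=> iE; rewrite /g mem_set //; apply/E_exhaust; exists n.
have NB : {subset E N <= (B : seq I)}.
  by move=> i iE; apply: (fsubsetP EB); rewrite inE.
rewrite (sum_subseq _ (E_uniq N) (fset_uniq B) NB).
have -> : \sum_(i <- E N) g i = \sum_(i <- E N) f i.
  by rewrite big_seq [RHS]big_seq; apply: eq_bigr => i; apply: gE.
set rest := \sum_(i <- B | _) g i.
have restle : cmod rest <= t - T N.
  pose s := [seq i <- B | i \in D].
  have sD i : i \in s -> D i by rewrite mem_filter => /andP[/set_mem].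
  have [m sm] := exhaust_seq sD.
  have -> : rest = \sum_(i <- s | i \notin E N) f i.
    rewrite /s big_filter_cond /rest [LHS](bigID (fun i => i \in D)) /= addrC big1 ?add0r.
      rewrite [LHS](eq_bigl (fun i => (i \in D) && (i \notin E N))); last first.
        by move=> i; rewrite andbC.
      by apply: eq_bigr => i /andP[iD _]; rewrite /g iD.
    by move=> i /andP[_ /negPf iD]; rewrite /g iD.
  apply: (le_trans (cmod_sum _ _ _)).
  have := @exhaust_norm_le s N (maxn N m) (filter_uniq _ (fset_uniq B)).
  move=> /(_ _ (leq_maxl _ _)) h; apply: (le_trans (h _)).
    by move=> i /sm; apply: exhaust_homo; apply: leq_maxr.
  by have := tub (maxn N m); lra.
have tN := h1 N (leq_maxl _ _); have lN := h2 N (leq_maxr _ _).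
rewrite eE cmodE ltcR opprD addrA.
apply: (le_lt_trans (cmodB _ _)); rewrite cmodBC; lra.
Qed.

End AbsSum.

Section Summable.
Variables (R : realType) (I : choiceType) (D : set I) (f : I -> R[i]).

Lemma summable_finite (e : R) : 0 < e -> summable D (fun i => (Re `|f i|)%:E) ->
  finite_set [set i | D i /\ e <= cmod (f i)].
Proof.
move=> e0; rewrite /summable; set S := \esum_(_ in _) _ => Sfin.
apply: contrapT => inf.
have S0 : (0 <= S)%E by apply: esum_ge0.
have Sr : S = (fine S)%:E by rewrite fineK // ge0_fin_numE.
pose n := Num.bound (fine S / e).
have [F Fsub Fn] := infinite_set_fset n.+1 inf.
have : (\sum_(i \in [set` F]) `|(Re `|f i|)%:E| <= S)%E.
  apply: ereal_sup_ubound; exists [set` F] => //; split; first exact: finite_fset.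
  by move=> i /Fsub [].
rewrite Sr fsbig_finite /=; last exact: finite_fset.
rewrite set_fsetK.
have -> : (\sum_(i <- F) `|(Re `|f i|)%:E|)%E = (\sum_(i <- F) cmod (f i))%:E.
  rewrite -sumEFin; apply: eq_bigr => i _.
  by rewrite -[LHS]/((`|cmod (f i)|)%:E) ger0_norm ?cmod_ge0.
rewrite lee_fin; apply/negP; rewrite -ltNge.
have le : (n.+1)%:R * e <= \sum_(i <- F) cmod (f i).
  apply: (@le_trans _ _ (\sum_(i <- F) e)).
    rewrite big_const_seq count_predT iter_addr_0 -[e *+ _]mulr_natl.
    by apply: ler_wpM2r; [exact: ltW|rewrite ler_nat].
  rewrite big_seq [X in _ <= X]big_seq; apply: ler_sum => i iF.
  by have [] := Fsub i iF.
apply: lt_le_trans le; rewrite -ltr_pdivrMr //.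
apply: (lt_le_trans (archi_boundP _)); last by rewrite ler_nat.
by apply: divr_ge0; [exact: fine_ge0|exact: ltW].
Qed.

End Summable.

(** * Trace identities *)

Section Traces.
Variables (R : realType) (Gamma : groupType) (rho : Gamma -> 'M[R[i]]_2).
Hypothesis rhoP : SL2_rep rho.
Implicit Types (g h u v : Gamma) (l : seq bool).

Let t g : R[i] := \tr (rho g).

Lemma trE g : tr_curve rho (curve_of g) = t g.
Proof. exact: tr_curve_of. Qed.

Lemma trV g : t (g^-1)%g = t g.
Proof. by rewrite -!trE curve_of_inv. Qed.

Lemma trJ g k : t (g ^ k)%g = t g.
Proof. by rewrite -!trE curve_of_conj. Qed.

Lemma trC g h : t (g * h)%g = t (h * g)%g.
Proof. by rewrite /t !rhoP.2 mxtrace_mulC. Qed.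

Lemma rho1 : rho 1%g = 1%:M.
Proof.
have [det1 rhoM] := rhoP.
have u : rho 1%g \in unitmx by rewrite unitmxE det1 unitr1.
have e : rho 1%g *m rho 1%g = rho 1%g by rewrite -rhoM mulg1.
by rewrite -[LHS]mul1mx -{1}(mulVmx u) -mulmxA e mulVmx.
Qed.

Lemma tr1 : t 1%g = 2.
Proof. by rewrite /t rho1 mxtrace1. Qed.

Lemma rhoV g : rho (g^-1)%g = \adj (rho g).
Proof.
rewrite -[RHS]mul1mx -rho1 -(mulVg g) rhoP.2 -mulmxA mul_mx_adj rhoP.1.
by rewrite mulmx1.
Qed.

(** Cayley-Hamilton for 2 by 2 matrices; by [rhoV] the adjugate is the image of the inverse. *)
Lemma adjD (A : 'M[R[i]]_2) : A + \adj A = (\tr A)%:M.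
Proof.
apply/matrixP => i j; rewrite /mxtrace !big_ord_recl !big_ord0 !mxE /cofactor.
rewrite det_mx11 !mxE /=.
have k01 (k : 'I_2) : k = 0 \/ k = 1.
  by case: k => [[|[|//]] hk]; [left|right]; apply: val_inj.
have l0 : lift 0 0 = 1 :> 'I_2 by apply: val_inj.
have l1 : lift 1 0 = 0 :> 'I_2 by apply: val_inj.
have o0 : ord0 = 0 :> 'I_2 by [].
by case: (k01 i) (k01 j) => -> [] ->; rewrite ?o0 ?l0 ?l1 /= ?expr0 ?addr0 ?mul1r
  ?mulr1n ?mulr0n ?expr1 ?mulN1r ?subrr // ?expr2 ?mulN1r ?opprK ?mul1r // addrC.
Qed.

Lemma trM g h : t g * t h = t (g * h)%g + t (g^-1 * h)%g.
Proof.
rewrite /t !rhoP.2 rhoV -mxtraceD -mulmxDl adjD mul_scalar_mx.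
by rewrite mxtraceZ.
Qed.

Lemma trS g h : t (g * h)%g = t g * t h - t (g^-1 * h)%g.
Proof. by rewrite trM addrK. Qed.

(** Fricke's identity. It is written with [g^-1 * h] instead of [g * h], because this is the region
    to which an edge of the tree points. *)
Lemma tr_commutator g h : t (g * h * g^-1 * h^-1)%g =
  t g ^+ 2 + t h ^+ 2 + t (g^-1 * h)%g ^+ 2 - t g * t h * t (g^-1 * h)%g - 2.
Proof.
have e1 := trM g (h * g^-1 * h^-1)%g.
have e2 := trM (g^-1 * h)%g (g^-1 * h^-1)%g.
have e3 := trM h^-1%g h^-1%g.
have c1 : t (h * g^-1 * h^-1)%g = t g.
  by rewrite -[RHS]trV -[RHS](trJ _ h^-1%g) conjgE invgK mulgA.
have c2 : t (g^-1 * h^-1)%g = t g * t h - t (g^-1 * h)%g.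
  by rewrite -trV invgM !invgK trC trS.
rewrite invgM invgK !mulgA mulgK in e2.
rewrite mulVg tr1 !trV in e3; rewrite c1 !mulgA in e1; rewrite c2 in e2.
have -> : t (g * h * g^-1 * h^-1)%g = t g * t g - t (g^-1 * h * g^-1 * h^-1)%g.
  by rewrite e1 addrK.
have -> : t (g^-1 * h * g^-1 * h^-1)%g =
    t (g^-1 * h)%g * (t g * t h - t (g^-1 * h)%g) - t (h^-1 * h^-1)%g.
  by rewrite e2 addrK.
have -> : t (h^-1 * h^-1)%g = t h * t h - 2 by rewrite e3 addrK.
by ring.
Qed.

Lemma tr_node u v l : t (node (u, v) l) = region (t u) (t v) (t (u^-1 * v)%g) l.
Proof.
elim: l u v => [|[] l IH] u v /=; first by rewrite /node /= trS.
  rewrite /node /= -/(node (_, _) l) IH -trS invgM.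
  by congr region; rewrite -mulgA trC -mulgA mulgV mulg1 trV.
by rewrite /node /= -/(node (_, _) l) IH -trS mulKg.
Qed.

Lemma tr_fan u v n : t (u ^+ n * v)%g = fan (t u) (t v) (t (u * v)%g) n.
Proof.
suff [] : t (u ^+ n * v)%g = fan (t u) (t v) (t (u * v)%g) n /\
  t (u ^+ n.+1 * v)%g = fan (t u) (t v) (t (u * v)%g) n.+1 by [].
elim: n => [|n [IH1 IH2]]; first by rewrite expg0 mul1g expg1.
split=> //; rewrite fanSS -IH1 -IH2 expgS -mulgA trS; congr (_ - t _).
by rewrite expgS -mulgA mulKg.
Qed.

Section Markoff.
Variables (tau : R[i]) (a b : Gamma).
Hypothesis bas : free_basis a b.
Hypothesis tau_ab : t (a * b * a^-1 * b^-1)%g = tau.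

(** The Markoff equation survives every Nielsen move, so the single basis supplied by [tau_rep]
    settles all others. *)
Lemma markoff_basis u v : free_basis u v -> markoff tau (t u) (t v) (t (u^-1 * v)%g).
Proof.
move=> /(nielsen_free_basis bas); elim=> [|{}u {}v _|{}u {}v _|{}u {}v _|k {}u {}v _].
- by rewrite /markoff -tau_ab tr_commutator subrK.
- move=> /markoff_swap; congr markoff.
  by rewrite -trV invgM invgK.
- rewrite trV invgK => /markoff_opp; by rewrite -trS.
- by rewrite mulKg trS => /markoffL.
- by rewrite -conjVg -conjMg !trJ.
Qed.

End Markoff.
End Traces.

(** * Enumeration of the simple curves *)

Section FanCurves.
Variable G : groupType.
Implicit Types u v : G.

Lemma free_basis_fan u v n : free_basis u v -> free_basis u (u ^+ n * v)%g.
Proof.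
move=> bas; elim: n => [|n IH]; first by rewrite expg0 mul1g.
by rewrite expgS -mulgA; apply: free_basis_mul.
Qed.

Lemma simple_fan u v n : free_basis u v -> simple_curves (curve_of (u ^+ n * v)%g).
Proof.
move=> /(free_basis_fan n)/free_basis_swap bas.
by exists (u ^+ n * v)%g, u.
Qed.

(** The homology classes [(n, 1)] are pairwise distinct even up to sign. *)
Lemma fan_curve_inj u v : free_basis u v ->
  injective (fun n => curve_of (u ^+ n * v)%g).
Proof.
move=> bas; have [f [fM [fu fv]]] := homology_exists bas.
have fn n : (f (u ^+ n * v)%g : int * int) = (n%:Z, 1).
  elim: n => [|n IH]; first by rewrite expg0 mul1g fv.
  rewrite expgS -mulgA fM fu -[LHS]/((1, 0) + (f (u ^+ n * v)%g : int * int)).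
  by rewrite IH; congr (_, _); rewrite /= ?intS.
move=> m n /(curve_homology fM); rewrite !fn => -[] []; lia.
Qed.

(** The exponents have equal signs in one tree and opposite signs in the other, so no unoriented
    curve lies in both. *)
Lemma homology_fan_node (f : G -> zpair) a b l : {morph f : x y / (x * y)%g} ->
  f a = (1, 0) -> f b = (0, 1) ->
  (f (node (a, b) l) : int * int) = ((coef l).1%:Z, (coef l).2%:Z) /\
  (f (node (a^-1, b)%g l) : int * int) = (- (coef l).1%:Z, (coef l).2%:Z).
Proof.
move=> fM fa fb; have pairMn (p q : int) n : (p, q) *+ n = (p *+ n, q *+ n).
  by elim: n => [|n IH]; rewrite ?mulr0n // !mulrS IH.
have faV : (f (a^-1)%g : int * int) = (-1, 0).
  by rewrite (morph_inv fM) fa -[LHS]/(- ((1, 0) : int * int)).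
split; rewrite homology_node // ?faV ?fa fb !pairMn !mul0rn ?mulNrn !natz;
  by congr (_, _); rewrite /= ?addr0 ?add0r.
Qed.

(** Words shorter than [n], in the order in which [tree_sum n] visits the regions. *)
Fixpoint words (n : nat) : seq (seq bool) :=
  if n is m.+1 then
    [::] :: [seq false :: l | l <- words m] ++ [seq true :: l | l <- words m]
  else [::].

Lemma mem_words n l : (l \in words n) = (size l < n)%N.
Proof.
elim: n l => [|n IH] [|d l] //; rewrite inE mem_cat /= ltnS -IH.
have inj (c : bool) : injective (cons c) by move=> ? ? [].
have no (c e : bool) : c != e -> (c :: l \in [seq e :: l | l <- words n]) = false.
  by move=> ce; apply/negP => /mapP[m _ [ce' _]]; rewrite ce' eqxx in ce.
by case: d; rewrite ?(mem_map (inj _)) ?no // orbF.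
Qed.

Lemma words_uniq n : uniq (words n).
Proof.
have inj (c : bool) : injective (cons c) by move=> ? ? [].
elim: n => // n IH; rewrite [words _]/= cons_uniq mem_cat negb_or cat_uniq.
rewrite !(map_inj_uniq (inj _)) IH andbT; apply/andP; split.
  by apply/andP; split; apply/negP => /mapP[].
by rewrite andTb; apply/hasPn => _ /mapP[l _ ->]; apply/negP => /mapP[].
Qed.

Lemma node_curve_inj (a b : G) : free_basis a b ->
  injective (fun l => curve_of (node (a, b) l)).
Proof.
move=> bas; have [f [fM [fa fb]]] := homology_exists bas.
move=> l m /(curve_homology fM); have hf l' := (homology_fan_node l' fM fa fb).1.
rewrite !hf => h; apply: coef_inj; have := coef_gt0 l; have := coef_gt0 m.
case: (coef l) (coef m) h => [p q] [r s] /= [] []; last by lia.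
by move=> ? ? _ _; congr pair; lia.
Qed.

Definition curves_upto a b n : seq (curve G) :=
  [:: curve_of a; curve_of b] ++ [seq curve_of (node (a, b) l) | l <- words n] ++
  [seq curve_of (node (a^-1, b)%g l) | l <- words n].

Lemma curves_upto_uniq a b n : free_basis a b -> uniq (curves_upto a b n).
Proof.
move=> bas; have [f [fM [fa fb]]] := homology_exists bas.
have hf l := homology_fan_node l fM fa fb.
have inj1 := node_curve_inj bas; have inj2 := node_curve_inj (free_basis_inv bas).
rewrite /curves_upto /= cat_uniq !map_inj_uniq ?words_uniq // andbT /=.
rewrite inE !mem_cat negb_or !negb_or -!andbA.
have out (g : G) (u : G) (n1 : int * int) : (f g : int * int) = n1 ->
    (forall l, n1 <> (f (node (u, b) l) : int * int) /\
       n1 <> - (f (node (u, b) l) : int * int)) ->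
    curve_of g \notin [seq curve_of (node (u, b) l) | l <- words n].
  move=> fg no; apply/negP => /mapP[l _ /(curve_homology fM)].
  by rewrite fg; have [h1 h2] := no l; case.
apply/andP; split; [|apply/and5P; split].
- apply/eqP => /(curve_homology fM); rewrite fa fb; by case=> -[].
- apply: out fa _ => l; rewrite (hf l).1; have := coef_gt0 l.
  by case: (coef l) => [p q] /= ?; split=> -[]; lia.
- apply: out fa _ => l; rewrite (hf l).2; have := coef_gt0 l.
  by case: (coef l) => [p q] /= ?; split=> -[]; lia.
- apply: out fb _ => l; rewrite (hf l).1; have := coef_gt0 l.
  by case: (coef l) => [p q] /= ?; split=> -[]; lia.
- apply: out fb _ => l; rewrite (hf l).2; have := coef_gt0 l.
  by case: (coef l) => [p q] /= ?; split=> -[]; lia.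
- apply/hasPn => _ /mapP[l _ ->]; apply/negP => /mapP[m _ /(curve_homology fM)].
  rewrite (hf _).1 (hf _).2; have := coef_gt0 l; have := coef_gt0 m.
  by case: (coef l) (coef m) => [p q] [r s] /= ? ? [] []; lia.
Qed.

Lemma curves_upto_mono a b n : {subset curves_upto a b n <= curves_upto a b n.+1}.
Proof.
have sub : {subset words n <= words n.+1}.
  by move=> l; rewrite !mem_words => /ltnW; rewrite -ltnS.
move=> c; rewrite !mem_cat => /orP[->//|/orP[] /mapP[l /sub lw ->]].
  by rewrite (map_f (fun l => curve_of (node (a, b) l)) lw) orbT.
by rewrite (map_f (fun l => curve_of (node (a^-1, b)%g l)) lw) !orbT.
Qed.

Lemma curves_upto_exhaust a b c : free_basis a b ->
  simple_curves c <-> exists n, c \in curves_upto a b n.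
Proof.
move=> bas; rewrite (simple_tree_curve _ bas); split.
  case=> [->|->|[l ->]|[l ->]].
  - by exists 0%N; rewrite inE eqxx.
  - by exists 0%N; rewrite !inE eqxx orbT.
  - have lw : l \in words (size l).+1 by rewrite mem_words.
    exists (size l).+1; rewrite !mem_cat.
    by rewrite (map_f (fun l => curve_of (node (a, b) l)) lw) orbT.
  - have lw : l \in words (size l).+1 by rewrite mem_words.
    exists (size l).+1; rewrite !mem_cat.
    by rewrite (map_f (fun l => curve_of (node (a^-1, b)%g l)) lw) !orbT.
move=> [n]; rewrite !mem_cat !inE => /orP[/orP[]/eqP->|/orP[] /mapP[l _ ->]].
- exact: Or41.
- exact: Or42.
- by apply: Or43; exists l.
- by apply: Or44; exists l.
Qed.

(** [sz] is left arbitrary so that the lemma serves for positions in a fan and for words in a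
    tree. *)
Lemma finite_escape (T : choiceType) (g : T -> curve G) (sz : T -> nat)
    (B : set (curve G)) : finite_set B -> injective g ->
  exists N, forall i, (N <= sz i)%N -> ~ B (g i).
Proof.
move=> Bfin ginj.
have Fin : finite_set (g @^-1` B).
  by apply: finite_preimage => // i j _ _; apply: ginj.
exists (\max_(i <- fset_set (g @^-1` B)) sz i).+1 => i Ni Bi.
suff : (sz i <= \max_(i <- fset_set (g @^-1` B)) sz i)%N by rewrite leqNgt Ni.
by apply: leq_bigmax_seq => //; rewrite in_fset_set // inE.
Qed.

End FanCurves.

Section WordSums.
Variables (R : realType) (tau : R[i]).

Lemma sum_words (V : nmodType) (F : seq bool -> V) n :
  \sum_(l <- words n.+1) F l =
  F [::] + (\sum_(l <- words n) F (false :: l) + \sum_(l <- words n) F (true :: l)).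
Proof. by rewrite /= big_cons big_cat !big_map. Qed.

Lemma tree_sum_words n x y z :
  \sum_(l <- words n) hfrak tau (region x y z l) = tree_sum tau n x y z.
Proof. by elim: n x y z => [|n IH] x y z; rewrite ?big_nil // sum_words !IH. Qed.

Lemma tree_norm_words n x y z :
  \sum_(l <- words n) cmod (hfrak tau (region x y z l)) = tree_norm tau n x y z.
Proof. by elim: n x y z => [|n IH] x y z; rewrite ?big_nil // sum_words !IH. Qed.

End WordSums.

Section Periods.
Variable R : realType.
Implicit Types w z : R[i].

Lemma cexpMn w n : cexp (w *+ n) = cexp w ^+ n.
Proof. by elim: n => [|n IH]; rewrite ?mulr0n ?cexp0 // mulrS exprS cexpD IH. Qed.

Lemma cexp_period (k : int) : cexp (k%:~R * (2 * pi) *i) = 1 :> R[i].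
Proof.
have c2 : cexp ((2 * pi) *i) = 1 :> R[i].
  by rewrite /cexp /= expR0 mul1r mulr_natl cos2pi sin2pi.
have cn n : cexp (n%:R * (2 * pi) *i) = 1 :> R[i].
  by rewrite mulr_natl cexpMn c2 expr1n.
case: k => n; first exact: cn.
rewrite NegzE mulrNz mulNr; have := cexpN_mul (n.+1%:R * (2 * pi : R) *i).
by rewrite cn mul1r.
Qed.

Lemma cexp_eq w z : cexp w = cexp z -> exists k : int, w = z + k%:~R * (2 * pi) *i.
Proof.
move=> e; have pi0 := pi_gt0 R.
pose v := w - z; have ev : cexp v = 1 by rewrite cexpD e cexpN_mul.
(* This multiple of [2 pi] moves the imaginary part of [v] into (-pi, pi], where [cexp] is
   injective. *)
pose m := Num.floor ((pi - Im v) / (2 * pi)).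
have pi2 : 0 < 2 * pi :> R by rewrite mulr_gt0.
have h1 : m%:~R <= (pi - Im v) / (2 * pi) by apply: floor_le.
have h2 : (pi - Im v) / (2 * pi) < m%:~R + 1 by rewrite -intrD1 floorD1_gt.
have ImE : Im (v + m%:~R * (2 * pi) *i) = Im v + m%:~R * (2 * pi).
  by case: (v) => a b; rewrite -(rmorph_int (real_complex R)) /= ; simpc.
exists (- m); suff : v + m%:~R * (2 * pi) *i = 0.
  by rewrite /v mulrNz mulNr => /eqP; rewrite addr_eq0 subr_eq => /eqP ->; rewrite addrC.
apply: cexp_inj.
- rewrite ImE; move: h1 h2; rewrite ler_pdivlMr // ltr_pdivrMr // => h1 h2.
  by apply/andP; split; lra.
- by rewrite /=; apply/andP; split; lra.
- by rewrite cexpD ev cexp_period mulr1 cexp0.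
Qed.

End Periods.

(** * Lower bounds for the terms, bounded and contracting fans *)

Section Bounds.
Variables (R : realType) (tau : R[i]).
Hypothesis tau2 : tau <> 2.
Hypothesis tauN2 : tau <> - 2.
Implicit Types x y z : R[i].

Lemma hfrak_definedP x : hfrak_defined tau x <-> regular tau x.
Proof.
have sq : sqrtc (tau + 2) ^+ 2 = tau + 2 by exact: sqr_sqrtc.
rewrite /regular -sq eqf_sqr negb_or; split.
  by move=> [/eqP-> /eqP-> /eqP->].
by move=> /andP[/eqP? /andP[/eqP? /eqP?]].
Qed.

(* [1 / (exp h_tau - 1)] is affine in [1 / h], and [|1 / h| <= |x|^2 + 2]. *)
Lemma hfrak_lower (M : R) : exists2 e, 0 < e &
  forall x, regular tau x -> cmod x <= M -> e <= cmod (hfrak tau x).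
Proof.
set eps := cexp (cacosh (- tau / 2)); have eps0 : eps != 0 by apply: cexp_neq0.
have D0 : 0 < cmod (eps - eps^-1).
  rewrite cmod_gt0 subr_eq0; apply/eqP => e.
  have : eps ^+ 2 == 1 by rewrite expr2 {1}e mulVf.
  by rewrite sqrf_eq1 (negPf (eps_neq1 tauN2)) (negPf (eps_neqN1 tau2)).
set D := cmod _ in D0; set E := cmod (eps^-1 - 1).
pose k := D / (M ^+ 2 + 2 + E + 1).
have E0 : 0 <= E by apply: cmod_ge0.
have den0 : 0 < M ^+ 2 + 2 + E + 1 by have := sqr_ge0 M; lra.
have k0 : 0 < k by rewrite divr_gt0.
have [d d0 hd] := cexp_near0 k0; exists d => // x rx xM.
rewrite leNgt; apply/negP => /hd; rewrite (cexp_hfrak rx); apply/negP; rewrite -leNgt.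
have x0 := regular_neq0 rx; have h0 := hfun_neq0 x0; have Q0 := gapQ_neq0 rx.
have e : gapP tau x / gapQ tau x - 1 = (eps - eps^-1) * (hfun x / gapQ tau x).
  apply: (mulIf Q0); rewrite mulrBl !divfK // mul1r -mulrA divfK // /gapP /gapQ -/eps.
  by ring.
rewrite e cmodM -/D ler_wpM2l ?(ltW D0) // cmod_div.
have Qle : cmod (gapQ tau x) <= (M ^+ 2 + 2 + E + 1) * cmod (hfun x).
  have inv : (hfun x)^-1 = x ^+ 2 * (1 - hfun x).
    apply: (mulfI h0); rewrite mulfV // mulrCA hfun_eq // mulfV // expf_neq0 //.
  have ci : cmod (hfun x)^-1 <= M ^+ 2 + 2.
    rewrite inv mulrBr mulr1; apply: (le_trans (cmodB _ _)).
    rewrite (cmodM (x ^+ 2)) cmodX.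
    have cx : 0 < cmod x by rewrite cmod_gt0.
    have := cmod_hfun x0; rewrite ler_pdivlMr ?exprn_gt0 // mulrC => h2.
    by apply: lerD => //; rewrite ler_pXn2r ?nnegrE //; lra.
  rewrite /gapQ -/eps; apply: (le_trans (cmodD _ _)); rewrite cmod1 cmodM -/E.
  have ch : 0 < cmod (hfun x) by rewrite cmod_gt0.
  have c1 : cmod (hfun x)^-1 * cmod (hfun x) = 1 by rewrite -cmodM mulVf ?cmod1.
  by have := ler_wpM2r (ltW ch) ci; rewrite c1; nra.
have cQ : 0 < cmod (gapQ tau x) by rewrite cmod_gt0.
by rewrite ler_pdivlMr // mulrC ler_pdivrMr // mulrC.
Qed.

(** For [|x| < 2] the quadratic form preserved by the recurrence is definite: it is at least
    [1 - |x|/2] times the sum of the two squares. *)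
Lemma real_fan_bounded (x : R) (p : nat -> R) : -2 < x < 2 ->
  (forall n, p n.+2 = x * p n.+1 - p n) ->
  exists C, forall n, `|p n| <= C.
Proof.
move=> /andP[x1 x2] rec.
pose c := p 1%N ^+ 2 + p 0%N ^+ 2 - x * p 1%N * p 0%N.
have inv n : p n.+1 ^+ 2 + p n ^+ 2 - x * p n.+1 * p n = c.
  by elim: n => // n <-; rewrite rec; ring.
pose k := 1 - `|x| / 2; have ax : `|x| < 2 by rewrite ltr_norml x1.
have k0 : 0 < k by rewrite /k; lra.
have c0 n : k * p n ^+ 2 <= c.
  rewrite -(inv n) /k; have [x0|x0] := leP 0 x.
    by rewrite ger0_norm //; have := sqr_ge0 (p n.+1 - p n); have := sqr_ge0 (p n.+1); nra.
  by rewrite ltr0_norm //; have := sqr_ge0 (p n.+1 + p n); have := sqr_ge0 (p n.+1); nra.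
(* The inequality [s <= 1 + s^2] replaces a square root. *)
exists (1 + c / k) => n; have := c0 n; rewrite mulrC -ler_pdivlMr // => h.
by rewrite -(real_normK (num_real (p n))) in h; have := normr_ge0 (p n); nra.
Qed.

(** As [x] is real, real and imaginary parts satisfy the recurrence separately. *)
Lemma fan_bounded x a b : -2 < x < 2 -> exists C, forall n, cmod (fan x a b n) <= C.
Proof.
case: x => x xi; rewrite !ltcE /= => /andP[/andP[/eqP xi0 x1] /andP[_ x2]].
have {xi0} xi0 : xi = 0 by move: xi0; rewrite !(oppr0, addr0).
rewrite {xi}xi0.
have xI : -2 < x < 2 by apply/andP; split; lra.
have rec n : fan (x +i* 0) a b n.+2 =
    (x * Re (fan (x +i* 0) a b n.+1) - Re (fan (x +i* 0) a b n)) +i*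
    (x * Im (fan (x +i* 0) a b n.+1) - Im (fan (x +i* 0) a b n)).
  rewrite fanSS; case: (fan _ _ _ n.+1) (fan _ _ _ n) => [? ?] [? ?] /=.
  by simpc.
have [C1 h1] : exists C, forall n, `|Re (fan (x +i* 0) a b n)| <= C.
  by apply: real_fan_bounded xI _ => n; rewrite rec.
have [C2 h2] : exists C, forall n, `|Im (fan (x +i* 0) a b n)| <= C.
  by apply: real_fan_bounded xI _ => n; rewrite rec.
exists (C1 + C2) => n; apply: (le_trans (cmod_le_ReIm _)).
exact: lerD (h1 n) (h2 n).
Qed.

(* On the contracting eigenline the fan tends to 0. *)
Lemma fan_contracting x a b : x != 0 -> ~ (- 2 < x < 2) -> x ^+ 2 = tau + 2 ->
  b = eig2 x * a -> exists n, forall m, (n <= m)%N -> cmod (fan x a b m) <= 2.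
Proof.
move=> x0 xI xmu ba.
(* Eigenvalues of modulus one would coincide and have square 1, which gives [x^2 = 4 = mu]. *)
have e1 : 1 < cmod (eig1 x).
  rewrite lt_neqAle; have /andP[_ ->] := cmod_eig x0; rewrite andbT eq_sym.
  apply/eqP => /(eig_unit x0)/(_ xI)[e2 sq].
  have := mu_neq4 tau2; rewrite -xmu -(eigD x) e2 => /eqP; apply.
  by rewrite (_ : (_ + _) ^+ 2 = 4 * eig1 x ^+ 2); [rewrite sq mulr1|ring].
have lin n : eig1 x ^+ n * fan x a b n = a.
  elim: n => [|n IH]; first by rewrite mul1r.
  have D0 : b - eig2 x * a = 0 by rewrite ba subrr.
  have := fan_eig1 a b x0 n; rewrite D0 mulr0 => /eqP.
  rewrite subr_eq0 => /eqP ->.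
  by rewrite exprSr mulrA -(mulrA _ (eig1 x)) eigM // mulr1.
exists (Num.bound (cmod a / (cmod (eig1 x) - 1))) => m nm.
have := congr1 (@cmod R) (lin m); rewrite cmodM cmodX => e.
have c1 : cmod a <= m%:R * (cmod (eig1 x) - 1).
  rewrite -ler_pdivrMr ?subr_gt0 //.
  apply: ltW; apply: (lt_le_trans (archi_boundP _)); last by rewrite ler_nat.
  by rewrite divr_ge0 ?cmod_ge0 // subr_ge0 ltW.
have := @bernoulli_ineq R (cmod (eig1 x) - 1) m; rewrite addrCA subrr addr0 => B.
have {}B := B (ltW _); move: B; rewrite subr_gt0 => /(_ e1) B.
have f0 := cmod_ge0 (fan x a b m); have a0 := cmod_ge0 a.
rewrite leNgt; apply/negP => f2.
have : cmod a < cmod (eig1 x) ^+ m * cmod (fan x a b m); last by rewrite e ltxx.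
by move: (cmod (eig1 x) ^+ m) B => q B; nra.
Qed.

End Bounds.

(** * The two directions of the equivalence *)

Section Main.
Variables (R : realType) (Gamma : groupType) (tau : R[i]).
Hypothesis tau2 : tau <> 2.
Hypothesis tauN2 : tau <> - 2.
Variable rho : Gamma -> 'M[R[i]]_2.
Hypothesis rhoP : SL2_rep rho.
Variables a b : Gamma.
Hypothesis bas : free_basis a b.
Hypothesis tau_ab : \tr (rho (a * b * a^-1 * b^-1)%g) = tau.

Let t g : R[i] := \tr (rho g).
Local Notation tc := (tr_curve rho).
Local Notation simple := (@simple_curves Gamma).

Lemma cmod_le2 (z : R[i]) : (`|z| <= 2) = (cmod z <= 2).
Proof. by rewrite cmodE -(rmorph_nat (real_complex R) 2) lecR. Qed.

Lemma fan_escape (M : R) u v : free_basis u v ->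
  finite_set [set c | simple c /\ cmod (tc c) <= M] ->
  exists N, forall n, (N <= n)%N -> M < cmod (fan (t u) (t v) (t (u * v)%g) n).
Proof.
move=> buv fin; have [N hN] := finite_escape id fin (fan_curve_inj buv).
exists N => n /hN no; rewrite ltNge; apply/negP => le; apply: no; split.
  exact: simple_fan.
by rewrite trE // tr_fan.
Qed.

Lemma summable_conditions :
  (forall c, simple c -> hfrak_defined tau (tc c)) ->
  summable simple (fun c => (Re `|hfrak tau (tc c)|)%:E) ->
  (forall c, simple c -> ~ (- 2 < tc c < 2)) /\
  finite_set [set c | simple c /\ `|tc c| <= 2].
Proof.
move=> def sm; have fin (M : R) : finite_set [set c | simple c /\ cmod (tc c) <= M].
  have [e e0 he] := hfrak_lower tau2 tauN2 M.
  apply: sub_finite_set (summable_finite e0 sm) => c [sc cM]; split=> //.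
  by apply: he => //; apply/hfrak_definedP/def.
split.
  move=> _ [u [v [buv ->]]]; rewrite trE // => xI.
  have [C hC] := fan_bounded (t v) (t (u * v)%g) xI.
  have [N hN] := fan_escape buv (fin C).
  by have := hN N (leqnn _); rewrite ltNge hC.
by apply: sub_finite_set (fin 2) => c [sc]; rewrite cmod_le2.
Qed.

Section Converse.
Hypothesis notin : forall c, simple c -> ~ (- 2 < tc c < 2).
Hypothesis fin : finite_set [set c | simple c /\ `|tc c| <= 2].

Let fin' : finite_set [set c | simple c /\ cmod (tc c) <= 2].
Proof. by apply: sub_finite_set fin => c [sc]; rewrite -cmod_le2. Qed.

(** If [x^2 = mu], the preserved form of the fan vanishes, so the fan starts on one of the two
    eigenlines. It then contracts along [u^n v], or along [u^-n v] on the other eigenline, against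
    the finiteness of the small traces. *)
Lemma simple_regular c : simple c -> regular tau (tc c).
Proof.
move=> sc; have [u [v [buv e]]] := sc; have xI := notin sc.
rewrite e trE // -/(t u) in xI *.
have x0 : t u != 0.
  by apply/eqP => u0; apply: xI; rewrite u0 oppr_lt0 ltr0n.
rewrite /regular x0 /=; apply/eqP => xmu.
have no (u' v' : Gamma) : free_basis u' v' -> t u' = t u ->
    t (u' * v')%g = eig2 (t u) * t v' -> False.
  move=> buv' tu' ev; have [n hn] := fan_contracting tau2 x0 xI xmu ev.
  have [N hN] := fan_escape buv' fin'; rewrite tu' in hN.
  have := hN (maxn n N) (leq_maxr _ _); rewrite ltNge => /negP; apply.
  by apply: hn; apply: leq_maxl.
have m := markoff_basis rhoP bas tau_ab buv; rewrite -!/(t _) in m.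
have w : t (u^-1 * v)%g = t u * t v - t (u * v)%g.
  by have := trM rhoP u v; rewrite -!/(t _) => ->; rewrite addrAC subrr add0r.
have d0 : (t (u * v)%g - eig2 (t u) * t v) * (t (u * v)%g - eig1 (t u) * t v) = 0.
  rewrite (eig_dispersion _ _ x0); move: m; rewrite /markoff w -xmu => m.
  transitivity (t u ^+ 2 + t v ^+ 2 + (t u * t v - t (u * v)%g) ^+ 2 -
    t u * t v * (t u * t v - t (u * v)%g) - t u ^+ 2); first by ring.
  by rewrite m subrr.
move/eqP: d0; rewrite mulf_eq0 !subr_eq0 => /orP[/eqP|/eqP] ev.
  exact: (no u v).
apply: (no u^-1%g v); first exact: free_basis_inv.
  exact: trV.
by rewrite w ev -{1}(eigD (t u)); ring.
Qed.

Lemma good_tree u v : free_basis u v ->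
  tree_good tau (t u) (t v) (t (u^-1 * v)%g).
Proof.
move=> buv.
have nodeE l : region (t u) (t v) (t (u^-1 * v)%g) l = tc (curve_of (node (u, v) l)).
  by rewrite trE // tr_node.
have su : simple (curve_of u) by exists u, v.
have sv : simple (curve_of v) by exists v, u; split=> //; apply: free_basis_swap.
have [N hN] := finite_escape size fin' (node_curve_inj buv).
apply: (@tree_good_all _ _ tau2 _ _ _ N).
- split; first exact: markoff_basis bas tau_ab _ _ buv.
  + by rewrite /t -trE //; apply: simple_regular.
  + by rewrite /t -trE //; apply: simple_regular.
  + by move=> l; rewrite nodeE; apply/simple_regular/simple_node.
- by rewrite /t -trE //; apply: notin.
- by rewrite /t -trE //; apply: notin.
- by move=> l; rewrite nodeE; apply/notin/simple_node.
- move=> l /hN no; rewrite nodeE ltNge; apply/negP => le; apply: no; split=> //.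
  exact: simple_node.
Qed.

(** The root edge [(a, b)] borders one tree on each side, with [z] and [x y - z] exchanged;
    [gapG_edge] combines the two limits with the terms of [a] and [b]. *)
Lemma conditions_identity :
  (forall c, simple c -> hfrak_defined tau (tc c)) /\
  exists s : R[i], abs_sum_to simple (fun c => hfrak tau (tc c)) s /\
    exists k : int, s = cacosh (- tau / 2) + k%:~R * (2 * pi) *i.
Proof.
split; first by move=> c /simple_regular/hfrak_definedP.
set x := t a; set y := t b; set z := t (a^-1 * b)%g.
have zV : t (a^-1^-1 * b)%g = x * y - z by rewrite invgK; apply: trS.
have [B1 G1] := good_tree bas; have [B2 G2] := good_tree (free_basis_inv bas).
have xV : t (a^-1)%g = x by apply: trV.
rewrite zV xV -/y in B2 G2; rewrite -/x -/y -/z in B1 G1.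
have [s1 h1] := tree_bounded_lim B1; have [s2 h2] := tree_bounded_lim B2.
have c1 := ctends_unique (ctends_cexp h1) G1; have c2 := ctends_unique (ctends_cexp h2) G2.
exists (hfrak tau x + hfrak tau y + (s1 + s2)); split.
  (* Stated for arbitrary [F], as it is applied both to the terms and to their moduli. *)
  have sumE (V : nmodType) (F : R[i] -> V) n :
      \sum_(c <- curves_upto a b n) F (tc c) = F x + F y +
      (\sum_(l <- words n) F (region x y z l) +
       \sum_(l <- words n) F (region x y (x * y - z) l)).
    rewrite /curves_upto !big_cat !big_cons big_nil !big_map !trE //. rewrite /= addr0.
    congr (_ + (_ + _)); apply: eq_bigr => l _; rewrite trE // tr_node //.
    by rewrite -!/(t _) zV xV.
  have [C1 hC1] := B1; have [C2 hC2] := B2.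
  apply: (@abs_sum_exhaust _ _ _ _ (curves_upto a b) _ _ _
    (cmod (hfrak tau x) + cmod (hfrak tau y) + (C1 + C2))).
  - by move=> n; apply: curves_upto_uniq.
  - exact: curves_upto_mono.
  - by move=> c; apply: curves_upto_exhaust.
  - move=> n; rewrite (sumE _ (fun w => cmod (hfrak tau w))) !tree_norm_words.
    by rewrite lerD2l lerD.
  apply: (ctends_ext (N := 0)); last exact: ctendsD (ctends_cst _) (ctendsD h1 h2).
  by move=> n _; rewrite (sumE _ (hfrak tau)) !tree_sum_words.
apply: cexp_eq; rewrite !cexpD c1 c2.
have m := markoff_basis rhoP bas tau_ab bas; rewrite -!/(t _) -/x -/y -/z in m.
have rx : regular tau x.
  by rewrite /x /t -trE //; apply: simple_regular; exists a, b.
have ry : regular tau y.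
  rewrite /y /t -trE //; apply: simple_regular; exists b, a; split=> //.
  exact: free_basis_swap.
exact: gapG_edge.
Qed.

End Converse.
End Main.

(* In [R[i]], [x < y] means [Im x = Im y /\ Re x < Re y], so that
   [-2 < z < 2] says that [z] lies in the real interval (-2, 2). *)
Theorem theorem1p6 (R : realType) (Gamma : groupType)
    (free_Gamma : free_of_rank2 Gamma)
    (tau : R[i]) (tau_neq2 : tau <> 2) (tau_neqN2 : tau <> - 2)
    (rho : Gamma -> 'M[R[i]]_2) (tau_rho : tau_rep tau rho) :
  let nu := cacosh (- tau / 2) in
  ((forall c, simple_curves c -> hfrak_defined tau (tr_curve rho c)) /\
   exists s : R[i],
     abs_sum_to (@simple_curves Gamma) (fun c => hfrak tau (tr_curve rho c)) s /\
     exists k : int, s = nu + k%:~R * (2 * pi) *i)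
  <->
  ((forall c, simple_curves c -> ~ (- 2 < tr_curve rho c < 2)) /\
   finite_set [set c | simple_curves c /\ `|tr_curve rho c| <= 2]).
Proof.
have [rhoP [a [b [bas tau_ab]]]] := tau_rho.
split=> [[def [s [[sm _] _]]]|[notin fin]].
  exact: (summable_conditions tau_neq2 tau_neqN2 rhoP def sm).
exact: (conditions_identity tau_neq2 rhoP bas tau_ab notin fin).
Qed.
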